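(* Let $\delta>0$, and for $h>0$ let $H_{\delta,h}$ be the operator $$H_{\delta,h}:=-h^2\frac{d^2}{dx^2}+V_\delta(x)$$ acting on $L^2(-1,1)$ with Dirichlet boundary conditions, where $V_\delta(x):=i(x-\delta)$ for $x<0$ and $V_\delta(x):=i(x+\delta)$ for $x>0$. Let $\Gamma_{\pm}:=\frac{1}{2\sqrt3}\pm\frac{i(1+2\delta)}{2}$ and define $S\subset\mathbb{C}$ to be the union of the line segments $$[i\delta,\Gamma_+],\quad[i(1+\delta),\Gamma_+],\quad[-i\delta,\Gamma_-],\quad[-i(1+\delta),\Gamma_-]$$ and the two horizontal half-lines $\{\Gamma_++r:r\ge 0\}$ and $\{\Gamma_-+r:r\ge 0\}$. Then for every $\varepsilon>0$ and every positive integer $N$ there exists $h_0>0$ such that for all $0<h<h_0$, $$\mathrm{Spec}(H_{\delta,h})\cap\{z\in\mathbb{C}:|z|\le N\}\subset\mathrm{Nhd}(S;\varepsilon).$$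
   Context: The domain of $H_{\delta,h}$ is $\{f\in C[-1,1]: f(-1)=f(1)=0,\ f'\in C[-1,1],\ f''\in L^2(-1,1)\}$. For $\alpha,\beta\in\mathbb{C}$, $[\alpha,\beta]$ denotes the line segment joining $\alpha$ and $\beta$. $\mathrm{Nhd}(S;\varepsilon):=\{s+z:s\in S,\ |z|<\varepsilon\}$. *)

(* Defs.v *)
(* The reals are an arbitrary [R : realType]; the complex numbers are [R[i]]. *)
From HB Require Import structures.
From mathcomp Require Import all_boot all_order all_algebra.
From mathcomp Require Import complex.
From mathcomp Require Import all_classical all_reals all_analysis.

Set Implicit Arguments.
Unset Strict Implicit.
Unset Printing Implicit Defensive.

Import Order.TTheory GRing.Theory Num.Theory numFieldNormedType.Exports.

Local Open Scope classical_set_scope.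
Local Open Scope complex_scope.
Local Open Scope ring_scope.

(* The R-valued projections of R[i], not the R[i]-valued 'Re and 'Im. *)
Local Notation Re := complex.Re.
Local Notation Im := complex.Im.

Section Operators.
Variable R : realType.

Local Notation mu := (@lebesgue_measure R).

Definition oI : set R := `]-1, 1[.
Definition cI : set R := `[-1, 1].

(* Elements of L^2(-1,1) are represented by functions on R, of which only the
   restriction to ]-1, 1[ matters; [ae_eqI] is equality in L^2(-1,1). *)
Definition ae_eqI (f g : R -> R[i]) : Prop :=
  {ae mu, forall x, oI x -> f x = g x}.

Definition L2normsq (f : R -> R[i]) : \bar R :=
  (\int[mu]_(x in oI) (Re (f x) ^+ 2 + Im (f x) ^+ 2)%:E)%E.

Definition L2norm (f : R -> R[i]) : R := Num.sqrt (fine (L2normsq f)).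

Definition L2 (f : R -> R[i]) : Prop :=
  [/\ measurable_fun oI (fun x => Re (f x)),
      measurable_fun oI (fun x => Im (f x)) &
      (L2normsq f < +oo)%E].

(* An operator in L^2(-1,1) is given by its graph: [T f k] means that f is in
   the domain of T and that k represents T f. *)
Definition operator := (R -> R[i]) -> (R -> R[i]) -> Prop.

(* z is in the resolvent set when T - z is injective, maps its domain onto
   L^2(-1,1), and has a bounded inverse. *)
Definition resolvent_set (T : operator) : set R[i] :=
  [set z | [/\
    forall f1 k1 f2 k2, T f1 k1 -> T f2 k2 ->
      ae_eqI (fun x => k1 x - z * f1 x) (fun x => k2 x - z * f2 x) ->
      ae_eqI f1 f2,
    forall g, L2 g ->
      exists f k, T f k /\ ae_eqI (fun x => k x - z * f x) g &
    exists C : R, forall f k, T f k ->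
      L2norm f <= C * L2norm (fun x => k x - z * f x)]].

Definition Spec (T : operator) : set R[i] := ~` resolvent_set T.

Definition continuous_cI (f : R -> R[i]) : Prop :=
  {within cI, continuous (fun x => Re (f x))} /\
  {within cI, continuous (fun x => Im (f x))}.

Definition deriv_on_oI (f f1 : R -> R[i]) : Prop :=
  forall x, oI x ->
    is_derive x (1 : R) (fun y => Re (f y)) (Re (f1 x)) /\
    is_derive x (1 : R) (fun y => Im (f y)) (Im (f1 x)).

(* f1 is absolutely continuous on [-1,1] with derivative f2, i.e. it is an
   indefinite Lebesgue integral of f2. *)
Definition ac_deriv (f1 f2 : R -> R[i]) : Prop :=
  forall a b : R, -1 <= a -> a <= b -> b <= 1 ->
    f1 b - f1 a = (\int[mu]_(t in `[a, b]) Re (f2 t))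
                  +i* (\int[mu]_(t in `[a, b]) Im (f2 t)).

(* f belongs to {f in C[-1,1] : f(-1) = f(1) = 0, f' in C[-1,1],
   f'' in L^2(-1,1)}, and f'' = f2. *)
Definition dom_snd_deriv (f f2 : R -> R[i]) : Prop :=
  [/\ continuous_cI f, f (-1) = 0, f 1 = 0, L2 f2 &
      exists f1, [/\ deriv_on_oI f f1, continuous_cI f1 & ac_deriv f1 f2]].

(* The value at 0 is irrelevant: {0} is a null set. *)
Definition Vdelta (delta x : R) : R[i] :=
  if x < 0 then (x - delta)*i
  else if 0 < x then (x + delta)*i
  else 0.

Definition Hop (delta h : R) : operator := fun f k =>
  L2 k /\
  exists2 f2, dom_snd_deriv f f2 &
    ae_eqI k (fun x => - (h ^+ 2)%:C * f2 x + Vdelta delta x * f x).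

End Operators.

Section Plane.
Variable R : realType.

Definition segment (a b : R[i]) : set R[i] :=
  [set z | exists2 t : R, 0 <= t <= 1 & z = (1 - t)%:C * a + t%:C * b].

Definition halfline (a : R[i]) : set R[i] :=
  [set z | exists2 r : R, 0 <= r & z = a + r%:C].

Definition Nhd (A : set R[i]) (eps : R) : set R[i] :=
  [set w | exists s z, [/\ A s, `|z| < eps%:C & w = s + z]].

Definition Gammap (delta : R) : R[i] :=
  (1 / (2 * Num.sqrt 3)) +i* ((1 + 2 * delta) / 2).

Definition Gammam (delta : R) : R[i] :=
  (1 / (2 * Num.sqrt 3)) -i* ((1 + 2 * delta) / 2).

Definition Sset (delta : R) : set R[i] :=
  segment (delta*i) (Gammap delta) `|`
  segment ((1 + delta)*i) (Gammap delta) `|`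
  segment ((- delta)*i) (Gammam delta) `|`
  segment ((- (1 + delta))*i) (Gammam delta) `|`
  halfline (Gammap delta) `|`
  halfline (Gammam delta).

End Plane.

(* Main.v *)
(** Let u solve - h^2 u'' + V u = z u with u(-1) = 0 and u'(-1) = 1.  By variation
    of constants, z is in the resolvent set unless u(1) = 0.

    On the right half V is affine, so u continues to an entire function of x and
    can be followed from x = 1, where it vanishes, to x = 0 along any complex
    path.  If V - z does not vanish on the path and the real part of the WKB phase
    is strictly monotone along it, then only one WKB component survives at x = 0
    when h is small, that is h^2 u'(0)^2 ~ (i delta - z) u(0)^2.  In terms of
    p = sqrt(V - z) the real part of the phase is a multiple of Im p^3, and such a
    path exists whenever z avoids the part of S in the upper half-plane.
    Compactness makes the estimate uniform in z.

    The symmetry x -> - x, z -> conj z gives h^2 u'(0)^2 ~ (- i delta - z) u(0)^2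
    from the left half.  The two right-hand sides differ by 2 i delta u(0)^2, so
    u(0) = 0, hence u'(0) = 0 and u = 0: z is not in the spectrum.

    The analytic continuation is replaced by Taylor polynomials at x = 1, which
    solve the equation up to an arbitrarily small residual, and the size of the
    decaying WKB component is controlled by a Lyapunov function. *)
Require Import Defs.
From HB Require Import structures.
From mathcomp Require Import all_boot all_order all_algebra.
From mathcomp Require Import complex.
From mathcomp Require Import all_classical all_reals all_analysis.
From mathcomp Require Import ring lra.

Set Implicit Arguments.
Unset Strict Implicit.
Unset Printing Implicit Defensive.

Import Order.TTheory GRing.Theory Num.Theory numFieldNormedType.Exports.

Local Open Scope classical_set_scope.
Local Open Scope complex_scope.
Local Open Scope ring_scope.

Local Notation Re := complex.Re.
Local Notation Im := complex.Im.


(** * Complex-valued functions of a real variable *)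

Section ComplexDerivative.
Variable R : realType.
Implicit Types (f g : R -> R[i]) (z w : R[i]) (t x : R).

(** Using p as the coordinate removes all branch questions: x is a quadratic polynomial in p, the
    turning point is p = 0, and the phase, the integral of p dx, is a multiple of p^3. The plane
    splits into six sectors of opening pi/3, bounded by the rays on which Im p^3 = 0. Since the
    conclusion involves only p0^2, either root may be taken at each end; choosing the signs amounts
    to choosing the side on which the path passes the turning point.

    The shape of S can be read off from this. On a segment of S, Im p^3 vanishes at one end of the
    half interval, as it does at the turning point; on the half-line it is equal at both ends.

    The order of choices matters. The path constants [c] and [M] come first and fix how small h must
    be; only then are h, z and the solution given, and the polynomial is chosen last. Its degree may
    therefore depend on h: the decay estimate has constants independent of the polynomial, and the
    residual tends to 0 with everything else fixed. *)

Lemma eqC z w : Re z = Re w -> Im z = Im w -> z = w.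
Proof. by case: z => a b; case: w => c d /= -> ->. Qed.

Lemma ReM z w : Re (z * w) = Re z * Re w - Im z * Im w.
Proof. by case: z => a b; case: w. Qed.

Lemma ImM z w : Im (z * w) = Re z * Im w + Im z * Re w.
Proof. by case: z => a b; case: w. Qed.

Lemma ReD z w : Re (z + w) = Re z + Re w.
Proof. by case: z => a b; case: w. Qed.

Lemma ImD z w : Im (z + w) = Im z + Im w.
Proof. by case: z => a b; case: w. Qed.

Lemma ReN z : Re (- z) = - Re z.
Proof. by case: z. Qed.

Lemma ImN z : Im (- z) = - Im z.
Proof. by case: z. Qed.

Lemma is_derive_mul (f g : R -> R) x df dg :
  is_derive x (1 : R) f df -> is_derive x (1 : R) g dg ->
  is_derive x (1 : R) (fun t => f t * g t) (df * g x + f x * dg).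
Proof.
move=> hf hg; have := is_deriveM hf hg.
by rewrite /GRing.scale /= => h; apply: is_derive_eq h _; ring.
Qed.

Lemma is_derive_add (f g : R -> R) x df dg :
  is_derive x (1 : R) f df -> is_derive x (1 : R) g dg ->
  is_derive x (1 : R) (fun t => f t + g t) (df + dg).
Proof. by move=> hf hg; exact: is_deriveD hf hg. Qed.

Lemma is_derive_opp (f : R -> R) x df :
  is_derive x (1 : R) f df -> is_derive x (1 : R) (fun t => - f t) (- df).
Proof. by move=> hf; exact: is_deriveN hf. Qed.

Lemma is_derive_inv (f : R -> R) x df : f x != 0 ->
  is_derive x (1 : R) f df ->
  is_derive x (1 : R) (fun t => (f t)^-1) (- df / f x ^+ 2).
Proof.
move=> f0 hf; have := is_deriveV f0 hf.
by rewrite /GRing.scale /= => h; apply: is_derive_eq h _; field.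
Qed.

Definition cderiv f x (d : R[i]) :=
  is_derive x (1 : R) (fun t => Re (f t)) (Re d) /\
  is_derive x (1 : R) (fun t => Im (f t)) (Im d).

Lemma cderiv_eq f x d d' : cderiv f x d -> d = d' -> cderiv f x d'.
Proof. by move=> h <-. Qed.

Lemma cderiv_cst z x : cderiv (fun=> z) x 0.
Proof. by split; exact: is_derive_cst. Qed.

Lemma cderivD f g x df dg : cderiv f x df -> cderiv g x dg ->
  cderiv (fun t => f t + g t) x (df + dg).
Proof.
move=> [f1 f2] [g1 g2]; split.
  rewrite (_ : (fun t => _) = (fun t => Re (f t) + Re (g t))).
    by rewrite ReD; exact: is_derive_add.
  by apply/funext => t; rewrite ReD.
rewrite (_ : (fun t => _) = (fun t => Im (f t) + Im (g t))).
  by rewrite ImD; exact: is_derive_add.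
by apply/funext => t; rewrite ImD.
Qed.

Lemma cderivM f g x df dg : cderiv f x df -> cderiv g x dg ->
  cderiv (fun t => f t * g t) x (df * g x + f x * dg).
Proof.
move=> [f1 f2] [g1 g2]; split.
  rewrite (_ : (fun t => _) =
      (fun t => Re (f t) * Re (g t) + - (Im (f t) * Im (g t)))).
    apply: (@is_derive_eq _ _ _ _ _ _ _ _
      (is_derive_add (is_derive_mul f1 g1) (is_derive_opp (is_derive_mul f2 g2)))).
    by rewrite ReD !ReM; ring.
  by apply/funext => t; rewrite ReM.
rewrite (_ : (fun t => _) =
    (fun t => Re (f t) * Im (g t) + Im (f t) * Re (g t))).
  apply: (@is_derive_eq _ _ _ _ _ _ _ _
      (is_derive_add (is_derive_mul f1 g2) (is_derive_mul f2 g1))).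
  by rewrite ImD !ImM; ring.
by apply/funext => t; rewrite ImM.
Qed.

Lemma cderivMl z g x dg : cderiv g x dg -> cderiv (fun t => z * g t) x (z * dg).
Proof.
move=> hg; apply: cderiv_eq (cderivM (cderiv_cst z x) hg) _.
by rewrite mul0r add0r.
Qed.

Lemma cderivN f x df : cderiv f x df -> cderiv (fun t => - f t) x (- df).
Proof.
move=> hf; rewrite -mulN1r (_ : (fun t => _) = (fun t => -1 * f t)).
  exact: cderivMl.
by apply/funext => t; rewrite mulN1r.
Qed.

Lemma cderivB f g x df dg : cderiv f x df -> cderiv g x dg ->
  cderiv (fun t => f t - g t) x (df - dg).
Proof. by move=> hf hg; exact: cderivD hf (cderivN hg). Qed.

Lemma cderiv_real (f : R -> R) x df : is_derive x (1 : R) f df ->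
  cderiv (fun t => (f t)%:C) x df%:C.
Proof. by move=> hf; split => //=; exact: is_derive_cst. Qed.

Lemma cderiv_id x : cderiv (fun t => t%:C) x 1.
Proof. exact: (cderiv_real (is_derive_id _ _)). Qed.

Lemma cderiv_horner (p : {poly R[i]}) f x df : cderiv f x df ->
  cderiv (fun t => p.[f t]) x (p^`().[f x] * df).
Proof.
move=> hf; elim/poly_ind: p => [|p c IH].
  rewrite deriv0 horner0 mul0r (_ : (fun t => _) = (fun=> 0)).
    exact: cderiv_cst.
  by apply/funext => t; rewrite horner0.
rewrite (_ : (fun t => _) = (fun t => p.[f t] * f t + c)); last first.
  by apply/funext => t; rewrite !hornerE.
apply: cderiv_eq (cderivD (cderivM IH hf) (cderiv_cst c x)) _.
by rewrite derivD derivM derivX derivC !hornerE; ring.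
Qed.

(** The squared modulus as an element of [R]: the norm of [R[i]] is [R[i]]-valued, and a polynomial
    in the components can be differentiated and passed to [nra]. *)
Definition nsq z : R := Re z ^+ 2 + Im z ^+ 2.

Lemma nsq_ge0 z : 0 <= nsq z.
Proof. by rewrite addr_ge0 // sqr_ge0. Qed.

Lemma nsq_eq0 z : nsq z = 0 -> z = 0.
Proof.
case: z => a b; rewrite /nsq /= => h.
have a0 : a = 0 by nra.
have b0 : b = 0 by nra.
by rewrite a0 b0.
Qed.

Lemma nsqM z w : nsq (z * w) = nsq z * nsq w.
Proof. by rewrite /nsq ReM ImM; ring. Qed.

Lemma nsqN z : nsq (- z) = nsq z.
Proof. by case: z => a b; rewrite /nsq /=; ring. Qed.

Lemma nsqB z w : nsq (z - w) = nsq (w - z).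
Proof. by rewrite -nsqN opprB. Qed.

Lemma nsqD_le z w : nsq (z + w) <= 2 * nsq z + 2 * nsq w.
Proof.
case: z => a b; case: w => c d; rewrite /nsq /=.
have := sqr_ge0 (a - c); have := sqr_ge0 (b - d); nra.
Qed.

Lemma nsq_real (a : R) : nsq a%:C = a ^+ 2.
Proof. by rewrite /nsq /= expr0n addr0. Qed.

Lemma nsq_i : nsq 'i%C = 1.
Proof. by rewrite /nsq /= expr0n expr1n add0r. Qed.

Lemma nsq0 : nsq 0 = 0.
Proof. by rewrite /nsq /= expr0n addr0. Qed.

Lemma is_derive_nsq f x df : cderiv f x df ->
  is_derive x (1 : R) (fun t => nsq (f t))
    (2 * (Re (f x) * Re df + Im (f x) * Im df)).
Proof.
move=> [h1 h2]; rewrite /nsq.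
rewrite (_ : (fun t => _) =
  (fun t => Re (f t) * Re (f t) + Im (f t) * Im (f t))).
  apply: (@is_derive_eq _ _ _ _ _ _ _ _
      (is_derive_add (is_derive_mul h1 h1) (is_derive_mul h2 h2))).
  by ring.
by apply/funext => t; rewrite !expr2.
Qed.

End ComplexDerivative.

(** * WKB components along a path in the complex plane *)

Section Lyapunov.
Variable R : realType.
Implicit Types (f g : R -> R[i]) (z w p : R[i]) (t x : R) (T : {poly R[i]}).

Lemma le0_derive_le (f df : R -> R) (a b : R) : a <= b ->
  (forall x, a < x < b -> is_derive x (1 : R) f (df x)) ->
  {within `[a, b], continuous f} ->
  (forall x, a < x < b -> df x <= 0) -> f b <= f a.
Proof.
rewrite le_eqVlt => /predU1P[-> //|ab] hd hc hle.
have [x xab e] : exists2 c, c \in `]a, b[%R & f b - f a = df c * (b - a).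
  by apply: MVT => // x; rewrite in_itv; exact: hd.
rewrite -subr_le0 e; apply: mulr_le0_ge0; last by rewrite subr_ge0 ltW.
by apply: hle; move: xab; rewrite in_itv.
Qed.

Lemma cderiv_continuous_Re f t d : cderiv f t d ->
  {for t, continuous (fun x => Re (f x))}.
Proof. by move=> [h _]; apply: differentiable_continuous; apply/derivable1_diffP. Qed.

Lemma cderiv_continuous_Im f t d : cderiv f t d ->
  {for t, continuous (fun x => Im (f x))}.
Proof. by move=> [_ h]; apply: differentiable_continuous; apply/derivable1_diffP. Qed.

Lemma pointwise_within_continuous (f : R -> R) (a b : R) :
  (forall x, a <= x <= b -> {for x, continuous f}) ->
  {within `[a, b], continuous f}.
Proof.
move=> h; apply: continuous_in_subspaceT => x; rewrite inE /= in_itv /=.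
exact: h.
Qed.

(* A path from [p1] to [p0] in the plane of p = sqrt(V - z), along which
   Im p^3, i.e. the real part of the WKB phase, increases. *)
Definition bpiece (c M : R) (p1 p0 : R[i]) := exists p pd : R -> R[i],
  [/\ p 0 = p1, p 1 = p0 & forall t : R, 0 <= t <= 1 ->
    [/\ cderiv p t (pd t), c <= Im (p t * p t * pd t), c <= nsq (p t),
        nsq (p t) <= M & nsq (pd t) <= M]].

(* The point v = x - 1 where i(x + delta) - z = p^2, if the left-hand side is
   [P1] at x = 1. *)
Definition vpt (P1 p : R[i]) := - 'i%C * (p * p - P1).

(** The two factors of the leading-order WKB splitting. Along a path p(t) the point moves with v' =
    - 2 i p p', so they grow and decay at the rates q / h and - q / h with q = - 2 i p^2 p', whose
    real part is 2 Im (p^2 p'). *)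
Definition wkbp (h : R) T P1 p := h%:C * T^`().[vpt P1 p] + p * T.[vpt P1 p].
Definition wkbm (h : R) T P1 p := h%:C * T^`().[vpt P1 p] - p * T.[vpt P1 p].

(** The left-hand side is the derivative of |b|^2 - th |a|^2 when th' = - (1 - eta). The smallness
    of h makes the growth rate X = 2 Re q / h at least (2 + 2 L) / eta; hence even after
    multiplication by th >= eta, the growth of |a|^2 absorbs the coupling terms and the decrease of
    th. *)
Lemma lyapunov_ineq (q w w' a b a' b' : R[i]) (h c L eta th G : R) :
  0 < h -> 0 < c -> 0 <= L -> 0 < eta -> eta <= th -> th <= 1 -> 0 <= G ->
  2 * c <= Re q -> h * (2 + 2 * L) <= 4 * c * eta ->
  nsq w <= L * (nsq a + nsq b) + G -> nsq w' <= L * (nsq a + nsq b) + G ->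
  a' = h^-1%:C * q * a + w -> b' = - (h^-1%:C * q * b) + w' ->
  2 * (Re b * Re b' + Im b * Im b')
   - (th * (2 * (Re a * Re a' + Im a * Im a')) - (1 - eta) * nsq a) <= 2 * G.
Proof.
move=> h0 c0 L0 e0 eth th1 G0 qc hc hw hw' Ea Eb.

have hb : 2 * (Re b * Re b' + Im b * Im b') <=
    - (2 * Re q / h) * nsq b + nsq b + nsq w'.
  have -> : 2 * (Re b * Re b' + Im b * Im b') =
     - (2 * Re q / h) * nsq b + 2 * (Re b * Re w' + Im b * Im w').
    by rewrite Eb /nsq !(ReD, ImD, ReN, ImN, ReM, ImM) /=; ring.
  rewrite -addrA lerD2l /nsq.
  have := sqr_ge0 (Re b - Re w'); have := sqr_ge0 (Im b - Im w'); nra.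
have ha : 2 * Re q / h * nsq a - nsq a - nsq w <=
    2 * (Re a * Re a' + Im a * Im a').
  have -> : 2 * (Re a * Re a' + Im a * Im a') =
     2 * Re q / h * nsq a + 2 * (Re a * Re w + Im a * Im w).
    by rewrite Ea /nsq !(ReD, ImD, ReM, ImM) /=; ring.
  rewrite -addrA lerD2l /nsq.
  have := sqr_ge0 (Re a + Re w); have := sqr_ge0 (Im a + Im w); nra.
set X := 2 * Re q / h in ha hb.
have hX : 2 + 2 * L <= eta * X.
  rewrite /X mulrA ler_pdivlMr //.
  have : eta * (2 * c) <= eta * Re q by rewrite ler_pM2l.
  nra.
have X1 : eta * X <= X.
  rewrite ler_piMl //; last exact: le_trans eth th1.
  by rewrite -(pmulr_rge0 X e0); apply: le_trans hX; nra.
have X0 : 0 <= X by rewrite -(pmulr_rge0 X e0); apply: le_trans hX; nra.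
have thX : eta * X <= th * X by rewrite ler_wpM2r.
have A0 := nsq_ge0 a; have B0 := nsq_ge0 b.
have th0 : 0 <= th by lra.
have := ler_wpM2l th0 ha.
move: (nsq a) (nsq b) (nsq w) (nsq w') A0 B0 hw hw' hb
  => A B W W' A0 B0 hw hw' hb hta.
have hW : th * W <= L * (A + B) + G.
  have LG : 0 <= L * (A + B) + G by rewrite addr_ge0 // mulr_ge0 // addr_ge0.
  apply: le_trans (_ : th * (L * (A + B) + G) <= _); first by rewrite ler_wpM2l.
  by rewrite ler_piMl.
have k1 : (2 + 2 * L) * A <= th * X * A.
  by rewrite ler_wpM2r //; exact: le_trans thX.
have k2 : (1 + 2 * L) * B <= X * B by rewrite ler_wpM2r //; lra.
have k3 : th * A <= A by rewrite ler_piMl.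
have k4 : 0 <= eta * A by rewrite mulr_ge0 // ltW.
nra.
Qed.

(** The components a and b are coupled only through p' T and the residual. Since a - b = 2 p T, the
    lower bound on |p|^2 controls the coupling by M / c: this is where the path has to avoid the
    turning point. The slack [e1] allows a second piece to start where the first one ended. *)
Lemma piece_decay (c M eta h e e1 : R) T (P1 p1 p0 : R[i]) :
  0 < c -> 0 < M -> 0 < eta -> eta <= 1 -> 0 < h -> h <= 1 -> 0 <= e ->
  h * (2 + 2 * (M / c)) <= 4 * c * eta ->
  (forall v, nsq v <= 2 * M ^+ 2 + 2 * nsq P1 ->
     nsq (T^`()^`().[v] - (h ^- 2)%:C * (P1 + 'i%C * v) * T.[v]) <= e) ->
  bpiece c M p1 p0 ->
  nsq (wkbm h T P1 p1) <= nsq (wkbp h T P1 p1) + e1 ->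
  nsq (wkbm h T P1 p0) <= eta * nsq (wkbp h T P1 p0) + e1 + 16 * M ^+ 2 * e.
Proof.
move=> c0 M0 eta0 eta1 h0 h1 e0 hc hT [p [pd [pE1 pE0 hp]]].
pose v t := vpt P1 (p t).
pose U t := T.[v t]; pose U1 t := T^`().[v t].
pose a t := wkbp h T P1 (p t); pose b t := wkbm h T P1 (p t).
pose res t := T^`()^`().[v t] - (h ^- 2)%:C * (P1 + 'i%C * v t) * T.[v t].
pose er t := - (2%:R * 'i%C) * p t * pd t * h%:C * res t.
pose q t := - (2%:R * 'i%C) * (p t * p t * pd t).
pose da t := h^-1%:C * q t * a t + (pd t * U t + er t).
pose db t := - (h^-1%:C * q t * b t) + (- (pd t * U t) + er t).
have hh : h%:C * h^-1%:C = 1 :> R[i].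
  by rewrite -rmorphM /= divff // gt_eqF.
have ivE t : P1 + 'i%C * v t = p t * p t.
  rewrite /v /vpt; have := sqr_i R; move: 'i%C => j jj.   ring: jj.
have dv t : 0 <= t <= 1 -> cderiv v t (- (2%:R * 'i%C) * p t * pd t).
  move=> /hp[dp _ _ _ _].
  apply: cderiv_eq (cderivMl (- 'i%C)
     (cderivB (cderivM dp dp) (cderiv_cst P1 t))) _.
  by rewrite subr0; ring.
have dab t : 0 <= t <= 1 -> cderiv a t (da t) /\ cderiv b t (db t).
  move=> t01; have dvt := dv t t01; have [dp _ _ _ _] := hp t t01.
  have dU := cderiv_horner T dvt; have dU1 := cderiv_horner T^`() dvt.
  have hres : T^`()^`().[v t] = res t + (h^-1%:C * h^-1%:C) * (p t * p t) * T.[v t].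
    rewrite /res ivE (_ : (h ^- 2)%:C = h^-1%:C * h^-1%:C); first by ring.
    by rewrite -exprVn expr2 rmorphM.
  split.
    apply: cderiv_eq (cderivD (cderivMl h%:C dU1) (cderivM dp dU)) _.
    rewrite hres /da /a /wkbp -/(v t) -/(U t) -/(U1 t) /er /q.
    by ring: hh.
  apply: cderiv_eq (cderivB (cderivMl h%:C dU1) (cderivM dp dU)) _.
  rewrite hres /db /b /wkbm -/(v t) -/(U t) -/(U1 t) /er /q.
  by ring: hh.
(* The inequality |b|^2 <= th |a|^2 is an equality at the starting point and is
   propagated, up to the residual, while th decreases to eta. *)
pose th t := 1 - (1 - eta) * t.
pose G := 8 * M ^+ 2 * e.
have nsqi := nsq_i R.
have nsq2 : nsq (2%:R : R[i]) = 4.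
  by rewrite (_ : 2%:R = (2%:R : R)%:C) ?nsq_real ?rmorph_nat //; ring.
pose Y t := nsq (b t) + - (th t * nsq (a t)) + - (2 * G * t).
have Yle : Y 1 <= Y 0.
  pose dY t := 2 * (Re (b t) * Re (db t) + Im (b t) * Im (db t))
   + - (- (1 - eta) * nsq (a t)
       + th t * (2 * (Re (a t) * Re (da t) + Im (a t) * Im (da t))))
   + - (2 * G).
  have hY t : 0 <= t <= 1 -> is_derive t (1 : R) Y (dY t).
    move=> t01; have [dat dbt] := dab t t01.
    have dth : is_derive t (1 : R) th (- (1 - eta)).
      apply: is_derive_eq (is_derive_add (is_derive_cst (1 : R) _ _)
        (is_derive_opp (is_derive_mul (is_derive_cst (1 - eta) _ _)
           (is_derive_id t (1 : R))))) _.
      by rewrite /=; ring.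
    apply: is_derive_eq (is_derive_add (is_derive_add (is_derive_nsq dbt)
       (is_derive_opp (is_derive_mul dth (is_derive_nsq dat))))
       (is_derive_opp (is_derive_mul (is_derive_cst (2 * G) _ _)
           (is_derive_id t (1 : R))))) _.
    by rewrite /dY /=; ring.
  apply: (@le0_derive_le _ dY _ _ ler01).
  - by move=> t /andP[t0 t1]; apply: hY; rewrite !ltW.
  - apply: pointwise_within_continuous => t t01.
    by apply: differentiable_continuous; apply/derivable1_diffP; case: (hY t t01).
  move=> t /andP[t0 t1]; have t01 : 0 <= t <= 1 by rewrite !ltW.
  have [_ hq hpc hpM hpdM] := hp t t01.
  have n4U : 4 * nsq (p t) * nsq (U t) = nsq (a t - b t).
    have -> : a t - b t = 2%:R * p t * U t.
      by rewrite /a /b /wkbp /wkbm -/(v t) -/(U t); ring.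
    by rewrite !nsqM nsq2.
  have nU : 2 * c * nsq (U t) <= nsq (a t) + nsq (b t).
    have := nsqD_le (a t) (- b t); rewrite nsqN -n4U.
    have := nsq_ge0 (U t); nra.
  have npdU : 2 * nsq (pd t * U t) <= M / c * (nsq (a t) + nsq (b t)).
    rewrite nsqM mulrAC ler_pdivlMr //.
    rewrite [X in X <= _](_ : _ = nsq (pd t) * (2 * c * nsq (U t))); last by ring.
    by apply: ler_pM => //; rewrite ?nsq_ge0 // !mulr_ge0 ?nsq_ge0 // ltW.
  have ner : 2 * nsq (er t) <= G.
    have nres : nsq (res t) <= e.
      apply: hT; rewrite /v /vpt nsqM nsqN nsqi mul1r.
      apply: le_trans (nsqD_le _ _) _; rewrite nsqN nsqM lerD2r ler_pM2l //.
      by rewrite expr2 ler_pM ?nsq_ge0.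
    have h2 : h ^+ 2 <= 1 by rewrite expr_le1 // ltW.
    have pp : nsq (p t) * nsq (pd t) <= M ^+ 2.
      by rewrite expr2 ler_pM ?nsq_ge0.
    rewrite /er /G !nsqM nsqN nsqM nsqi nsq2 nsq_real mulr1.
    rewrite [X in X <= _](_ : _ =
      8 * (nsq (p t) * nsq (pd t)) * (h ^+ 2 * nsq (res t))); last by ring.
    have hr : h ^+ 2 * nsq (res t) <= e.
      by rewrite -[e]mul1r; apply: ler_pM; rewrite ?nsq_ge0 ?sqr_ge0.
    apply: ler_pM => //; rewrite ?ler_pM2l //.
      by rewrite !mulr_ge0 ?nsq_ge0.
    by rewrite mulr_ge0 ?nsq_ge0 ?sqr_ge0.
  have w1 : nsq (pd t * U t + er t) <= M / c * (nsq (a t) + nsq (b t)) + G.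
    by apply: le_trans (nsqD_le _ _) _; exact: lerD.
  have w2 : nsq (- (pd t * U t) + er t) <= M / c * (nsq (a t) + nsq (b t)) + G.
    by apply: le_trans (nsqD_le _ _) _; rewrite nsqN; exact: lerD.
  have G0 : 0 <= G by rewrite /G !mulr_ge0 // ltW.
  have L0 : 0 <= M / c by rewrite divr_ge0 // ltW.
  have th1 : th t <= 1 by rewrite /th; nra.
  have theta : eta <= th t by rewrite /th; nra.
  have req : 2 * c <= Re (q t).
    have -> : Re (q t) = 2 * Im (p t * p t * pd t).
      by rewrite /q; case: (p t * p t * pd t) => x y /=; ring.
    by rewrite ler_pM2l.
  have := lyapunov_ineq h0 c0 L0 eta0 theta th1 G0 req hc w1 w2 erefl erefl.
  by rewrite -/(da t) -/(db t) /dY; lra.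
rewrite -/(a 0) -pE1 -pE0 -/(a 0) -/(b 0) -/(a 1) -/(b 1) => h01.
move: Yle; rewrite /Y /th !mulr0 !mulr1 /G.
lra.
Qed.

End Lyapunov.

(** * Approximation of solutions by polynomials *)

Section TaylorApproximation.
Variable R : realType.

(** Beyond an index J >= 2 K the factor on the left is at least 2 K, so a common bound for two
    earlier terms passes to the next one. The sum of the first J + 3 terms serves as that bound. *)
Lemma linear_recurrence_bounded (A : nat -> R) (K : R) : 0 <= K ->
  (forall j, 0 <= A j) ->
  (forall j, (j.+3%:R * j.+2%:R) ^+ 2 * A j.+3 <= K * (A j.+1 + A j)) ->
  exists C, forall j, A j <= C.
Proof.
move=> K0 A0 hA.
have [J hJ] : exists J : nat, 2 * K <= J%:R.
  exists (Num.truncn (2 * K)).+1; apply: ltW; exact: truncnS_gt.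
pose C := \sum_(i < J.+3) A i.
have hC i : (i < J.+3)%N -> A i <= C.
  move=> iJ; rewrite /C (bigD1 (Ordinal iJ)) //= lerDl.
  by apply: sumr_ge0 => k _.
have C0 : 0 <= C by apply: sumr_ge0.
exists C => j; elim/ltn_ind: j => j IH.
have [/hC //|] := ltnP j J.+3.
case: j IH => [|[|[|j]]] // IH; rewrite !ltnS => Jj.
have h1 := IH j.+1 (leqnSn _); have h2 := IH j (leqW (leqnSn _)).
have := hA j.
have b1 : 1 <= j.+2%:R :> R by rewrite ler1n.
have b2 : J%:R <= j.+3%:R :> R by rewrite ler_nat; do 3!apply: leqW.
have b3 : 1 <= j.+3%:R :> R by rewrite ler1n.
have b4 : 2 * K <= (j.+3%:R * j.+2%:R) ^+ 2.
  apply: le_trans (le_trans hJ b2) _; rewrite exprMn.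
  apply: le_trans (_ : j.+3%:R ^+ 2 <= _); first by rewrite expr2 ler_peMr //; lra.
  by rewrite ler_peMr ?sqr_ge0 // exprn_ege1.
have b5 : 0 < (j.+3%:R * j.+2%:R : R) ^+ 2 by rewrite exprn_gt0 ?mulr_gt0.
move: (_ ^+ 2) b4 b5 => X hX X0 hXA.
rewrite -(ler_pM2l X0); apply: le_trans hXA _.
apply: le_trans (_ : 2 * K * C <= _); last by rewrite ler_wpM2r.
by rewrite [2 * K]mulrC -mulrA ler_wpM2l //; lra.
Qed.

Section Coefficients.
Variables (k P1 s : R[i]).

(* Three consecutive Taylor coefficients at v = 0 of the solution of
   T'' = k (P1 + i v) T with T(0) = 0 and T'(0) = s. *)
Fixpoint airy_state (n : nat) : R[i] * R[i] * R[i] :=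
  if n is m.+1 then let: (a, b, c) := airy_state m in
    (b, c, k * (P1 * b + 'i%C * a) / (m.+3%:R * m.+2%:R))
  else (0, s, 0).

Definition airy_coef n := (airy_state n).1.1.

Lemma airy_stateE n :
  airy_state n = (airy_coef n, airy_coef n.+1, airy_coef n.+2).
Proof. by rewrite /airy_coef /=; case: (airy_state n) => [[a b] c]. Qed.

Lemma airy_coef_rec n : airy_coef n.+3 * (n.+3%:R * n.+2%:R) =
  k * (P1 * airy_coef n.+1 + 'i%C * airy_coef n).
Proof.
rewrite {1}/airy_coef [airy_state n.+3]/=.
by rewrite airy_stateE /= divfK // mulf_neq0 // pnatr_eq0.
Qed.

Definition airy_poly n : {poly R[i]} := \sum_(j < n) airy_coef j *: 'X^j.

Lemma airy_polyS n : airy_poly n.+1 = airy_poly n + airy_coef n *: 'X^n.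
Proof. by rewrite /airy_poly big_ord_recr. Qed.

(** The recurrence cancels every coefficient of degree at most n; truncation leaves the three of
    degrees n + 1, n + 2 and n + 3. *)
Lemma airy_residual n v : let T := airy_poly n.+3 in
  T^`()^`().[v] - k * (P1 + 'i%C * v) * T.[v] =
  - (k * (P1 * airy_coef n.+1 + 'i%C * airy_coef n) * v ^+ n.+1
     + k * (P1 * airy_coef n.+2 + 'i%C * airy_coef n.+1) * v ^+ n.+2
     + k * 'i%C * airy_coef n.+2 * v ^+ n.+3).
Proof.
elim: n => [|n /= IH] /=.
  rewrite !airy_polyS [airy_poly 0]big_ord0 /airy_coef /= !scale0r !add0r addr0.
  rewrite derivZ derivX linearZ /= derivC scaler0 horner0 hornerZ hornerX.
  by rewrite !exprS expr0; ring.
rewrite airy_polyS !derivD !derivZ !derivXn derivMn derivXn.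
rewrite -[n.+3.-1.-1]/n.+1.
rewrite hornerD !hornerZ !hornerMn hornerD hornerZ !hornerXn.
move: IH; set T := airy_poly n.+3 => IH.
have := airy_coef_rec n; set a := airy_coef n.+3; move: IH.
move: (T^`()^`().[v]) (T.[v]) => t2 t0 IH ha.
have -> : t2 = k * (P1 + 'i%C * v) * t0 - (a * (n.+3%:R * n.+2%:R) * v ^+ n.+1
     + k * (P1 * airy_coef n.+2 + 'i%C * airy_coef n.+1) * v ^+ n.+2
     + k * 'i%C * airy_coef n.+2 * v ^+ n.+3).
  by rewrite ha -IH; ring.
rewrite -(mulr_natr (v ^+ n.+1)) -(mulr_natr (v ^+ n.+1 * _)) !exprS.
by rewrite -[n.+3.-1]/n.+2; ring.
Qed.

(** Infinite radius of convergence. The weights [sg ^+ j] preserve the form of the recurrence, at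
    the price of a factor [sg ^+ 3] in its constant. *)
Lemma airy_coef_bounded (sg : R) : 1 <= sg ->
  exists C, forall j, nsq (airy_coef j) * sg ^+ j <= C.
Proof.
move=> sg1; have sg0 : 0 <= sg by lra.
apply: (@linear_recurrence_bounded _ (nsq k * (2 * nsq P1 + 2) * sg ^+ 3)).
- by rewrite !mulr_ge0 ?nsq_ge0 ?exprn_ge0 // addr_ge0 // mulr_ge0 ?nsq_ge0.
- by move=> j; rewrite mulr_ge0 ?nsq_ge0 ?exprn_ge0.
move=> j.
have nat2 : nsq ((j.+3%:R * j.+2%:R) : R[i]) = (j.+3%:R * j.+2%:R : R) ^+ 2.
  by rewrite (_ : j.+3%:R * j.+2%:R = (j.+3%:R * j.+2%:R)%:C) ?nsq_real //
    rmorphM /= !rmorph_nat.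
rewrite mulrA -nat2 [nsq _ * _]mulrC -nsqM airy_coef_rec nsqM.
have i1 := nsq_i R.
rewrite -!mulrA ler_wpM2l ?nsq_ge0 //.
set x := nsq (airy_coef j.+1); set y := nsq (airy_coef j).
have x0 : 0 <= x by exact: nsq_ge0.
have y0 : 0 <= y by exact: nsq_ge0.
have h : nsq (P1 * airy_coef j.+1 + 'i%C * airy_coef j) <=
    (2 * nsq P1 + 2) * (x + y).
  apply: le_trans (nsqD_le _ _) _; rewrite !nsqM i1 -/x -/y.
  have := nsq_ge0 P1; nra.
have p0 := nsq_ge0 P1.
apply: le_trans (ler_wpM2r (exprn_ge0 _ sg0) h) _.
rewrite -!mulrA ler_wpM2l //; first by lra.
rewrite !exprS; set S := sg ^+ j.
have S0 : 0 <= S by rewrite exprn_ge0.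
have s3 : 1 <= sg * (sg * sg) by nra.
have xS : 0 <= x * S by rewrite mulr_ge0.
have yS : 0 <= y * S by rewrite mulr_ge0.
have s2 : 1 <= sg * sg by nra.
have -> : sg * (sg * (sg * (x * (sg * S) + y * S))) =
  x * S * ((sg * sg) * (sg * sg)) + y * S * (sg * (sg * sg)) by ring.
have -> : (x + y) * (sg * (sg * (sg * S))) =
  x * S * (sg * (sg * sg)) + y * S * (sg * (sg * sg)) by ring.
rewrite lerD2r.
rewrite ler_wpM2l // [X in X <= _]mulrC. by apply: ler_wpM2l; [lra|rewrite ler_peMr].
Qed.

End Coefficients.

Lemma taylor_approx (k P1 s : R[i]) (rho e : R) : 0 <= rho -> 0 < e ->
  exists T : {poly R[i]}, [/\ T.[0] = 0, T^`().[0] = s &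
    forall v, nsq v <= rho ->
      nsq (T^`()^`().[v] - k * (P1 + 'i%C * v) * T.[v]) <= e].
Proof.
move=> rho0 e0.
(* With this weight the j-th monomial has squared modulus at most C / 4^j on the disc |v|^2 <=
   rho. *)
have [C hC] := @airy_coef_bounded k P1 s (4 * (1 + rho)) ltac:(lra).
set a := airy_coef k P1 s in hC.
pose B := nsq k * (nsq P1 + 1 + rho).
have B0 : 0 <= B by rewrite mulr_ge0 ?nsq_ge0 //; have := nsq_ge0 P1; lra.
(* The residual is a sum of five monomials, and splitting it by [nsqD_le] costs 2 + 4 + 8 + 16 + 16
   = 46. *)
have [n hn] : exists n, 46 * B * C <= e * 4 ^+ n.
  pose n := (Num.truncn (46 * B * C / e)).+1; exists n.
  rewrite [leRHS]mulrC -ler_pdivrMr //; apply: ltW; apply: lt_le_trans (truncnS_gt _) _.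
  rewrite -/n -natrX ler_nat; apply: ltnW; exact: ltn_expl.
exists (airy_poly k P1 s n.+3); split.
- rewrite /airy_poly horner_sum big1 // => -[[|i] hi] _ /=.
    by rewrite /airy_coef /= scale0r horner0.
  by rewrite hornerZ hornerXn expr0n mulr0.
- rewrite /airy_poly raddf_sum horner_sum big_ord_recl big_ord_recl big1 => [|i _].
    rewrite /= /airy_coef /= !derivZ derivX !hornerZ. by rewrite hornerC mul0r
      mulr1 add0r addr0.
  rewrite [X in X.[_]]derivZ derivXn hornerZ hornerMn hornerXn.
  by rewrite /= expr0n /= mul0rn mulr0.
move=> v hv; rewrite airy_residual -/a nsqN.
have C0 : 0 <= C.
  by apply: le_trans (hC 0%N); rewrite expr0 mulr1 nsq_ge0.
have hav j : (n <= j)%N -> nsq (a j * v ^+ j) * 4 ^+ n <= C.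
  move=> nj; apply: le_trans (hC j); rewrite nsqM -mulrA ler_wpM2l ?nsq_ge0 //.
  have nv : nsq (v ^+ j) = nsq v ^+ j.
    by elim: j {nj} => [|j IH]; rewrite ?exprS ?nsqM ?IH // !expr0 /nsq /= expr0n expr1n addr0.
  rewrite nv; apply: le_trans (_ : nsq v ^+ j * 4 ^+ j <= _).
    by rewrite ler_wpM2l ?exprn_ge0 ?nsq_ge0 // ler_eXn2l // ltr1n.
  by rewrite -exprMn lerXn2r ?nnegrE ?mulr_ge0 ?nsq_ge0 //; lra.
have i1 := nsq_i R.
have t1 w : nsq w <= nsq P1 + 1 + rho -> forall j, (n <= j)%N ->
    nsq (k * w * (a j * v ^+ j)) * 4 ^+ n <= B * C.
  move=> hw j nj; rewrite nsqM -mulrA; apply: ler_pM (hav _ nj).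
  - exact: nsq_ge0.
  - by rewrite mulr_ge0 ?nsq_ge0 ?exprn_ge0.
  by rewrite nsqM ler_wpM2l ?nsq_ge0.
have nP : nsq P1 <= nsq P1 + 1 + rho by lra.
have niv : nsq ('i%C * v) <= nsq P1 + 1 + rho.
  by rewrite nsqM i1 mul1r; have := nsq_ge0 P1; lra.
have niv1 := t1 _ niv; have nP1 := t1 _ nP.
rewrite [X in nsq X](_ : _ = k * P1 * (a n.+1 * v ^+ n.+1) +
  (k * ('i%C * v) * (a n * v ^+ n) + (k * P1 * (a n.+2 * v ^+ n.+2) +
  (k * ('i%C * v) * (a n.+1 * v ^+ n.+1) +
   k * ('i%C * v) * (a n.+2 * v ^+ n.+2))))); last by rewrite !exprS; ring.
have h1 := nP1 n.+1 (leqnSn _); have h2 := niv1 n (leqnn _).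
have h3 := nP1 n.+2 (leqW (leqnSn _)).
have h4 := niv1 n.+1 (leqnSn _); have h5 := niv1 n.+2 (leqW (leqnSn _)).
have X0 : 0 < 4 ^+ n :> R by rewrite exprn_gt0.
rewrite -(ler_pM2r X0).
apply: le_trans hn.
set x1 := k * P1 * _ in h1 *; set x2 := k * _ * (a n * _) in h2 *.
set x3 := k * P1 * (a n.+2 * _) in h3 *.
set x4 := k * _ * _ in h4 *; set x5 := k * _ * (a n.+2 * _) in h5 *.
have g1 := nsqD_le x1 (x2 + (x3 + (x4 + x5))).
have g2 := nsqD_le x2 (x3 + (x4 + x5)).
have g3 := nsqD_le x3 (x4 + x5); have g4 := nsqD_le x4 x5.
have g : nsq (x1 + (x2 + (x3 + (x4 + x5)))) <=
  2 * nsq x1 + 4 * nsq x2 + 8 * nsq x3 + 16 * nsq x4 + 16 * nsq x5 by lra.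
apply: le_trans (ler_wpM2r (ltW X0) g) _; lra.
Qed.

End TaylorApproximation.

(** * Gronwall estimates and polynomial approximation of true solutions *)

Section Energy.
Variable R : realType.
Implicit Types (u w : R -> R[i]) (x : R).

Definition continuous01 u :=
  {within `[0, 1], continuous (fun x => Re (u x))} /\
  {within `[0, 1], continuous (fun x => Im (u x))}.

Lemma within_continuous_add (f g : R -> R) (a b : R) :
  {within `[a, b], continuous f} -> {within `[a, b], continuous g} ->
  {within `[a, b], continuous (fun x => f x + g x)}.
Proof. by move=> hf hg x; apply: cvgD; [exact: hf|exact: hg]. Qed.

Lemma within_continuous_mul (f g : R -> R) (a b : R) :
  {within `[a, b], continuous f} -> {within `[a, b], continuous g} ->
  {within `[a, b], continuous (fun x => f x * g x)}.
Proof. by move=> hf hg x; apply: cvgM; [exact: hf|exact: hg]. Qed.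

Lemma within_continuous_opp (f : R -> R) (a b : R) :
  {within `[a, b], continuous f} -> {within `[a, b], continuous (fun x => - f x)}.
Proof. by move=> hf x; apply: cvgN; exact: hf. Qed.

Lemma continuous01_nsq u : continuous01 u ->
  {within `[0, 1], continuous (fun x => nsq (u x))}.
Proof.
move=> [h1 h2]; rewrite /nsq (_ : (fun x => _) = (fun x =>
   Re (u x) * Re (u x) + Im (u x) * Im (u x))).
  by apply: within_continuous_add; apply: within_continuous_mul.
by apply/funext => x; rewrite !expr2.
Qed.

Lemma is_derive_continuous (f : R -> R) x d :
  is_derive x (1 : R) f d -> {for x, continuous f}.
Proof. by move=> h; apply: differentiable_continuous; apply/derivable1_diffP. Qed.

Lemma is_derive_expRl (L x : R) :
  is_derive x (1 : R) (fun t => expR (L * t)) (L * expR (L * x)).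
Proof.
have h : is_derive x (1 : R) (fun t => L * t) L.
  apply: is_derive_eq (is_derive_mul (is_derive_cst L _ _) (is_derive_id x (1 : R))) _.
  by rewrite /=; ring.
apply: is_derive_eq (is_derive1_comp (is_derive_expR (L * x)) h) _.
by rewrite mulrC.
Qed.

(** Gronwall's inequality in both directions, from |E'| <= (2 + K) E + G. The bound from 1 to 0
    gives the approximation of solutions, the one from 0 to 1 gives uniqueness. *)
Lemma energy_bound u (u1 : R -> R[i]) w (K G : R) : 0 <= K -> 0 <= G ->
  continuous01 u -> continuous01 u1 ->
  (forall x, 0 < x < 1 -> [/\ cderiv u x (u1 x), cderiv u1 x (w x) &
     nsq (w x) <= K * nsq (u x) + G]) ->
  let E x := nsq (u x) + nsq (u1 x) in
  E 0 <= expR (2 + K) * (E 1 + G) /\ E 1 <= expR (2 + K) * (E 0 + G).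
Proof.
move=> K0 G0 cu cu1 hd E.
set L := 2 + K.
pose dE x := 2 * (Re (u x) * Re (u1 x) + Im (u x) * Im (u1 x)) +
  2 * (Re (u1 x) * Re (w x) + Im (u1 x) * Im (w x)).
have hE x : 0 < x < 1 -> is_derive x (1 : R) E (dE x).
  move=> /hd[h1 h2 _]; exact: is_derive_add (is_derive_nsq h1) (is_derive_nsq h2).
have cE : {within `[0, 1], continuous E}.
  by apply: within_continuous_add; exact: continuous01_nsq.
have bE x : 0 < x < 1 -> - (L * E x + G) <= dE x <= L * E x + G.
  move=> /hd[_ _ hw]; rewrite /dE /E /L.
  have i (a b : R[i]) : - (nsq a + nsq b) <= 2 * (Re a * Re b + Im a * Im b) <= nsq a + nsq b.
    rewrite /nsq; have := sqr_ge0 (Re a - Re b); have := sqr_ge0 (Im a - Im b).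
    have := sqr_ge0 (Re a + Re b); have := sqr_ge0 (Im a + Im b).
    by move=> ? ? ? ?; apply/andP; split; nra.
  have /andP[i1 i2] := i (u x) (u1 x); have /andP[i3 i4] := i (u1 x) (w x).
  have a0 := nsq_ge0 (u x); have a1 := nsq_ge0 (u1 x).
  by apply/andP; split; nra.
have cexp (l : R) : {within `[0, 1], continuous (fun t : R => expR (l * t))}.
  apply: pointwise_within_continuous => x _; exact: is_derive_continuous (is_derive_expRl _ _).
have clin (l : R) : {within `[0, 1], continuous (fun t : R => l * t)}.
  apply: pointwise_within_continuous => x _.
  exact: is_derive_continuous (is_derive_mul (is_derive_cst l _ _) (is_derive_id x (1 : R))).
have L0 : 0 <= L by rewrite /L; lra.
have hexp (x : R) : 0 < x < 1 -> 1 <= expR (L * x) <= expR L.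
  move=> /andP[x0 x1]; rewrite -{1}expR0 !ler_expR mulr_ge0 //=; last exact: ltW.
  by rewrite ler_piMr // ltW.
split.
(* An integrating factor for the lower bound on E'; the linear term pays for the forcing, so F is
   nonincreasing. *)
- pose F x := - (E x * expR (L * x)) + - (G * expR L * x).
  pose dF x := - (dE x * expR (L * x) + E x * (L * expR (L * x))) + - (G * expR L).
  have : F 1 <= F 0.
    apply: (@le0_derive_le _ F dF _ _ ler01).
    + move=> x x01.
      apply: is_derive_eq (is_derive_add
        (is_derive_opp (is_derive_mul (hE x x01) (is_derive_expRl L x)))
        (is_derive_opp (is_derive_mul (is_derive_cst (G * expR L) _ _)
          (is_derive_id x (1 : R))))) _.
      by rewrite /dF /=; ring.
    + apply: within_continuous_add; apply: within_continuous_opp => //.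
      exact: within_continuous_mul.
    move=> x x01; rewrite /dF.
    have /andP[b1 b2] := bE x x01; have /andP[e1 e2] := hexp x x01.
    have : 0 <= (dE x + L * E x + G) * expR (L * x) by rewrite mulr_ge0 //; lra.
    have : G * expR (L * x) <= G * expR L by rewrite ler_wpM2l.
    by lra.
  rewrite /F !mulr0 !mulr1 expR0 mulr1; lra.
- pose F x := E x * expR (- L * x) + - (G * x).
  pose dF x := (dE x * expR (- L * x) + E x * (- L * expR (- L * x))) + - G.
  have : F 1 <= F 0.
    apply: (@le0_derive_le _ F dF _ _ ler01).
    + move=> x x01.
      apply: is_derive_eq (is_derive_add (is_derive_mul (hE x x01) (is_derive_expRl (- L) x))
        (is_derive_opp (is_derive_mul (is_derive_cst G _ _) (is_derive_id x (1 : R))))) _.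
      by rewrite /dF /=; ring.
    + apply: within_continuous_add; last exact: within_continuous_opp.
      exact: within_continuous_mul.
    move=> x x01; rewrite /dF.
    have /andP[b1 b2] := bE x x01.
    have e1 : expR (- L * x) <= 1.
      by rewrite -expR0 ler_expR mulNr oppr_le0 mulr_ge0 //; case/andP: x01 => /ltW.
    have : 0 <= (L * E x + G - dE x) * expR (- L * x).
      by rewrite mulr_ge0 ?expR_ge0 //; lra.
    have : G * expR (- L * x) <= G by rewrite ler_piMr.
    by lra.
  rewrite /F !mulr0 !mulr1 expR0 mulr1 => h.
  have : E 1 * expR (- L) <= E 0 + G by lra.
  by rewrite expRN -ler_pdivlMr ?invr_gt0 ?expR_gt0 // invrK mulrC.
Qed.

(* [u] solves h^2 u'' = (P1 + i (x - 1)) u on ]0, 1[ and vanishes at 1. *)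
Definition edge_solution (h : R) (P1 : R[i]) u (u1 : R -> R[i]) :=
  [/\ continuous01 u, continuous01 u1, u 1 = 0 &
    forall x, 0 < x < 1 -> cderiv u x (u1 x) /\
      cderiv u1 x ((h ^- 2)%:C * (P1 + 'i%C * (x - 1)%:C) * u x)].

Lemma potential_bounded (h : R) (P1 : R[i]) : exists2 K : R, 0 <= K &
  forall x, 0 < x < 1 -> nsq ((h ^- 2)%:C * (P1 + 'i%C * (x - 1)%:C)) <= K.
Proof.
exists (nsq (h ^- 2)%:C * (2 * nsq P1 + 2)) => [|x /andP[x0 x1]].
  by rewrite mulr_ge0 ?nsq_ge0 //; have := nsq_ge0 P1; lra.
rewrite nsqM ler_wpM2l ?nsq_ge0 //.
apply: le_trans (nsqD_le _ _) _; rewrite lerD2l nsqM nsq_real.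
by rewrite nsq_i; nra.
Qed.

Lemma edge_solution_eq0 (h : R) P1 u (u1 : R -> R[i]) : edge_solution h P1 u u1 ->
  u 0 = 0 -> u1 0 = 0 -> u1 1 = 0.
Proof.
move=> [cu cu1 u10 hu] u0 u10'.
have [K K0 hK] := potential_bounded h P1.
have [|_] := @energy_bound u u1
  (fun x => (h ^- 2)%:C * (P1 + 'i%C * (x - 1)%:C) * u x) K 0 K0 (lexx 0) cu cu1.
  move=> x x01; have [d1 d2] := hu x x01; split; [exact: d1|exact: d2|].
  by rewrite addr0 nsqM ler_wpM2r ?nsq_ge0 // hK.
rewrite u0 u10' u10 nsq0 !addr0 mulr0 add0r => h0.
by apply: nsq_eq0; apply/eqP; rewrite eq_le h0 nsq_ge0.
Qed.

(** The difference u - T has zero Cauchy data at 1 and solves the equation with the residual as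
    forcing, so the energy bound carries its smallness to 0. The residual is small on a whole
    complex disc, where u itself is not defined. *)
Lemma edge_solution_approx (h : R) P1 u (u1 : R -> R[i]) : edge_solution h P1 u u1 ->
  forall rho e : R, 0 <= rho -> 0 < e -> exists T : {poly R[i]},
  [/\ T.[0] = 0,
    forall v, nsq v <= rho ->
      nsq (T^`()^`().[v] - (h ^- 2)%:C * (P1 + 'i%C * v) * T.[v]) <= e,
    nsq (u 0 - T.[-1]) <= e & nsq (u1 0 - T^`().[-1]) <= e].
Proof.
move=> [cu cu1 u10 hu] rho e rho0 e0.
have [K K0 hK] := potential_bounded h P1.
set C := expR (2 + 2 * K).
have C1 : 1 <= C by rewrite -expR0 ler_expR; lra.
pose e' := e / (2 * C).
have e'0 : 0 < e' by rewrite divr_gt0 //; lra.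
have e'e : 2 * e' * C = e by rewrite /e'; field; rewrite gt_eqF //; lra.
(* The radius [1 + rho] makes the disc contain also the real values v = x - 1 with x between 0 and
   1. *)
have [T [T0 T10 hT]] := @taylor_approx R (h ^- 2)%:C P1 (u1 1) (1 + rho) e' ltac:(lra) e'0.
exists T.
pose v x := (x - 1)%:C : R[i].
have dv x : cderiv v x 1.
  rewrite /v (_ : (fun x => _) = (fun x : R => x%:C - 1)).
    by apply: cderiv_eq (cderivB (cderiv_id x) (cderiv_cst 1 x)) _; rewrite subr0.
  by apply/funext => y; rewrite rmorphB rmorph1.
have dT (S : {poly R[i]}) x : cderiv (fun x => S.[v x]) x S^`().[v x].
  by apply: cderiv_eq (cderiv_horner S (dv x)) _; rewrite mulr1.
have contS (S : {poly R[i]}) : continuous01 (fun x => S.[v x]).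
  split; apply: pointwise_within_continuous => x _.
    exact: cderiv_continuous_Re (dT S x).
  exact: cderiv_continuous_Im (dT S x).
have contB f g : continuous01 f -> continuous01 g -> continuous01 (fun x => f x - g x).
  move=> [f1 f2] [g1 g2]; split.
    rewrite (_ : (fun x => _) = (fun x => Re (f x) + - Re (g x))).
      by apply: within_continuous_add => //; exact: within_continuous_opp.
    by apply/funext => x; rewrite ReD ReN.
  rewrite (_ : (fun x => _) = (fun x => Im (f x) + - Im (g x))).
    by apply: within_continuous_add => //; exact: within_continuous_opp.
  by apply/funext => x; rewrite ImD ImN.
pose Q x := (h ^- 2)%:C * (P1 + 'i%C * v x).
pose w x := Q x * u x - T^`()^`().[v x].
have := @energy_bound (fun x => u x - T.[v x]) (fun x => u1 x - T^`().[v x]) w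
  (2 * K) (2 * e') ltac:(lra) ltac:(lra) (contB _ _ cu (contS T)) (contB _ _ cu1 (contS _)).
case.
  move=> x x01; have [d1 d2] := hu x x01; split.
  - exact: cderivB d1 (dT T x).
  - exact: cderivB d2 (dT _ x).
  have -> : w x = Q x * (u x - T.[v x]) + - (T^`()^`().[v x] - Q x * T.[v x]).
    by rewrite /w; ring.
  apply: le_trans (nsqD_le _ _) _; rewrite nsqN; apply: lerD; last first.
    rewrite ler_pM2l //; apply: hT; rewrite nsq_real; nra.
  by rewrite nsqM -mulrA ler_pM2l // ler_wpM2r ?nsq_ge0 // hK.
rewrite {3 4}/v subrr T0 T10 u10 !subrr nsq0 !add0r {1 2}/v sub0r rmorphN rmorph1.
rewrite -/C mulrC e'e => h0 _; split => //.
- move=> x hx; apply: le_trans (hT x _) _; first by lra.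
  by rewrite -e'e; nra.
- by have := nsq_ge0 (u1 0 - T^`().[-1]); lra.
by have := nsq_ge0 (u 0 - T.[-1]); lra.
Qed.

End Energy.

(** * Dominance of one WKB component at x = 0 *)

Section EdgeAsymptotics.
Variable R : realType.

(** The second piece is for paths with a corner: those between adjacent sectors, joined at a point
    of the common ray. *)
Definition bpath (c M : R) (p1 p0 : R[i]) := bpiece c M p1 p0 \/
  exists2 q, bpiece c M p1 q & bpiece c M q p0.

Lemma edge_decay (c M eta h : R) (P1 p1 p0 : R[i]) (u u1 : R -> R[i]) :
  0 < c -> 0 < M -> 0 < eta -> eta <= 1 -> 0 < h -> h <= 1 ->
  h * (2 + 2 * (M / c)) <= 4 * c * eta ->
  p1 * p1 = P1 -> p0 * p0 = P1 - 'i%C -> bpath c M p1 p0 ->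
  edge_solution h P1 u u1 ->
  nsq (h%:C * u1 0 - p0 * u 0) <= 4 * eta * nsq (h%:C * u1 0 + p0 * u 0).
Proof.
move=> c0 M0 eta0 eta1 h0 h1 hc Ep1 Ep0 hp hu.
(* All errors are at most C e: the residuals of two pieces give 64 M^2, and replacing T by u at 0
   gives 12 (1 + |p0|^2). As e is free, the conclusion has no error term. *)
pose C := 64 * M ^+ 2 + 12 * (1 + nsq p0).
have C0 : 0 < C by rewrite /C; have := sqr_ge0 M; have := nsq_ge0 p0; lra.
apply/ler_addgt0Pr => d d0.
pose e := d / C; have e0 : 0 < e by rewrite divr_gt0.
have eC : e * C = d by rewrite /e divfK // gt_eqF.
have [|T [T0 hT hTu hTu1]] := edge_solution_approx hu _ e0
  (rho := 2 * M ^+ 2 + 2 * nsq P1).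
  by have := sqr_ge0 M; have := nsq_ge0 P1; lra.
have step := fun e1 p q => @piece_decay R c M eta h e e1 T P1 p q c0 M0 eta0 eta1
  h0 h1 (ltW e0) hc hT.
(* At [p1] the point is v = 0, that is x = 1; T vanishes there and both components equal h T'(0). *)
have start : nsq (wkbm h T P1 p1) <= nsq (wkbp h T P1 p1) + 0.
  by rewrite /wkbm /wkbp /vpt Ep1 subrr mulr0 T0 mulr0 addr0 subr0 addr0.
pose Z := 16 * M ^+ 2 * e.
have Z0 : 0 <= Z.
  by rewrite mulr_ge0 ?(ltW e0) // mulr_ge0 // sqr_ge0.
have hTp : nsq (wkbm h T P1 p0) <= eta * nsq (wkbp h T P1 p0) + 2 * Z.
  case: hp => [hp|[q h1q hq0]].
    by have := step 0 _ _ hp start; rewrite addr0 -/Z; lra.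
  have hq := step 0 _ _ h1q start; rewrite addr0 -/Z in hq.
  have := step Z _ _ hq0; rewrite -/Z => hh; apply: le_trans (hh _) _; last by lra.
  by apply: le_trans hq _; rewrite lerD2r ler_piMl ?nsq_ge0.
have v0 : vpt P1 p0 = -1.
  by rewrite /vpt Ep0; have := sqr_i R; move: 'i%C => j jj; ring: jj.
move: hTp; rewrite /wkbm /wkbp v0.
set x := T.[-1] in hTu *; set y := T^`().[-1] in hTu1 *.
have cmp (s : R[i]) : nsq s = nsq p0 ->
    nsq ((h%:C * u1 0 + s * u 0) - (h%:C * y + s * x)) <= 2 * (1 + nsq p0) * e.
  move=> hs; have -> : (h%:C * u1 0 + s * u 0) - (h%:C * y + s * x) =
    h%:C * (u1 0 - y) + s * (u 0 - x) by ring.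
  apply: le_trans (nsqD_le _ _) _; rewrite !nsqM hs nsq_real.
  have h2 : h ^+ 2 <= 1 by rewrite expr_le1 // ltW.
  have := ler_pM (sqr_ge0 h) (nsq_ge0 (u1 0 - y)) h2 hTu1.
  have := ler_wpM2l (nsq_ge0 p0) hTu. lra.
have cp := cmp p0 erefl; have := cmp (- p0) (nsqN p0); rewrite !mulNr => cm.
set b := h%:C * u1 0 - p0 * u 0 in cm *; set a := h%:C * u1 0 + p0 * u 0 in cp *.
set bT := h%:C * y - _ in cm *; set aT := h%:C * y + _ in cp *.
move=> hTp.
have hb : nsq b <= 2 * nsq bT + 2 * nsq (b - bT).
  by have := nsqD_le bT (b - bT); rewrite addrC subrK.
have ha : nsq aT <= 2 * nsq a + 2 * nsq (a - aT).
  by have := nsqD_le a (aT - a); rewrite addrC subrK [nsq (aT - a)]nsqB.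
have : eta * nsq aT <= 2 * eta * nsq a + 4 * (1 + nsq p0) * e.
  have := ler_wpM2l (ltW eta0) ha; rewrite mulrDr.
  have : eta * (2 * nsq (a - aT)) <= 2 * nsq (a - aT).
    by rewrite ler_piMl // mulr_ge0 ?nsq_ge0.
  lra.
rewrite -eC /C; rewrite /Z in hTp; lra.
Qed.

(** With a, b = h u'(0) +- p0 u(0), the quantity to be bounded is the product a b, which no longer
    depends on the sign of p0. As a - b = 2 p0 u(0) and |b|^2 <= |a|^2 / 4, one gets |a|^2 <= 16
    |p0|^2 |u(0)|^2, whence the constant 4 * 16^2 = 1024. *)
Lemma edge_estimate (c M eta h : R) (P1 p1 p0 : R[i]) (u u1 : R -> R[i]) :
  0 < c -> 0 < M -> 0 < eta -> eta <= 1 / 16 -> 0 < h -> h <= 1 ->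
  h * (2 + 2 * (M / c)) <= 4 * c * eta ->
  p1 * p1 = P1 -> p0 * p0 = P1 - 'i%C -> bpath c M p1 p0 ->
  edge_solution h P1 u u1 ->
  nsq ((h ^+ 2)%:C * u1 0 ^+ 2 - (P1 - 'i%C) * u 0 ^+ 2) <=
    1024 * eta * nsq (P1 - 'i%C) * nsq (u 0) ^+ 2 /\
  (u 0 = 0 -> u1 0 = 0).
Proof.
move=> c0 M0 eta0 eta1 h0 h1 hc Ep1 Ep0 hp hu.
have eta1' : eta <= 1 by lra.
have := edge_decay c0 M0 eta0 eta1' h0 h1 hc Ep1 Ep0 hp hu.
set b := _ - _; set a := _ + p0 * _ => hba.
have a0 := nsq_ge0 a; have b0 := nsq_ge0 b.
split; last first.
  move=> u0; move: hba; rewrite /a /b u0 !mulr0 subr0 addr0.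
  set y := h%:C * _ => hy.
  have /nsq_eq0 y0 : nsq y = 0 by have := nsq_ge0 y; nra.
  move/eqP: y0; rewrite mulf_eq0 => /orP[/eqP[] hh|/eqP //].
  by move: h0; rewrite hh ltxx.
have -> : (h ^+ 2)%:C * u1 0 ^+ 2 - (P1 - 'i%C) * u 0 ^+ 2 = a * b.
  by rewrite -Ep0 rmorphXn /a /b; ring.
have ha : nsq a <= 16 * nsq p0 * nsq (u 0).
  have := nsqD_le (a - b) b; rewrite subrK.
  have -> : a - b = 2%:C * p0 * u 0 by rewrite /a /b rmorphMn rmorph1; ring.
  rewrite !nsqM nsq_real; nra.
rewrite -Ep0 !nsqM.
apply: le_trans (_ : 4 * eta * (nsq a * nsq a) <= _).
  rewrite mulrC [leRHS]mulrA ler_wpM2r //.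
have : nsq a * nsq a <= (16 * nsq p0 * nsq (u 0)) * (16 * nsq p0 * nsq (u 0)).
  exact: ler_pM.
move=> /(ler_wpM2l (ltW eta0)); lra.
Qed.

End EdgeAsymptotics.

(** * Paths around the turning point *)

Section PathPerturbation.
Variable R : realType.

(** A qualitative form of [bpiece]: differentiability of [pd] gives the continuity from which the
    constants follow on the compact interval, and the strict inequality already forces p to be
    nonzero. *)
Definition spiece (p1 p0 : R[i]) := exists p pd : R -> R[i],
  [/\ p 0 = p1, p 1 = p0 & forall t : R, 0 <= t <= 1 ->
    [/\ cderiv p t (pd t), (exists d, cderiv pd t d) & 0 < Im (p t * p t * pd t)]].

Definition spath (p1 p0 : R[i]) := spiece p1 p0 \/
  exists2 q, spiece p1 q & spiece q p0.

Lemma bpiece_le (c c' M M' : R) (p1 p0 : R[i]) : c' <= c -> M <= M' ->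
  bpiece c M p1 p0 -> bpiece c' M' p1 p0.
Proof.
move=> cc MM [p [pd [e1 e0 h]]]; exists p, pd; split => // t /h[? h1 h2 h3 h4].
split => //.
- exact: le_trans h1.
- exact: le_trans h2.
- exact: le_trans h3 MM.
- exact: le_trans h4 MM.
Qed.

Lemma Im_sqr_le (z : R[i]) : Im z ^+ 2 <= nsq z.
Proof. by rewrite /nsq lerDr sqr_ge0. Qed.

(** The end points move with z, so the constants must survive a displacement of both. Adding to the
    path the affine interpolation D of the two displacements changes p^2 p' by the small term W. *)
Lemma spiece_bpiece (p1 p0 : R[i]) : spiece p1 p0 ->
  exists c M rho : R, [/\ 0 < c, 0 < M, 0 < rho & forall p1' p0',
    nsq (p1' - p1) <= rho -> nsq (p0' - p0) <= rho -> bpiece c M p1' p0'].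
Proof.
move=> [p [pd [e1 e0 hp]]].
have cf (f : R -> R) :
    (forall t : R, 0 <= t <= 1 -> exists d, is_derive t (1 : R) f d) ->
    {within `[0, 1], continuous f}.
  move=> h; apply: pointwise_within_continuous => t /h[d].
  exact: is_derive_continuous.
have [c1 c10 hc1] : exists2 c : R, 0 < c &
    forall t : R, 0 <= t <= 1 -> c <= Im (p t * p t * pd t).
  have [t t01 ht] : exists2 c : R, c \in `[0, 1] & forall t : R, t \in `[0, 1] ->
      Im (p c * p c * pd c) <= Im (p t * p t * pd t).
    apply: (EVT_min (f := fun t => Im (p t * p t * pd t)) ler01).
    apply: cf => t /hp[h1 [d h2] _]; eexists.
    exact: (cderivM (cderivM h1 h1) h2).2.
  exists (Im (p t * p t * pd t)) => [|s s01].
    by case: (hp t) => //; move: t01; rewrite in_itv.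
  by apply: ht; rewrite in_itv.
have [M1 hM1] : exists M : R,
    forall t : R, 0 <= t <= 1 -> nsq (p t) + nsq (pd t) <= M.
  have [t t01 ht] : exists2 c : R, c \in `[0, 1] & forall t : R, t \in `[0, 1] ->
      nsq (p t) + nsq (pd t) <= nsq (p c) + nsq (pd c).
    apply: (EVT_max (f := fun t => nsq (p t) + nsq (pd t)) ler01).
    apply: cf => t /hp[h1 [d h2] _]; eexists.
    exact: is_derive_add (is_derive_nsq h1) (is_derive_nsq h2).
  by exists (nsq (p t) + nsq (pd t)) => s s01; apply: ht; rewrite in_itv.
have M10 : 0 <= M1.
  apply: le_trans (hM1 0 _); last by rewrite lexx ler01.
  by rewrite addr_ge0 ?nsq_ge0.
pose M' := 2 * M1 + 8; pose K := 8 * M1 ^+ 2 + 8 * (8 * M1 + 8) * M'.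
have K0 : 0 < K by rewrite /K /M'; nra.
(* K rho bounds |W|^2, so this choice gives |W| <= c1 / 2 and at least half of the minimum of Im
   (p^2 p') is kept. *)
pose rho := Num.min 1 (c1 ^+ 2 / (4 * K)).
have rho0 : 0 < rho by rewrite lt_min ltr01 /= divr_gt0 ?exprn_gt0 // mulr_gt0.
have rho1 : rho <= 1 by rewrite ge_min lexx.
have rhoK : rho * (4 * K) <= c1 ^+ 2.
  by rewrite -ler_pdivlMr ?mulr_gt0 // ge_min lexx orbT.
have M'0 : 0 < M' by rewrite /M'; lra.
exists (c1 / (2 * (1 + M'))), M', rho; split => //.
  by rewrite divr_gt0 //; lra.
move=> p1' p0' h1 h0.
set A := p1' - p1 in h1; set B := p0' - p0 in h0.
pose D t := (1 - t)%:C * A + t%:C * B.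
pose q t := p t + D t; pose qd t := pd t + (B - A).
exists q, qd; split.
- by rewrite /q /D e1 subr0 mul1r mul0r addr0 /A addrC subrK.
- by rewrite /q /D e0 subrr mul0r mul1r add0r /B addrC subrK.
move=> t t01; have [dp _ _] := hp t t01.
have hc := hc1 t t01; have hM := hM1 t t01; case/andP: t01 => t0 t1.
have np0 := nsq_ge0 (p t); have npd0 := nsq_ge0 (pd t).
have nD : nsq (D t) <= 4 * rho.
  apply: le_trans (nsqD_le _ _) _; rewrite !nsqM !nsq_real.
  have : (1 - t) ^+ 2 * nsq A <= 1 * rho.
    by apply: ler_pM; rewrite ?sqr_ge0 ?nsq_ge0 // expr_le1 //; lra.
  have : t ^+ 2 * nsq B <= 1 * rho.
    by apply: ler_pM; rewrite ?sqr_ge0 ?nsq_ge0 // expr_le1 //; lra.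
  lra.
have nE : nsq (B - A) <= 4 * rho.
  by apply: le_trans (nsqD_le _ _) _; rewrite nsqN; lra.
have nq : nsq (q t) <= M'.
  by apply: le_trans (nsqD_le _ _) _; rewrite /M'; lra.
have nqd : nsq (qd t) <= M'.
  by apply: le_trans (nsqD_le _ _) _; rewrite /M'; lra.
have n2p : nsq (2%:C * p t + D t) <= 8 * M1 + 8.
  by apply: le_trans (nsqD_le _ _) _; rewrite nsqM nsq_real; lra.
set W := p t * p t * (B - A) + D t * (2%:C * p t + D t) * qd t.
have nW : nsq W <= rho * K.
  apply: le_trans (nsqD_le _ _) _; rewrite !nsqM.
  have w1 : nsq (p t) * nsq (p t) * nsq (B - A) <= M1 ^+ 2 * (4 * rho).
    apply: ler_pM; rewrite ?mulr_ge0 ?nsq_ge0 //.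
    by rewrite expr2; apply: ler_pM; rewrite ?nsq_ge0 //; lra.
  have w2 : nsq (D t) * nsq (2%:C * p t + D t) * nsq (qd t) <=
      4 * rho * (8 * M1 + 8) * M'.
    by do 2!(apply: ler_pM; rewrite ?mulr_ge0 ?nsq_ge0 //).
  by rewrite /K; lra.
have Eq : q t * q t * qd t = p t * p t * pd t + W.
  by rewrite /W /q /qd rmorphMn rmorph1; ring.
have Imq : c1 / 2 <= Im (q t * q t * qd t).
  rewrite Eq ImD; have := Im_sqr_le W; move: (Im W) => y hy.
  have : - (c1 / 2) <= y; last lra.
  rewrite leNgt; apply/negP => hlt.
  have : y ^+ 2 <= (c1 / 2) ^+ 2 by nra.
  nra.
have cc : c1 / (2 * (1 + M')) <= c1 / 2.
  rewrite ler_pM2l // lef_pV2 ?posrE //; lra.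
split => //.
- have d1 : cderiv (fun s : R => (1 - s)%:C) t (-1).
    rewrite (_ : (fun s => _) = (fun s : R => 1 - s%:C)).
      by apply: cderiv_eq (cderivB (cderiv_cst 1 t) (cderiv_id t)) _; rewrite sub0r.
    by apply/funext => s; rewrite rmorphB rmorph1.
  apply: cderiv_eq (cderivD dp (cderivD (cderivM d1 (cderiv_cst A t))
     (cderivM (cderiv_id t) (cderiv_cst B t)))) _.
  by rewrite /qd; ring.
- exact: le_trans cc Imq.
(* A small q would make q^2 q' small, because |q'|^2 <= M', against the lower bound on its imaginary
   part. *)
rewrite leNgt; apply/negP => hlt.
have : (c1 / 2) ^+ 2 <= nsq (q t) ^+ 2 * M'.
  apply: le_trans (_ : nsq (q t * q t * qd t) <= _).
    by apply: le_trans (Im_sqr_le _); nra.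
  by rewrite !nsqM expr2; apply: ler_pM; rewrite ?mulr_ge0 ?nsq_ge0.
have : nsq (q t) ^+ 2 * M' < (c1 / 2) ^+ 2; last by lra.
have := nsq_ge0 (q t); move: (nsq _) hlt => y hlt y0.
have hy : y * (1 + M') < c1 / 2.
  by move: hlt; rewrite ltr_pdivlMr; lra.
have : (y * (1 + M')) ^+ 2 < (c1 / 2) ^+ 2.
  by rewrite ltr_pXn2r ?nnegrE ?mulr_ge0 //; lra.
nra.
Qed.

Lemma spath_bpath (p1 p0 : R[i]) : spath p1 p0 ->
  exists c M rho : R, [/\ 0 < c, 0 < M, 0 < rho & forall p1' p0',
    nsq (p1' - p1) <= rho -> nsq (p0' - p0) <= rho -> bpath c M p1' p0'].
Proof.
case=> [/spiece_bpiece[c [M [rho [c0 M0 r0 h]]]]|[q]].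
  by exists c, M, rho; split => // p1' p0' h1 h0; left; exact: h.
move=> /spiece_bpiece[c [M [rho [c0 M0 r0 h]]]].
move=> /spiece_bpiece[c' [M' [rho' [c'0 M'0 r'0 h']]]].
exists (Num.min c c'), (Num.max M M'), (Num.min rho rho'); split.
- by rewrite lt_min c0.
- by rewrite lt_max M0.
- by rewrite lt_min r0.
move=> p1' p0'; rewrite !le_min => /andP[h1 _] /andP[_ h0]; right.
exists q.
  apply: bpiece_le (h _ _ h1 _); rewrite ?ge_min ?lexx ?le_max ?lexx //.
  by rewrite subrr nsq0 ltW.
apply: bpiece_le (h' _ _ _ h0); rewrite ?ge_min ?lexx ?orbT ?le_max ?lexx ?orbT //.
by rewrite subrr nsq0 ltW.
Qed.

End PathPerturbation.

(** * Symmetries of Im p^3 and elementary paths *)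

Section PathConstruction.
Variable R : realType.
Implicit Types (f : R -> R[i]) (z w p q : R[i]).

Lemma is_derive_sqrt_comp (f : R -> R) (t d : R) : 0 < f t ->
  is_derive t (1 : R) f d ->
  is_derive t (1 : R) (fun s => Num.sqrt (f s)) (d / (2 * Num.sqrt (f t))).
Proof.
move=> f0 h; apply: is_derive_eq (is_derive1_comp (is_derive1_sqrt f0) h) _.
by rewrite mulrC.
Qed.

Lemma is_derive_onem (f : R -> R) (t d : R) : is_derive (1 - t) (1 : R) f d ->
  is_derive t (1 : R) (fun s => f (1 - s)) (- d).
Proof.
move=> h; have h1 : is_derive t (1 : R) (fun s : R => 1 - s) (-1).
  apply: is_derive_eq (is_derive_add (is_derive_cst (1 : R) _ _)
    (is_derive_opp (is_derive_id t (1 : R)))) _.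
  by rewrite add0r.
by apply: is_derive_eq (is_derive1_comp (g := fun s => 1 - s) h h1) _; rewrite mulrN1.
Qed.

Lemma cderiv_onem f (t : R) d : cderiv f (1 - t) d ->
  cderiv (fun s => f (1 - s)) t (- d).
Proof.
move=> [h1 h2]; split.
  rewrite ReN; exact: (is_derive_onem (f := fun s => Re (f s))).
rewrite ImN; exact: (is_derive_onem (f := fun s => Im (f s))).
Qed.

Lemma Re_conj z : Re (conjc z) = Re z. Proof. by case: z. Qed.
Lemma Im_conj z : Im (conjc z) = - Im z. Proof. by case: z. Qed.

Lemma cderiv_conj f (t : R) d : cderiv f t d ->
  cderiv (fun s => conjc (f s)) t (conjc d).
Proof.
move=> [h1 h2]; split.
  rewrite Re_conj (_ : (fun s => _) = (fun s => Re (f s))) //.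
  by apply/funext => s; rewrite Re_conj.
rewrite Im_conj (_ : (fun s => _) = (fun s => - Im (f s))).
  exact: is_derive_opp.
by apply/funext => s; rewrite Im_conj.
Qed.

Lemma onem_itv01 (t : R) : 0 <= t <= 1 -> 0 <= 1 - t <= 1.
Proof. by move=> /andP[? ?]; apply/andP; split; lra. Qed.

(** Negation and conjugation each change the sign of Im p^3, and running the path backwards restores
    monotonicity; multiplication by a cube root of unity leaves p^3 unchanged. These symmetries
    reduce every pair of adjacent sectors to the pair along the positive real axis. *)
Lemma spiece_rev p1 p0 : spiece p1 p0 -> spiece (- p0) (- p1).
Proof.
move=> [p [pd [e1 e0 h]]].
exists (fun t => - p (1 - t)), (fun t => pd (1 - t)); split.
- by rewrite subr0 e0.
- by rewrite subrr e1.
move=> t /onem_itv01 /h[h1 [d h2] h3]; split.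
- by apply: cderiv_eq (cderivN (cderiv_onem h1)) _; rewrite opprK.
- by eexists; exact: cderiv_onem h2.
by rewrite mulrNN.
Qed.

Lemma spiece_conj p1 p0 : spiece p1 p0 -> spiece (conjc p0) (conjc p1).
Proof.
move=> [p [pd [e1 e0 h]]].
exists (fun t => conjc (p (1 - t))), (fun t => - conjc (pd (1 - t))); split.
- by rewrite subr0 e0.
- by rewrite subrr e1.
move=> t /onem_itv01 /h[h1 [d h2] h3]; split.
- apply: cderiv_eq (cderiv_conj (cderiv_onem h1)) _.
  by rewrite rmorphN.
- by eexists; exact: cderivN (cderiv_conj (cderiv_onem h2)).
move: h3; rewrite !(ImM, ReM, ImN, ReN, Re_conj, Im_conj); lra.
Qed.

Lemma spiece_decr (p pd : R -> R[i]) : (forall t : R, 0 <= t <= 1 ->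
    [/\ cderiv p t (pd t), (exists d, cderiv pd t d) &
        Im (p t * p t * pd t) < 0]) ->
  spiece (- p 0) (- p 1).
Proof.
move=> h; exists (fun t => - p t), (fun t => - pd t); split => // t /h[h1 [d h2] h3].
split; [exact: cderivN|by eexists; exact: cderivN h2|].
by rewrite mulrNN mulrN ImN oppr_gt0.
Qed.

Lemma spiece_mul w p1 p0 : w * w * w = 1 -> spiece p1 p0 ->
  spiece (w * p1) (w * p0).
Proof.
move=> hw [p [pd [e1 e0 h]]].
exists (fun t => w * p t), (fun t => w * pd t); split; rewrite ?e1 ?e0 //.
move=> t /h[h1 [d h2] h3].
split; [exact: cderivMl|by eexists; exact: cderivMl h2|].
rewrite (_ : w * p t * _ * _ = (w * w * w) * (p t * p t * pd t)); last by ring.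
by rewrite hw mul1r.
Qed.

Lemma spath_rev p1 p0 : spath p1 p0 -> spath (- p0) (- p1).
Proof.
case=> [h|[q h1 h0]]; first by left; exact: spiece_rev.
by right; exists (- q); exact: spiece_rev.
Qed.

Lemma spath_mul w p1 p0 : w * w * w = 1 -> spath p1 p0 ->
  spath (w * p1) (w * p0).
Proof.
move=> hw; case=> [h|[q h1 h0]]; first by left; exact: spiece_mul.
by right; exists (w * q); exact: spiece_mul.
Qed.

Lemma spath_conj p1 p0 : spath p1 p0 -> spath (conjc p0) (conjc p1).
Proof.
case=> [h|[q h1 h0]]; first by left; exact: spiece_conj.
by right; exists (conjc q); exact: spiece_conj.
Qed.

(** A straight segment leaving the positive real axis in a direction d of argument at most pi/3. Im
    (p^2 d) is a quadratic polynomial in t with nonnegative coefficients: the leading one is Im d^3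
    and the constant one, q^2 Im d, is positive. *)
Lemma spiece_linear (al be q : R) : 0 < be -> 0 < q -> q < al ->
  be ^+ 2 <= 3 * (al - q) ^+ 2 -> spiece q%:C (al +i* be).
Proof.
move=> b0 q0 qa hb.
pose d := (al - q) +i* be : R[i].
exists (fun t => q%:C + t%:C * d), (fun=> d); split.
- by rewrite mul0r addr0.
- by rewrite mul1r; apply: eqC => /=; ring.
move=> t /andP[t0 t1]; split.
- apply: cderiv_eq (cderivD (cderiv_cst q%:C t)
    (cderivM (cderiv_id t) (cderiv_cst d t))) _.
  by ring.
- by eexists; exact: cderiv_cst.
rewrite !(ReM, ImM, ReD, ImD) /=.
rewrite [ltRHS](_ : _ = be * (q ^+ 2 + 4 * q * t * (al - q) +
  t ^+ 2 * (3 * (al - q) ^+ 2 - be ^+ 2))); last by ring.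
have aq : 0 < al - q by lra.
rewrite mulr_gt0 // !ltr_wpDr ?exprn_gt0 //.
  by rewrite mulr_ge0 ?sqr_ge0 // subr_ge0.
by rewrite !mulr_ge0 // ltW.
Qed.

(** Im p^3 is negative in the sector below the positive real axis and positive in the one above, so
    the path may cross the axis; it does so at a point q close enough to 0 for both segments to have
    admissible directions. *)
Lemma spath_sector (al1 be1 al0 be0 : R) :
  0 < al1 -> 0 < be1 -> be1 ^+ 2 < 3 * al1 ^+ 2 ->
  0 < al0 -> 0 < be0 -> be0 ^+ 2 < 3 * al0 ^+ 2 ->
  spath (al0 -i* be0) (al1 +i* be1).
Proof.
move=> a1 b1 h1 a0 b0 h0.
have bound (al be : R) : 0 < al -> 0 < be -> be ^+ 2 < 3 * al ^+ 2 ->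
    exists2 m : R, 0 < m & forall q : R, 0 < q -> q <= m ->
      q < al /\ be ^+ 2 <= 3 * (al - q) ^+ 2.
  (* From 3 (al - q)^2 >= 3 al^2 - 6 al q. *)
  move=> al0' be0' hh; exists ((3 * al ^+ 2 - be ^+ 2) / (6 * al)).
    by rewrite divr_gt0 ?mulr_gt0 // subr_gt0.
  move=> q q0; rewrite ler_pdivlMr ?mulr_gt0 // => hq.
  by split; nra.
have [m1 m10 hm1] := bound _ _ a1 b1 h1.
have [m0 m00 hm0] := bound _ _ a0 b0 h0.
pose q := Num.min m1 m0.
have q0 : 0 < q by rewrite lt_min m10.
have [q1 e1] := hm1 q q0 ltac:(by rewrite ge_min lexx).
have [q2 e2] := hm0 q q0 ltac:(by rewrite ge_min lexx orbT).
right; exists q%:C; last exact: spiece_linear.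
have := spiece_conj (spiece_linear b0 q0 q2 e2).
by rewrite (_ : conjc q%:C = q%:C) //; apply: eqC => //=; rewrite oppr0.
Qed.

(* The principal square root of X + i (Y - t): here x runs along the real
   segment. *)
Lemma spath_vertical (X Y : R) :
  (forall t : R, 0 <= t <= 1 -> Y - t = 0 -> 0 < X) ->
  exists p1 p0 : R[i], [/\ p1 * p1 = X +i* Y, p0 * p0 = X +i* (Y - 1) & spath p1 p0].
Proof.
move=> hX.
pose y t : R := Y - t.
pose m t : R := Num.sqrt (X * X + y t * y t).
pose al t : R := Num.sqrt ((m t + X) / 2).
pose be t : R := y t / (2 * al t).
pose p t : R[i] := al t +i* be t.
(* Since (p^2)' = - i and |p|^2 = m, the derivative is - i / (2 p) = - i conj p / (2 m). *)
pose pd t : R[i] := (- (be t / (2 * m t))) +i* (- (al t / (2 * m t))).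
have dy (t : R) : is_derive t (1 : R) y (-1).
  apply: is_derive_eq (is_derive_add (is_derive_cst Y _ _)
    (is_derive_opp (is_derive_id t (1 : R)))) _.
  by rewrite add0r.
have m2 (t : R) : m t * m t = X * X + y t * y t.
  by rewrite -expr2 sqr_sqrtr // addr_ge0 // -expr2 sqr_ge0.
have m0 (t : R) : 0 <= m t by exact: sqrtr_ge0.
have facts (t : R) : 0 <= t <= 1 -> [/\ 0 < m t, 0 < m t + X & 0 < X * X + y t * y t].
  move=> t01; have mm := m2 t; have mge := m0 t.
  have hx := hX t t01; rewrite -/(y t) in hx.
  have [y0|y0] := eqVneq (y t) 0.
    by have X0 := hx y0; rewrite y0 in mm *; split; nra.
  have yy : 0 < y t * y t by rewrite -expr2 exprn_even_gt0.
  by split; nra.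
have al2 (t : R) : 0 <= t <= 1 -> 0 < al t /\ 2 * (al t * al t) = m t + X.
  move=> /facts[h1 h2 h3]; split; first by rewrite sqrtr_gt0 divr_gt0.
  by rewrite -expr2 sqr_sqrtr; [field|rewrite divr_ge0 // ltW].
have be2 (t : R) : 0 <= t <= 1 -> y t = 2 * al t * be t /\ 2 * (be t * be t) = m t - X.
  move=> t01; have [a0 a2] := al2 t t01; have [h1 h2 h3] := facts t t01.
  have yE : y t = 2 * al t * be t by rewrite /be; field; rewrite gt_eqF.
  split => //; apply: (mulfI (lt0r_neq0 h2)).
  have := m2 t; rewrite {1}yE; rewrite -a2; move: a2; nra.
have psq (t : R) : 0 <= t <= 1 -> p t * p t = X +i* y t.
  move=> t01; have [a0 a2] := al2 t t01; have [b1 b2] := be2 t t01.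
  by apply: eqC; rewrite /p /=; lra.
have dm (t : R) : 0 <= t <= 1 -> is_derive t (1 : R) m (- y t / m t).
  move=> t01; have [h1 h2 h3] := facts t t01.
  apply: is_derive_eq (is_derive_sqrt_comp (f := fun s => X * X + y s * y s) h3 (is_derive_add
    (is_derive_cst (X * X) t (1 : R)) (is_derive_mul (dy t) (dy t)))) _.
  by rewrite -/(m t); field; rewrite gt_eqF.
have dal (t : R) : 0 <= t <= 1 -> is_derive t (1 : R) al (- (be t / (2 * m t))).
  move=> t01; have [h1 h2 h3] := facts t t01; have [a0 a2] := al2 t t01.
  have g0 : 0 < (m t + X) / 2 by rewrite divr_gt0.
  apply: is_derive_eq (is_derive_sqrt_comp (f := fun s => (m s + X) / 2) g0 (is_derive_mul
    (is_derive_add (dm t t01) (is_derive_cst X t (1 : R)))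
    (is_derive_cst (2^-1 : R) t (1 : R)))) _.
  by rewrite -/(al t) /be /=; field; rewrite !gt_eqF.
have dbe (t : R) : 0 <= t <= 1 -> is_derive t (1 : R) be (- (al t / (2 * m t))).
  move=> t01; have [h1 h2 h3] := facts t t01; have [a0 a2] := al2 t t01.
  have [b1 b2] := be2 t t01.
  have a2n0 : 2 * al t != 0 by rewrite gt_eqF // mulr_gt0.
  have := is_derive_mul (dy t) (is_derive_inv (f := fun s => 2 * al s) a2n0
    (is_derive_mul (is_derive_cst (2 : R) t (1 : R)) (dal t t01))).
  move=> h; apply: is_derive_eq h _.
  have mE : m t = al t * al t + be t * be t by lra.
  rewrite /= b1 mE; field.
  by rewrite (gt_eqF a0) -mE gt_eqF.
have dp (t : R) : 0 <= t <= 1 -> cderiv p t (pd t).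
  by move=> t01; split => /=; [exact: dal|exact: dbe].
have hdec (t : R) : 0 <= t <= 1 ->
    [/\ cderiv p t (pd t), (exists d, cderiv pd t d) & Im (p t * p t * pd t) < 0].
  move=> t01; have [h1 h2 h3] := facts t t01; have [a0 a2] := al2 t t01.
  have [b1 b2] := be2 t t01.
  have m2n0 : 2 * m t != 0 by rewrite gt_eqF // mulr_gt0.
  split; first exact: dp.
    have di := is_derive_inv (f := fun s => 2 * m s) m2n0
      (is_derive_mul (is_derive_cst (2 : R) t (1 : R)) (dm t t01)).
    eexists (_ +i* _); split => /=.
      exact: is_derive_opp (is_derive_mul (dbe t t01) di).
    exact: is_derive_opp (is_derive_mul (dal t t01) di).
  (* Here p^2 p' = - i p / 2: the phase is monotone because the principal root has positive real
     part. *)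
  rewrite psq // /pd /= (_ : _ + _ = - (al t / 2)).
    by rewrite oppr_lt0 divr_gt0.
  have mE : m t = al t * al t + be t * be t by lra.
  have XE : X = al t * al t - be t * be t by lra.
  rewrite XE b1 mE; field.
  by rewrite -mE gt_eqF.
exists (- p 0), (- p 1); split.
- by rewrite mulrNN psq ?lexx ?ler01 // /y subr0.
- by rewrite mulrNN psq ?lexx ?ler01.
left; exact: spiece_decr hdec.
Qed.

End PathConstruction.

(** * Paths along which the cube runs on a straight segment *)

Section CubicLine.
Variable R : realType.

(** The expression is A Re + B Im of (1 + i k)^3; its positivity means that the ray of slope k meets
    the line. For B > 0 it is nondecreasing for k <= 0, and for k > 0 both terms have the right
    sign; k -> - k exchanges the signs of B. *)
Lemma cubic_den_gt0 (A B k1 k0 k : R) : 0 <= A -> B != 0 ->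
  k1 <= 0 -> 0 <= k0 -> 3 * k1 ^+ 2 <= 1 -> 3 * k0 ^+ 2 <= 1 -> k1 <= k <= k0 ->
  0 < A * (1 - 3 * k1 ^+ 2) + B * (3 * k1 - k1 ^+ 3) ->
  0 < A * (1 - 3 * k0 ^+ 2) + B * (3 * k0 - k0 ^+ 3) ->
  0 < A * (1 - 3 * k ^+ 2) + B * (3 * k - k ^+ 3).
Proof.
have main (A' B' k' : R) (k1' : R) : 0 <= A' -> 0 < B' -> 3 * k' ^+ 2 <= 1 ->
    3 * k1' ^+ 2 <= 1 -> k1' <= 0 -> k1' <= k' ->
    0 < A' * (1 - 3 * k1' ^+ 2) + B' * (3 * k1' - k1' ^+ 3) ->
    0 < A' * (1 - 3 * k' ^+ 2) + B' * (3 * k' - k' ^+ 3).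
  move=> A0 B0 hk hk1 k10 k1k h.
  have [kneg|kpos] := leP k' 0.
    apply: lt_le_trans h _; rewrite lerD //.
      by rewrite ler_wpM2l //; nra.
    rewrite ler_wpM2l //; first exact: ltW.
    have : 0 <= (k' - k1') * (3 - (k' ^+ 2 + k' * k1' + k1' ^+ 2)).
      by rewrite mulr_ge0 //; nra.
    by nra.
  have : 0 < B' * (3 * k' - k' ^+ 3).
    rewrite mulr_gt0 // (_ : _ - _ = k' * (3 - k' ^+ 2)); last by ring.
    by rewrite mulr_gt0 //; nra.
  have : 0 <= A' * (1 - 3 * k' ^+ 2) by rewrite mulr_ge0 //; lra.
  lra.
move=> A0 Bn k10 k00 h1 h0 /andP[kk1 kk0] d1 d0.
have hk : 3 * k ^+ 2 <= 1.
  have [kneg|kpos] := leP k 0; nra.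
have [Bneg|Bpos|B0] := ltgtP B 0; last by rewrite B0 eqxx in Bn.
  have e (x : R) : A * (1 - 3 * (- x) ^+ 2) + - B * (3 * - x - (- x) ^+ 3) =
      A * (1 - 3 * x ^+ 2) + B * (3 * x - x ^+ 3) by ring.
  have := main A (- B) (- k) (- k0) A0; rewrite !e oppr_gt0 !sqrrN oppr_le0 lerN2.
  exact.
exact: (main A B k k1).
Qed.

(* In the coordinate [- i p] = x (1 + i k), the cube is
   x^3 (1 - 3 k^2 + i (3 k - k^3)); the path makes it run along the straight
   segment A Re + B Im = D. *)
Lemma spath_cubic (al1 be1 al0 be0 : R) :
  0 <= al1 -> 0 < be1 -> 3 * al1 ^+ 2 <= be1 ^+ 2 ->
  0 <= al0 -> 0 < be0 -> 3 * al0 ^+ 2 <= be0 ^+ 2 ->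
  0 < al1 + al0 ->
  be1 * (be1 ^+ 2 - 3 * al1 ^+ 2) != be0 * (be0 ^+ 2 - 3 * al0 ^+ 2) ->
  spath (al1 +i* be1) (- al0 +i* be0) \/ spath (- (al1 +i* be1)) (- (- al0 +i* be0)).
Proof.
move=> a1 b1 h1 a0 b0 h0 ha hC.
set C1 := be1 * _ in hC; set C0 := be0 * _ in hC.
(* [C1 + i S1] and [C0 + i S0] are the cubes of - i p at the two ends, both in the closed right
   half-plane; A Re + B Im = D is the line through them. *)
pose S1 := - (al1 * (3 * be1 ^+ 2 - al1 ^+ 2)).
pose S0 := al0 * (3 * be0 ^+ 2 - al0 ^+ 2).
pose A := S0 - S1; pose B := C1 - C0; pose D := C1 * S0 - S1 * C0.
have C1ge : 0 <= C1 by rewrite mulr_ge0 ?(ltW b1) ?(ltW b0) //; lra.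
have C0ge : 0 <= C0 by rewrite mulr_ge0 ?(ltW b1) ?(ltW b0) //; lra.
have t1 : 0 < 3 * be1 ^+ 2 - al1 ^+ 2 by nra.
have t0 : 0 < 3 * be0 ^+ 2 - al0 ^+ 2 by nra.
have S1le : S1 <= 0 by rewrite oppr_le0 mulr_ge0 // ltW.
have S0ge : 0 <= S0 by rewrite mulr_ge0 // ltW.
have A0 : 0 <= A by rewrite /A; lra.
have Bn : B != 0 by rewrite subr_eq0.
(* The line misses the origin, so the path avoids the turning point. *)
have D0 : 0 < D.
  have [a1z|a1p] := eqVneq al1 0.
    have a0p : 0 < al0 by lra.
    have C1p : 0 < C1 by rewrite /C1 a1z expr0n mulr0 subr0 mulr_gt0 // exprn_gt0.
    have S0p : 0 < S0 by rewrite mulr_gt0.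
    by rewrite /D; nra.
  have {}a1p : 0 < al1 by rewrite lt_def a1p.
  have S1p : S1 < 0 by rewrite oppr_lt0 mulr_gt0.
  have [a0z|a0p] := eqVneq al0 0.
    have C0p : 0 < C0 by rewrite /C0 a0z expr0n mulr0 subr0 mulr_gt0 // exprn_gt0.
    by rewrite /D; nra.
  have {}a0p : 0 < al0 by rewrite lt_def a0p.
  have S0p : 0 < S0 by rewrite mulr_gt0.
  have : 0 < C1 \/ 0 < C0.
    have [z|] := eqVneq C1 0; last by left; rewrite lt_def C1ge andbT.
    by right; rewrite lt_def C0ge andbT -z eq_sym.
  rewrite /D; case=> hc; nra.
pose k1 := - (al1 / be1); pose k0 := al0 / be0; pose m := k0 - k1.
have k1E : k1 * be1 = - al1 by rewrite /k1 mulNr divfK // gt_eqF.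
have k0E : k0 * be0 = al0 by rewrite /k0 divfK // gt_eqF.
have k10 : k1 <= 0 by rewrite oppr_le0 divr_ge0 // ltW.
have k00 : 0 <= k0 by rewrite divr_ge0 // ltW.
have hk1 : 3 * k1 ^+ 2 <= 1.
  rewrite /k1 sqrrN expr_div_n mulrA ler_pdivrMr ?exprn_gt0 //; lra.
have hk0 : 3 * k0 ^+ 2 <= 1.
  rewrite /k0 expr_div_n mulrA ler_pdivrMr ?exprn_gt0 //; lra.
have m0 : 0 < m.
  rewrite /m subr_gt0 lt_neqAle (le_trans k10 k00) andbT; apply/eqP => e.
  have k1z : k1 = 0 by lra.
  have k0z : k0 = 0 by lra.
  by move: k1E k0E; rewrite k1z k0z !mul0r; lra.
pose den k := A * (1 - 3 * k ^+ 2) + B * (3 * k - k ^+ 3).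
have den1 : den k1 * be1 ^+ 3 = D.
  have -> : den k1 * be1 ^+ 3 = A * (be1 * (be1 ^+ 2 - 3 * (k1 * be1) ^+ 2)) +
     B * (3 * (k1 * be1) * be1 ^+ 2 - (k1 * be1) ^+ 3) by rewrite /den; ring.
  by rewrite k1E sqrrN -/C1 (_ : _ - (- al1) ^+ 3 = S1) /A /B /D /S1; ring.
have den0 : den k0 * be0 ^+ 3 = D.
  have -> : den k0 * be0 ^+ 3 = A * (be0 * (be0 ^+ 2 - 3 * (k0 * be0) ^+ 2)) +
     B * (3 * (k0 * be0) * be0 ^+ 2 - (k0 * be0) ^+ 3) by rewrite /den; ring.
  by rewrite k0E -/C0 (_ : _ - al0 ^+ 3 = S0) /A /B /D /S0; ring.
have d1 : 0 < den k1 by rewrite -(pmulr_lgt0 _ (exprn_gt0 3 b1)) den1.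
have d0 : 0 < den k0 by rewrite -(pmulr_lgt0 _ (exprn_gt0 3 b0)) den0.
pose k t : R := k1 + t * m.
have dk (t : R) : is_derive t (1 : R) k m.
  apply: is_derive_eq (is_derive_add (is_derive_cst k1 _ _)
    (is_derive_mul (is_derive_id t (1 : R)) (is_derive_cst m _ _))) _.
  by rewrite /=; ring.
have dt0 (t : R) : 0 <= t <= 1 -> 0 < den (k t).
  move=> /andP[t0' t1']; apply: (@cubic_den_gt0 A B k1 k0) => //.
  by rewrite /k /m; apply/andP; split; nra.
pose n t : R := m * (- (6 * A * k t) + 3 * B * (1 - k t * k t)).
have dden (t : R) : is_derive t (1 : R) (fun s => den (k s)) (n t).
  rewrite (_ : (fun s => _) = (fun s =>
     A * (1 + - (3 * (k s * k s))) + B * (3 * k s + - (k s * (k s * k s))))).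
    apply: is_derive_eq (is_derive_add
      (is_derive_mul (is_derive_cst A _ _) (is_derive_add (is_derive_cst (1 : R) _ _)
        (is_derive_opp (is_derive_mul (is_derive_cst (3 : R) _ _) (is_derive_mul (dk t) (dk t))))))
      (is_derive_mul (is_derive_cst B _ _) (is_derive_add
         (is_derive_mul (is_derive_cst (3 : R) _ _) (dk t))
         (is_derive_opp (is_derive_mul (dk t) (is_derive_mul (dk t) (dk t))))))) _.
    by rewrite /n /=; ring.
  by apply/funext => s; rewrite /den; ring.
(* The positive cube root of D / den, written with [expR] and [ln] in order to differentiate it. *)
pose x t : R := expR (- ln (den (k t) / D) / 3).
have x3 (t : R) : 0 <= t <= 1 -> x t ^+ 3 * den (k t) = D.
  move=> t01; have hd := dt0 t t01.
  rewrite /x -expRM_natl (_ : _ * (_ / 3) = - ln (den (k t) / D)); last by field.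
  by rewrite expRN lnK ?posrE ?divr_gt0 // invf_div; field; rewrite gt_eqF.
have x0 (t : R) : 0 < x t by exact: expR_gt0.
have dx (t : R) : 0 <= t <= 1 ->
    is_derive t (1 : R) x (- (x t * n t / (3 * den (k t)))).
  move=> t01; have hd := dt0 t t01.
  have hd' : 0 < den (k t) / D by rewrite divr_gt0.
  have h2 : is_derive t (1 : R) (fun s => den (k s) / D) (n t / D).
    apply: is_derive_eq (is_derive_mul (dden t) (is_derive_cst D^-1 _ _)) _.
    by rewrite /=; ring.
  have h3 := is_derive1_comp (g := fun s => den (k s) / D) (is_derive1_ln hd') h2.
  have h4 := is_derive_mul (is_derive_opp h3) (is_derive_cst (3^-1 : R) t (1 : R)).
  have h5 := is_derive1_comp (g := fun s => - ln (den (k s) / D) / 3) (is_derive_expR _) h4.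
  apply: is_derive_eq h5 _; rewrite -/(x t) /=.
  by field; rewrite !gt_eqF.
pose p t : R[i] := - (x t * k t) +i* x t.
pose xd t : R := - (x t * n t / (3 * den (k t))).
pose pd t : R[i] := - (xd t * k t + x t * m) +i* xd t.
have dp (t : R) : 0 <= t <= 1 -> cderiv p t (pd t).
  move=> t01; split => /=; last exact: dx.
  exact: is_derive_opp (is_derive_mul (dx t t01) (dk t)).
have dpd (t : R) : 0 <= t <= 1 -> exists d, cderiv pd t d.
  move=> t01.
  have hn : is_derive t (1 : R) n (m * (- (6 * A * m) + 3 * B * (- (2 * k t * m)))).
    apply: is_derive_eq (is_derive_mul (is_derive_cst m _ _) (is_derive_add
      (is_derive_opp (is_derive_mul (is_derive_cst (6 * A) _ _) (dk t)))
      (is_derive_mul (is_derive_cst (3 * B) _ _) (is_derive_add (is_derive_cst (1 : R) _ _)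
        (is_derive_opp (is_derive_mul (dk t) (dk t))))))) _.
    by rewrite /=; ring.
  have d3 : 3 * den (k t) != 0 by rewrite gt_eqF // mulr_gt0 ?dt0.
  have hxd := is_derive_opp (is_derive_mul (is_derive_mul (dx t t01) hn)
     (is_derive_inv (f := fun s => 3 * den (k s)) d3
        (is_derive_mul (is_derive_cst (3 : R) _ _) (dden t)))).
  eexists (_ +i* _); split => /=; last exact: hxd.
  exact: is_derive_opp (is_derive_add (is_derive_mul hxd (dk t))
    (is_derive_mul (dx t t01) (is_derive_cst m _ _))).
have key (t : R) : 0 <= t <= 1 -> Im (p t * p t * pd t) =
    B * (x t ^+ 3 * m * (1 + k t ^+ 2) ^+ 2 / den (k t)).
  move=> t01; have hd := dt0 t t01.
  rewrite !(ImM, ReM) /= /xd.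
  move: hd; rewrite /n /den => hd; field.
  by rewrite gt_eqF.
have pos (t : R) : 0 <= t <= 1 -> 0 < x t ^+ 3 * m * (1 + k t ^+ 2) ^+ 2 / den (k t).
  move=> t01; have q0 : 0 < 1 + k t ^+ 2 by have := sqr_ge0 (k t); lra.
  apply: divr_gt0; last exact: dt0.
  by apply: mulr_gt0; [apply: mulr_gt0 => //; exact: exprn_gt0|exact: exprn_gt0].
have cube (a b : R) : 0 < a -> 0 < b -> a ^+ 3 = b ^+ 3 -> a = b.
  by move=> a' b' /eqP; rewrite eqrXn2 ?ltW // => /eqP.
have x1E : x 0 = be1.
  apply: cube => //; apply: (mulIf (lt0r_neq0 d1)).
  by have := x3 0; rewrite /k mul0r addr0 lexx ler01 => ->; rewrite // mulrC.
have x0E : x 1 = be0.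
  apply: cube => //; apply: (mulIf (lt0r_neq0 d0)).
  have := x3 1; rewrite /k mul1r /m addrC subrK lexx ler01 => ->; rewrite // mulrC den0 //.
have p0E : p 0 = al1 +i* be1.
  by rewrite /p x1E /k mul0r addr0 mulrC k1E opprK.
have p1E : p 1 = - al0 +i* be0.
  by rewrite /p x0E /k mul1r /m addrC subrK mulrC k0E.
(* Im p^3 = - Re (- i p)^3 goes from - C1 to - C0, so the sign of B decides whether p or - p is the
   increasing path. *)
have [Bneg|Bpos|B0] := ltgtP B 0; last by rewrite B0 eqxx in Bn.
  right; left; rewrite -p0E -p1E; apply: (@spiece_decr _ p pd) => t t01.
  split; [exact: dp|exact: dpd|].
  by rewrite key // pmulr_llt0 // pos.
left; left; exists p, pd; split => // t t01.
split; [exact: dp|exact: dpd|].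
by rewrite key // pmulr_lgt0 // pos.
Qed.

End CubicLine.

(** * Existence of a path away from the exceptional set *)

Section PathExistence.
Variable R : realType.

Lemma sq_lt (a b : R) : 0 <= a -> 0 <= b -> a ^+ 2 < b ^+ 2 -> a < b.
Proof. by move=> a0 b0; rewrite ltr_pXn2r. Qed.

Lemma sq_eq (a b : R) : 0 <= a -> 0 <= b -> a ^+ 2 = b ^+ 2 -> a = b.
Proof. by move=> a0 b0 /eqP; rewrite eqrXn2 // => /eqP. Qed.

Lemma sqrt_real_neg (X Y : R) : 0 <= Y -> (Y = 0 -> X < 0) ->
  exists al be : R, [/\ 0 <= al, 0 < be, al ^+ 2 - be ^+ 2 = X & 2 * al * be = Y].
Proof.
move=> Y0 h; pose m := Num.sqrt (X ^+ 2 + Y ^+ 2).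
have m2 : m ^+ 2 = X ^+ 2 + Y ^+ 2 by rewrite sqr_sqrtr // addr_ge0 // sqr_ge0.
have m0 : 0 <= m by exact: sqrtr_ge0.
have mX : 0 < m - X.
  have [/h X0|Yn] := eqVneq Y 0; first by lra.
  have : 0 < Y ^+ 2 by rewrite exprn_even_gt0.
  by nra.
pose be := Num.sqrt ((m - X) / 2).
have be0 : 0 < be by rewrite sqrtr_gt0 divr_gt0.
have be2 : be ^+ 2 = (m - X) / 2 by rewrite sqr_sqrtr // divr_ge0 // ltW.
exists (Y / (2 * be)), be; split => //.
- by rewrite divr_ge0 // mulr_ge0 // ltW.
- rewrite expr_div_n exprMn be2.
  have -> : Y ^+ 2 = (m - X) * (m + X) by lra.
  by field; rewrite gt_eqF.
by field; rewrite gt_eqF.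
Qed.

Section Rotation.
Variable s : R.
Hypotheses (s0 : 0 < s) (s3 : s * s = 3).

Let w : R[i] := (- (1 / 2)) +i* (s / 2).

Lemma cube_root_of_unity : w * w * w = 1.
Proof. by apply: eqC; rewrite /w /=; [field: s3|field: s3]. Qed.

Lemma mul_sqrt3_lt (a b : R) : 0 <= a -> 0 <= b -> 3 * a ^+ 2 < b ^+ 2 -> s * a < b.
Proof.
move=> a0 b0 h; apply: sq_lt => //; first by rewrite mulr_ge0 // ltW.
by rewrite exprMn [s ^+ 2]expr2 s3.
Qed.

Lemma lt_mul_sqrt3 (a b : R) : 0 <= a -> 0 <= b -> b ^+ 2 < 3 * a ^+ 2 -> b < s * a.
Proof.
move=> a0 b0 h; apply: sq_lt => //; first by rewrite mulr_ge0 // ltW.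
by rewrite exprMn [s ^+ 2]expr2 s3.
Qed.

Lemma eq_mul_sqrt3 (a b : R) : 0 <= a -> 0 <= b -> 3 * a ^+ 2 = b ^+ 2 -> b = s * a.
Proof.
move=> a0 b0 h; apply: sq_eq => //; first by rewrite mulr_ge0 // ltW.
by rewrite exprMn [s ^+ 2]expr2 s3.
Qed.

(** The end points are - w (a + i b) and - w (- c + i d). The two strict inequalities put the first
    in the open sector below the positive real axis and the second in the one above. *)
Lemma spath_rotated_sectors (a b c d : R) : 0 <= c -> 0 < b -> 0 < d ->
  b < s * a -> s * c < d ->
  spath (((a + s * b) / 2) -i* ((s * a - b) / 2))
        (((s * d - c) / 2) +i* ((d + s * c) / 2)).
Proof.
move=> c0 b0 d0 hb hd.
have a0 : 0 < a by rewrite -(pmulr_rgt0 _ s0); exact: lt_trans hb.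
have sb0 : 0 < s * b by rewrite mulr_gt0.
have sc0 : 0 <= s * c by rewrite mulr_ge0 // ltW.
have sd0 : c < s * d.
  have : s * (s * c) < s * d by rewrite ltr_pM2l.
  by rewrite mulrA s3; lra.
have q1 : 0 < (s * d - c) / 2 by rewrite divr_gt0 ?subr_gt0.
have q2 : 0 < (d + s * c) / 2 by rewrite divr_gt0 ?ltr_wpDr.
have q3 : 0 < (a + s * b) / 2 by rewrite divr_gt0 ?addr_gt0.
have q4 : 0 < (s * a - b) / 2 by rewrite divr_gt0 ?subr_gt0.
apply: (spath_sector q1 q2 _ q3 q4).
  rewrite -subr_gt0 [ltRHS](_ : _ = (2 * d) * (d - s * c)); last by field: s3.
  by rewrite mulr_gt0 ?subr_gt0 ?mulr_gt0.
rewrite -subr_gt0 [ltRHS](_ : _ = (2 * b) * (s * a + b)); last by field: s3.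
by rewrite mulr_gt0 ?mulr_gt0 ?addr_gt0 ?mulr_gt0.
Qed.

(** p1 has argument in ]0, pi/3[ and p0 lies in the next sector, about the imaginary axis. Im p^3
    decreases from the first to the second, hence the minus signs. *)
Lemma spath_upper_sectors (al1 be1 al0 be0 : R) : 0 <= al0 -> 0 < be1 -> 0 < be0 ->
  be1 < s * al1 -> s * al0 < be0 ->
  spath (- (al1 +i* be1)) (- (- al0 +i* be0)).
Proof.
move=> a0 b1 b0 h1 h0.
rewrite (_ : - _ = conjc w * (((al1 + s * be1) / 2) -i* ((s * al1 - be1) / 2))); last first.
  by apply: eqC; rewrite /w /=; field: s3.
rewrite [X in spath _ X](_ : _ =
    conjc w * (((s * be0 - al0) / 2) +i* ((be0 + s * al0) / 2))); last first.
  by apply: eqC; rewrite /w /=; field: s3.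
apply: spath_mul; last exact: spath_rotated_sectors.
by rewrite -!rmorphM cube_root_of_unity rmorph1.
Qed.

Lemma spath_lower_sectors (al1 be1 al0 be0 : R) : 0 <= al1 -> 0 < be1 -> 0 < be0 ->
  be0 < s * al0 -> s * al1 < be1 ->
  spath (al1 +i* be1) (- al0 +i* be0).
Proof.
move=> a1 b1 b0 h0 h1.
have := spath_rotated_sectors a1 b0 b1 h0 h1.
move=> /spath_conj /(spath_mul cube_root_of_unity).
rewrite (_ : al1 +i* be1 = w * conjc (((s * be1 - al1) / 2) +i* ((be1 + s * al1) / 2))); last first.
  by apply: eqC; rewrite /w /=; field: s3.
rewrite (_ : - al0 +i* be0 =
    w * conjc (((al0 + s * be0) / 2) -i* ((s * al0 - be0) / 2))) //.
by apply: eqC; rewrite /w /=; field: s3.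
Qed.

(* If P0 is on the ray bounding a sector while P1 is in the outer sector, then P0
   is on the corresponding segment of S. *)
Lemma ray_in_segment (a b c d X Y : R) : 0 <= a -> 0 < b -> 0 <= c -> 0 < d ->
  a ^+ 2 - b ^+ 2 = X -> c ^+ 2 - d ^+ 2 = X -> 2 * c * d = Y -> 2 * a * b = 1 - Y ->
  b ^+ 2 < 3 * a ^+ 2 -> 3 * c ^+ 2 = d ^+ 2 ->
  Y = - (s * X) /\ 0 <= Y <= 1 / 2.
Proof.
move=> a0 b0 c0 d0 X1 X0 Y0 Y1 hb hd.
have dE : d = s * c by apply: eq_mul_sqrt3 => //; exact: ltW.
have YX : Y = - (s * X) by rewrite -X0 -hd -Y0 dE; ring.
have ca : c < a by apply: sq_lt => //; lra.
have cb : s * c < b.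
  apply: mul_sqrt3_lt => //; first exact: ltW.
  have : c ^+ 2 < a ^+ 2 by rewrite ltr_pXn2r.
  lra.
have : c * (s * c) <= a * b.
  by apply: ler_pM; rewrite ?mulr_ge0 ?(ltW s0) ?(ltW ca) ?(ltW cb).
have : 0 <= c * (s * c) by rewrite mulr_ge0 // mulr_ge0 // ltW.
rewrite dE in Y0 => h1 h2; split => //; apply/andP; split; lra.
Qed.

(** On the line Y = 1/2, lying in the sector about the imaginary axis means Re z = - X >= 1 / (2
    sqrt 3): this is the real part of [Gammap], where the half-line starts. *)
Lemma ray_center (a b X : R) : 0 <= a -> 0 < b -> 3 * a ^+ 2 <= b ^+ 2 ->
  a ^+ 2 - b ^+ 2 = X -> 2 * a * b = 1 / 2 -> 1 <= - (2 * s * X).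
Proof.
move=> a0 b0 hab <- hY.
have sab : s * a <= b.
  rewrite leNgt; apply/negP => hlt.
  have : b ^+ 2 < (s * a) ^+ 2.
    by rewrite ltr_pXn2r ?nnegrE ?(ltW b0) // mulr_ge0 // ltW.
  by rewrite exprMn [s ^+ 2]expr2 s3; lra.
have : 0 <= (b - s * a) * (s * b + a).
  by rewrite mulr_ge0 ?subr_ge0 // addr_ge0 // mulr_ge0 // ltW.
have -> : (b - s * a) * (s * b + a) = s * (b ^+ 2 - a ^+ 2) - 2 * a * b by ring: s3.
lra.
Qed.

End Rotation.

(* The real part of the phase at x = 1 and at x = 0 agrees only if |P1| = |P0|. *)
Lemma phase_eq (a b c d X : R) : 0 <= a -> 0 < b -> 0 <= c -> 0 < d ->
  3 * a ^+ 2 <= b ^+ 2 -> 3 * c ^+ 2 <= d ^+ 2 ->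
  a ^+ 2 - b ^+ 2 = X -> c ^+ 2 - d ^+ 2 = X ->
  b * (b ^+ 2 - 3 * a ^+ 2) = d * (d ^+ 2 - 3 * c ^+ 2) -> b = d /\ a = c.
Proof.
move=> a0 b0 c0 d0 hb hd X1 X0 e.
have E1 : a ^+ 2 = X + b ^+ 2 by lra.
have E0 : c ^+ 2 = X + d ^+ 2 by lra.
have b2 : 0 < b ^+ 2 by rewrite exprn_gt0.
have bd : b = d.
  (* Eliminating a^2 turns the phase into - 2 b^3 - 3 X b, and the difference of two such values has
     the factor b - d. *)
  have : (b - d) * (2 * (b ^+ 2 + b * d + d ^+ 2) + 3 * X) = 0.
    by move: e; rewrite E1 E0; lra.
  have F : 0 < 2 * (b ^+ 2 + b * d + d ^+ 2) + 3 * X.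
    by have := mulr_gt0 b0 d0; have := sqr_ge0 a; have := sqr_ge0 c; lra.
  by move/eqP; rewrite mulf_eq0 (gt_eqF F) orbF subr_eq0 => /eqP.
by split => //; apply: sq_eq => //; rewrite E1 E0 bd.
Qed.

(* [s] is the square root of 3; the three exclusions say that z is not on the
   segments or on the half-line of S in the upper half-plane, where
   X + iY = i (1 + delta) - z. *)
Lemma spath_exists (s X Y : R) : 0 < s -> s ^+ 2 = 3 ->
  ~ (Y - 1 = s * X /\ - (1 / 2) <= Y - 1 <= 0) ->
  ~ (Y = - (s * X) /\ 0 <= Y <= 1 / 2) ->
  ~ (Y = 1 / 2 /\ 1 <= - (2 * s * X)) ->
  exists p1 p0 : R[i], [/\ p1 * p1 = X +i* Y, p0 * p0 = X +i* (Y - 1) & spath p1 p0].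
Proof.
move=> s0 s2 e1 e2 e3.
(* X + i (Y - t) is the value of V - z at x = 1 - t. If it avoids the nonpositive real axis, the
   path may stay on the real segment. *)
have [hv|hv] := pselect (forall t : R, 0 <= t <= 1 -> Y - t = 0 -> 0 < X).
  exact: spath_vertical.
have [X0 Y0 Y1] : [/\ X <= 0, 0 <= Y & Y <= 1].
  move/existsNP: hv => [t /not_implyP[/andP[t0 t1] /not_implyP[yt /negP]]].
  by rewrite -leNgt => X0; split; lra.
have hY0 : Y = 0 -> X < 0.
  move=> y; rewrite lt_neqAle X0 andbT; apply/eqP => x; apply: e2.
  by rewrite x y; split; [ring|apply/andP; split; lra].
have hY1 : 1 - Y = 0 -> X < 0.
  move=> y; rewrite lt_neqAle X0 andbT; apply/eqP => x; apply: e1.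
  by rewrite x; split; [lra|apply/andP; split; lra].
have [al1 [be1 [a1 b1 X1 Y1E]]] := sqrt_real_neg Y0 hY0.
have Y'0 : 0 <= 1 - Y by lra.
have [al0 [be0 [a0 b0 X0E Y0E]]] := sqrt_real_neg Y'0 hY1.
pose p1 : R[i] := al1 +i* be1; pose p0 : R[i] := - al0 +i* be0.
have p1E : p1 * p1 = X +i* Y by apply: eqC; rewrite /p1 /=; lra.
have p0E : p0 * p0 = X +i* (Y - 1) by apply: eqC; rewrite /p0 /=; lra.
have s3 : s * s = 3 by rewrite -expr2.
have b1' := ltW b1; have b0' := ltW b0.
(* Each end is either in an outer sector, within pi/3 of the real axis, or in the closed middle
   sector about the imaginary axis. Two outer ends, taken as - p1 and p0, are joined across the
   negative real axis; an outer and a middle end lie in adjacent sectors; two middle ends are joined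
   by the cubic path. *)
have [A1|B1] := ltP (be1 ^+ 2) (3 * al1 ^+ 2);
  have [A0|B0] := ltP (be0 ^+ 2) (3 * al0 ^+ 2).
- have pos (a b : R) : 0 <= a -> b ^+ 2 < 3 * a ^+ 2 -> 0 < a.
    move=> a' hb; rewrite lt_def a' andbT; apply/eqP => z.
    by move: hb; rewrite z expr0n mulr0 ltNge sqr_ge0.
  have h := spath_rev (spath_sector (pos _ _ a1 A1) b1 A1 (pos _ _ a0 A0) b0 A0).
  exists (- p1), (- (al0 -i* be0)); split => //; first by rewrite mulrNN.
  by rewrite -p0E; apply: eqC; rewrite /p0 /=; ring.
- exists (- p1), (- p0); rewrite !mulrNN; split => //.
  apply: (spath_upper_sectors s0 s3) => //; first exact: lt_mul_sqrt3.
  apply: mul_sqrt3_lt => //.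
  rewrite lt_neqAle B0 andbT; apply/eqP => e; apply: e1.
  have Y1E' : 2 * al1 * be1 = 1 - (1 - Y) by rewrite subKr.
  have [h /andP[h2 h3]] := ray_in_segment s0 s3 a1 b1 a0 b0 X1 X0E Y0E Y1E' A1 e.
  by split; [lra|apply/andP; split; lra].
- exists p1, p0; split => //.
  apply: (spath_lower_sectors s0 s3) => //; first exact: lt_mul_sqrt3.
  apply: mul_sqrt3_lt => //.
  rewrite lt_neqAle B1 andbT; apply/eqP => e; apply: e2.
  exact: (ray_in_segment s0 s3 a0 b0 a1 b1 X0E X1 Y1E Y0E A0 e).
have aa : 0 < al1 + al0.
  rewrite lt_def addr_ge0 // andbT paddr_eq0 //; apply/negP => /andP[/eqP z1 /eqP z0].
  by move: Y1E Y0E; rewrite z1 z0 !mulr0 !mul0r; lra.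
have : be1 * (be1 ^+ 2 - 3 * al1 ^+ 2) != be0 * (be0 ^+ 2 - 3 * al0 ^+ 2).
  apply/eqP => /(phase_eq a1 b1 a0 b0 B1 B0 X1 X0E)[eb ea]; apply: e3.
  have Yh : Y = 1 / 2 by move: Y1E Y0E; rewrite eb ea; lra.
  by split => //; apply: (ray_center s0 s3 a1 b1 B1 X1); rewrite Y1E.
case/(spath_cubic a1 b1 B1 a0 b0 B0 aa) => h; first by exists p1, p0.
by exists (- p1), (- p0); rewrite !mulrNN.
Qed.

End PathExistence.

(** * Uniformity in z by compactness *)

Section UniformEdge.
Variable R : realType.

Definition Splus (delta : R) : set R[i] :=
  segment (delta*i) (Gammap delta) `|` segment ((1 + delta)*i) (Gammap delta) `|`
  halfline (Gammap delta).

(** V - z at x = 1; subtracting i gives its limit at 0 from the right. *)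
Definition edge_pot (delta : R) (z : R[i]) : R[i] := (1 + delta)*i - z.

(** The root nearer to p: P - p^2 = (s - p) (s + p) bounds the square of the smaller factor. *)
Lemma sqrt_near (p P : R[i]) : exists2 q, q * q = P &
  nsq (q - p) ^+ 2 <= nsq (P - p * p).
Proof.
pose s := sqrtc P; have s2 : s * s = P by rewrite -expr2 sqr_sqrtc.
have e : nsq (s - p) * nsq (s + p) = nsq (P - p * p).
  by rewrite -nsqM -s2; congr nsq; ring.
have [h|h] := leP (nsq (s - p)) (nsq (s + p)).
  by exists s; rewrite // -e expr2 ler_wpM2l ?nsq_ge0.
exists (- s); first by rewrite mulrNN.
rewrite -e (_ : - s - p = - (s + p)) ?nsqN; last by ring.
by rewrite expr2 ler_wpM2r ?nsq_ge0 // ltW.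
Qed.

Lemma spath_off_Splus (delta : R) (z : R[i]) : ~ Splus delta z ->
  exists p1 p0 : R[i], [/\ p1 * p1 = edge_pot delta z,
    p0 * p0 = edge_pot delta z - 'i%C & spath p1 p0].
Proof.
case: z => a b hz; set s := Num.sqrt (3 : R).
have s0 : 0 < s by rewrite sqrtr_gt0.
have s2 : s ^+ 2 = 3 by rewrite sqr_sqrtr.
have ss : s * s = 3 by rewrite -expr2.
have sn0 : s != 0 by rewrite gt_eqF.
have [||| p1 [p0 [e1 e0 hp]]] := @spath_exists R s (- a) (1 + delta - b) s0 s2.
(* [Gammap] is at height delta + 1/2, half-way between the two end points on the imaginary axis;
   hence the factor 2 in the parameter. *)
- move=> [e /andP[h1 h2]]; apply: hz; left; left; exists (2 * (b - delta)).
    by apply/andP; split; lra.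
  have ba : b - delta = s * a by lra.
  apply: eqC; rewrite /Gammap /= -/s ba; first by field.
  have -> : delta = b - s * a by lra.
  by field.
- move=> [e /andP[h1 h2]]; apply: hz; left; right; exists (2 * (1 + delta - b)).
    by apply/andP; split; lra.
  have ba : 1 + delta - b = s * a by lra.
  apply: eqC; rewrite /Gammap /= -/s ba; first by field.
  have -> : delta = s * a + b - 1 by lra.
  by field.
- move=> [e h]; apply: hz; right; exists (a - 1 / (2 * s)).
    rewrite subr_ge0 ler_pdivrMr ?mulr_gt0 //; lra.
  by apply: eqC; rewrite /Gammap /= -/s; [ring|lra].
exists p1, p0; split=> //; [rewrite e1|rewrite e0]; apply: eqC; rewrite /edge_pot /=; ring.
Qed.

Lemma bpath_locally_uniform (delta : R) (z0 : R[i]) : ~ Splus delta z0 ->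
  exists c M rho : R, [/\ 0 < c, 0 < M, 0 < rho & forall z, nsq (z - z0) <= rho ->
    exists p1 p0 : R[i], [/\ p1 * p1 = edge_pot delta z,
      p0 * p0 = edge_pot delta z - 'i%C & bpath c M p1 p0]].
Proof.
move=> /spath_off_Splus[p1 [p0 [e1 e0 /spath_bpath[c [M [rho [c0 M0 r0 h]]]]]]].
exists c, M, (rho ^+ 2); split => //; first exact: exprn_gt0.
move=> z hz.
have [q1 q1E h1] := sqrt_near p1 (edge_pot delta z).
have [q0 q0E h0] := sqrt_near p0 (edge_pot delta z - 'i%C).
exists q1, q0; split => //; apply: h.
  have : nsq (q1 - p1) ^+ 2 <= rho ^+ 2.
    apply: le_trans h1 _; rewrite e1 /edge_pot.
    by rewrite (_ : _ - _ = z0 - z) 1?nsqB //; ring.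
  by rewrite ler_pXn2r ?nnegrE ?nsq_ge0 // ltW.
have : nsq (q0 - p0) ^+ 2 <= rho ^+ 2.
  apply: le_trans h0 _; rewrite e0 /edge_pot.
  by rewrite (_ : _ - _ = z0 - z) 1?nsqB //; ring.
by rewrite ler_pXn2r ?nnegrE ?nsq_ge0 // ltW.
Qed.

Lemma nsq_normC (z : R[i]) (e : R) : 0 < e -> nsq z < e ^+ 2 -> `|z| < e%:C.
Proof.
move=> e0; case: z => a b; rewrite /nsq /= => h.
rewrite normc_def /= ltcR (_ : e = Num.sqrt (e ^+ 2)).
  by rewrite ltr_sqrt // exprn_gt0.
by rewrite sqrtr_sqr gtr0_norm.
Qed.

(** Each point of the square has a neighbourhood with a common threshold for h: off [Splus] because
    the path can be perturbed, and on [Splus] because the neighbourhood lies in the excluded set. *)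
Lemma edge_uniform (delta eps eta : R) (N : nat) : 0 < eps -> 0 < eta ->
  exists2 h0 : R, 0 < h0 & forall (h : R) (z : R[i]), 0 < h -> h < h0 ->
    `|Re z| <= N%:R -> `|Im z| <= N%:R -> ~ Nhd (Splus delta) eps z ->
    forall u u1, edge_solution h (edge_pot delta z) u u1 ->
    nsq ((h ^+ 2)%:C * u1 0 ^+ 2 - (edge_pot delta z - 'i%C) * u 0 ^+ 2) <=
      eta * nsq (edge_pot delta z - 'i%C) * nsq (u 0) ^+ 2 /\
    (u 0 = 0 -> u1 0 = 0).
Proof.
move=> eps0 eta0.
pose good (h : R) (z : R[i]) := 0 < h -> ~ Nhd (Splus delta) eps z ->
  forall u u1, edge_solution h (edge_pot delta z) u u1 ->
    nsq ((h ^+ 2)%:C * u1 0 ^+ 2 - (edge_pot delta z - 'i%C) * u 0 ^+ 2) <=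
      eta * nsq (edge_pot delta z - 'i%C) * nsq (u 0) ^+ 2 /\
    (u 0 = 0 -> u1 0 = 0).
pose Pr (h : R) (x : R * R) := good h (x.1 +i* x.2).
pose K : set (R * R) := `[- N%:R, N%:R] `*` `[- N%:R, N%:R].
have cK : compact K by apply: compact_setX; exact: segment_compact.
have nearz (z0 : R * R) (r : R) : 0 < r ->
    \forall z \near z0, nsq ((z.1 +i* z.2) - (z0.1 +i* z0.2)) <= r.
  move=> r0; pose d := Num.min 1 (r / 2).
  have d0 : 0 < d by rewrite lt_min ltr01 divr_gt0.
  have d1 : d <= 1 by rewrite ge_min lexx.
  have dr : d <= r / 2 by rewrite ge_min lexx orbT.
  exists (ball z0.1 d, ball z0.2 d); first by split; exact: nbhsx_ballx.
  move=> [a b] /= [ha hb].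
  rewrite /nsq /=.
  have sq (x y : R) : ball x d y -> (y - x) ^+ 2 <= d.
    rewrite /ball /= ltr_distl => /andP[? ?]; nra.
  have := sq _ _ ha; have := sq _ _ hb; lra.
have loc (x : R * R) : K x -> \forall x' \near x & h \near 0^'+, Pr h x'.
  move=> _; case: x => a b.
  have [hS|hS] := pselect (Splus delta (a +i* b)).
    exists ([set z : R * R | nsq ((z.1 +i* z.2) - (a +i* b)) <= eps ^+ 2 / 2], setT).
      split; last exact: filterT.
      by apply: (nearz (a, b)); rewrite divr_gt0 // exprn_gt0.
    move=> [z h] [/= hz _] _ []; exists (a +i* b), ((z.1 +i* z.2) - (a +i* b)).
    split => //; last by rewrite addrC subrK.
    apply: nsq_normC => //; apply: le_lt_trans hz _.
    by have := exprn_gt0 2 eps0; lra.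
  have [c [M [rho [c0 M0 r0 hp]]]] := bpath_locally_uniform hS.
  have [C C0 CE] : exists2 C : R, 0 < C & 1024 = C by exists 1024; rewrite ?ltr0n.
  pose eta' := Num.min (1 / 16) (eta / C).
  have eta'0 : 0 < eta' by rewrite lt_min !divr_gt0.
  have eta'1 : eta' <= 1 / 16 by rewrite ge_min lexx.
  have eta'2 : C * eta' <= eta.
    by rewrite mulrC -ler_pdivlMr // ge_min lexx orbT.
  have Mc : 0 < 2 + 2 * (M / c) by rewrite ltr_wpDr // mulr_ge0 // divr_ge0 // ltW.
  pose h1 := Num.min 1 (4 * c * eta' / (2 + 2 * (M / c))).
  have h10 : 0 < h1 by rewrite lt_min ltr01 divr_gt0 // !mulr_gt0.
  exists ([set z : R * R | nsq ((z.1 +i* z.2) - (a +i* b)) <= rho], [set h | h < h1]).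
    split; first exact: (nearz (a, b)).
    exact: nbhs_right_lt.
  move=> [z h] [/= hz hh] hpos _ u u1 hu.
  have [p1 [p0 [e1 e0 hpath]]] := hp _ hz.
  have hle1 : h <= 1 by apply: ltW; apply: lt_le_trans hh _; rewrite ge_min lexx.
  have hc : h * (2 + 2 * (M / c)) <= 4 * c * eta'.
    by rewrite -ler_pdivlMr // ltW //; apply: lt_le_trans hh _; rewrite ge_min lexx orbT.
  have [H1 H2] := edge_estimate c0 M0 eta'0 eta'1 hpos hle1 hc e1 e0 hpath hu.
  split; last exact: H2.
  apply: le_trans H1 _; rewrite CE.
  by do 2!(apply: ler_wpM2r; first by rewrite ?sqr_ge0 ?nsq_ge0).
have := (compact_near_coveringP K).1 cK _ _ Pr (at_right_proper_filter 0) loc.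
case=> e /= e0 he.
exists e => // h z h0 hlt hr hi hn u u1 hu.
have Kz : K (Re z, Im z).
  by split => /=; rewrite in_itv /= -ler_norml.
have hb : ball (0 : R) e h by rewrite /ball /= sub0r normrN gtr0_norm.
have := he h hb h0 (Re z, Im z) Kz; rewrite /Pr /=.
have -> : Re z +i* Im z = z by case: (z).
by move=> /(_ h0 hn u u1 hu).
Qed.

End UniformEdge.

(** * Linear Volterra systems *)

Section Primitive.
Variable R : realType.
Local Notation mu := (@lebesgue_measure R).
Implicit Types (f g : R -> R) (x t : R).

Definition prim f x : R := \int[mu]_(t in `[-1, x]) f t.

Definition integ f := mu.-integrable `[-1, 1] (EFin \o f).

(** A class stable under products, primitives and the limits of Picard iteration, and large enough
    to contain V, which jumps at 0. *)
Definition bm f := measurable_fun `[(-1 : R), 1] f /\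
  exists M, forall x, -1 <= x <= 1 -> `|f x| <= M.

Lemma bm_integ f : bm f -> integ f.
Proof.
move=> [mf [M hM]]; apply: measurable_bounded_integrable => //.
  by apply: compact_finite_measure; exact: segment_compact.
exists M; split; first exact: num_real.
by move=> y My x /=; rewrite in_itv /= => /hM h; apply: le_trans h (ltW My).
Qed.

Lemma integ_sub f x : integ f -> x <= 1 ->
  mu.-integrable `[-1, x] (EFin \o f).
Proof.
move=> hf x1; apply: integrableS hf => //.
by apply: subset_itvl; rewrite bnd_simp.
Qed.

Lemma integD f g : integ f -> integ g -> integ (fun x => f x + g x).
Proof.
move=> hf hg; rewrite /integ (_ : _ \o _ = (EFin \o f) \+ (EFin \o g))%E.
  exact: integrableD.
by apply/funext => x.
Qed.

Lemma integZ f (c : R) : integ f -> integ (fun x => c * f x).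
Proof.
move=> hf; rewrite /integ (_ : _ \o _ = (fun x => c%:E * (EFin \o f) x)%E).
  exact: integrableZl.
by apply/funext => x.
Qed.

Lemma primD f g x : integ f -> integ g -> x <= 1 ->
  prim (fun t => f t + g t) x = prim f x + prim g x.
Proof. by move=> hf hg x1; rewrite /prim RintegralD //; exact: integ_sub. Qed.

Lemma primB f g x : integ f -> integ g -> x <= 1 ->
  prim (fun t => f t - g t) x = prim f x - prim g x.
Proof. by move=> hf hg x1; rewrite /prim RintegralB //; exact: integ_sub. Qed.

Lemma primZ f (c : R) x : integ f -> x <= 1 ->
  prim (fun t => c * f t) x = c * prim f x.
Proof. by move=> hf x1; rewrite /prim RintegralZl //; exact: integ_sub. Qed.

Lemma eq_prim f g x : x <= 1 -> (forall t, -1 <= t <= 1 -> f t = g t) ->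
  prim f x = prim g x.
Proof.
move=> x1 fg; apply: eq_Rintegral => t; rewrite inE /= in_itv /= => /andP[t1 tx].
by apply: fg; rewrite t1 (le_trans tx).
Qed.

Lemma prim_continuous f : integ f -> {within `[-1, 1], continuous (prim f)}.
Proof. by move=> hf; apply: parameterized_integral_continuous => //; lra. Qed.

Lemma within_bm f : {within `[-1, 1], continuous f} -> bm f.
Proof.
move=> cf; split; first exact: measurable_realfun.subspace_continuous_measurable_fun.
have h : -1 <= 1 :> R by lra.
have cn : {within `[-1, 1], continuous (fun x => `|f x|)}.
  by move=> x; apply: (@cvg_comp _ _ _ f Num.norm _ (nbhs (f x))); [exact: cf|exact: norm_continuous].
have [c _ hc] := EVT_max h cn.
by exists `|f c| => x x1; apply: hc; rewrite in_itv.
Qed.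

Lemma prim_bm f : integ f -> bm (prim f).
Proof. by move=> hf; apply: within_bm; exact: prim_continuous. Qed.

Lemma bmD f g : bm f -> bm g -> bm (fun x => f x + g x).
Proof.
move=> [mf [M hM]] [mg [M' hM']]; split; first exact: measurable_realfun.measurable_funD.
by exists (M + M') => x hx; apply: le_trans (ler_normD _ _) _; apply: lerD; [exact: hM|exact: hM'].
Qed.

Lemma bmM f g : bm f -> bm g -> bm (fun x => f x * g x).
Proof.
move=> [mf [M hM]] [mg [M' hM']]; split; first exact: measurable_realfun.measurable_funM.
by exists (M * M') => x hx; rewrite normrM; apply: ler_pM => //; [exact: hM|exact: hM'].
Qed.

Lemma bm_cst (c : R) : bm (fun=> c).
Proof. by split; [exact: measurable_cst|exists `|c|]. Qed.

Lemma bmN f : bm f -> bm (fun x => - f x).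
Proof.
move=> hf; rewrite (_ : (fun x => _) = (fun x => -1 * f x)).
  by apply: bmM => //; exact: bm_cst.
by apply/funext => x; rewrite mulN1r.
Qed.

Lemma bm_sum n (f : 'I_n -> R -> R) : (forall i, bm (f i)) ->
  bm (fun x => \sum_(i < n) f i x).
Proof.
elim: n f => [|n IH] f hf.
  rewrite (_ : (fun x => _) = (fun=> 0)); first exact: bm_cst.
  by apply/funext => x; rewrite big_ord0.
rewrite (_ : (fun x => _) = (fun x => f ord0 x + \sum_(i < n) f (lift ord0 i) x)).
  by apply: bmD => //; apply: IH.
by apply/funext => x; rewrite big_ord_recl.
Qed.

Lemma prim_expR (lam : R) x : 0 < lam -> -1 <= x ->
  prim (fun t => lam * expR (lam * (t + 1))) x = expR (lam * (x + 1)) - 1.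
Proof.
move=> l0; rewrite le_eqVlt => /predU1P[<-|x1].
  by rewrite /prim set_itv1 Rintegral_set1 addNr mulr0 expR0 subrr.
have dF t : is_derive t (1 : R) (fun t => expR (lam * (t + 1))) (lam * expR (lam * (t + 1))).
  have h : is_derive t (1 : R) (fun t => lam * (t + 1)) lam.
    apply: is_derive_eq (is_derive_mul (is_derive_cst lam _ _)
      (is_derive_add (is_derive_id t (1 : R)) (is_derive_cst (1 : R) _ _))) _.
    by rewrite /=; ring.
  by apply: is_derive_eq (is_derive1_comp (is_derive_expR _) h) _; rewrite mulrC.
have cF t : {for t, continuous (fun t => expR (lam * (t + 1)))}.
  exact: is_derive_continuous (dF t).
have := @continuous_FTC2 R (fun t => lam * expR (lam * (t + 1)))
  (fun t => expR (lam * (t + 1))) (-1) x x1.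
rewrite /prim /Rintegral => ->.
- by rewrite addNr mulr0 expR0 -EFinB.
- apply: pointwise_within_continuous => t _; apply: continuousM; last exact: cF.
  exact: cvg_cst.
- split.
  + by move=> t _; case: (dF t).
  + by apply: cvg_at_right_filter; exact: cF.
  + by apply: cvg_at_left_filter; exact: cF.
by move=> t _; rewrite derive1E; apply: derive_val.
Qed.

Lemma prim_1 x : -1 <= x -> prim (fun=> 1) x = x + 1.
Proof.
rewrite le_eqVlt => /predU1P[<-|x1].
  by rewrite /prim set_itv1 Rintegral_set1 addNr.
have := @continuous_FTC2 R (fun=> 1) (fun t => t) (-1) x x1.
rewrite /prim /Rintegral => ->.
- by rewrite -EFinB /= opprK.
- by apply: pointwise_within_continuous => t _; exact: cvg_cst.
- by split=> [t _||]; [|exact: cvg_at_right_filter|exact: cvg_at_left_filter].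
by move=> t _; rewrite derive1E derive_id.
Qed.

Lemma prim_le f g x : integ f -> integ g -> x <= 1 ->
  (forall t, -1 <= t <= 1 -> `|f t| <= g t) -> `|prim f x| <= prim g x.
Proof.
move=> hf hg x1 fg; have hfx := integ_sub hf x1.
apply: le_trans (le_normr_Rintegral _ hfx) _ => //.
apply: le_Rintegral => //.
- by have := integrable_norm hfx.
- exact: integ_sub.
by move=> t /=; rewrite in_itv /= => /andP[t1 tx]; apply: fg; rewrite t1 (le_trans tx).
Qed.

(** Against the exponential weight, integration gains a factor 1 / lam; this gain makes the Volterra
    operator a contraction. *)
Lemma prim_weight f (C lam : R) : 0 < lam -> 0 <= C -> integ f ->
  (forall t, -1 <= t <= 1 -> `|f t| <= C * (lam * expR (lam * (t + 1)))) ->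
  forall x, -1 <= x <= 1 -> `|prim f x| <= C * expR (lam * (x + 1)).
Proof.
move=> l0 C0 hf hb x /andP[x0 x1].
have iw : integ (fun t => lam * expR (lam * (t + 1))).
  apply: bm_integ; apply: within_bm; apply: pointwise_within_continuous => t _.
  have h : is_derive t (1 : R) (fun t => lam * (t + 1)) lam.
    apply: is_derive_eq (is_derive_mul (is_derive_cst lam _ _)
      (is_derive_add (is_derive_id t (1 : R)) (is_derive_cst (1 : R) _ _))) _.
    by rewrite /=; ring.
  apply: continuousM; first exact: cvg_cst.
  exact: is_derive_continuous (is_derive1_comp (is_derive_expR _) h).
apply: le_trans (prim_le hf (integZ C iw) x1 hb) _.
rewrite primZ // prim_expR // ler_wpM2l //; lra.
Qed.

End Primitive.

Section VolterraSystem.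
Variables (R : realType) (n : nat).
Implicit Types (y : 'I_n -> R -> R) (x t : R).

(** The intervals [u k - d k, u k + d k] are nested, and the limit is the supremum of their left
    ends. *)
Lemma geometric_limit (u : nat -> R) (C : R) :
  (forall k, `|u k.+1 - u k| <= C / 2 ^+ k) ->
  exists l, forall k, `|l - u k| <= 2 * C / 2 ^+ k.
Proof.
move=> h; pose d k : R := 2 * C / 2 ^+ k.
have p2 k : 2 ^+ k != 0 :> R by rewrite expf_neq0 // pnatr_eq0.
have dS k : d k = C / 2 ^+ k + d k.+1.
  by rewrite /d exprS; field; exact: p2.
have C0 : 0 <= C by have := le_trans (normr_ge0 _) (h 0%N); rewrite expr0 divr1.
have d0 k : 0 <= d k by rewrite /d divr_ge0 ?mulr_ge0 ?exprn_ge0.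
have up k m : u k - d k <= u (k + m)%N - d (k + m)%N.
  elim: m => [|m IH]; first by rewrite addn0.
  apply: le_trans IH _; rewrite addnS dS.
  by have := h (k + m)%N; rewrite ler_norml => /andP[]; lra.
have dn k m : u (k + m)%N + d (k + m)%N <= u k + d k.
  elim: m => [|m IH]; first by rewrite addn0.
  apply: le_trans IH; rewrite addnS [d (k + m)%N]dS.
  by have := h (k + m)%N; rewrite ler_norml => /andP[]; lra.
have cross k m : u k - d k <= u m + d m.
  apply: le_trans (up k m) _; rewrite [(k + m)%N]addnC.
  apply: le_trans (dn m k); have := d0 (m + k)%N; lra.
pose E := range (fun k => u k - d k).
have hE : has_sup E.
  split; first by exists (u 0%N - d 0%N); exists 0%N.
  by exists (u 0%N + d 0%N) => _ [k _ <-]; exact: cross.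
exists (sup E) => k; rewrite -/(d k) ler_norml; apply/andP; split.
  have : u k - d k <= sup E by apply: sup_ubound; [exact: hE.2|exists k].
  lra.
have : sup E <= u k + d k.
  by apply: ge_sup; [exact: hE.1|move=> _ [m _ <-]; exact: cross].
lra.
Qed.

Variables (A : 'I_n -> 'I_n -> R -> R) (K : R).
Hypothesis mA : forall i j, bm (A i j).
Hypothesis K0 : 0 <= K.
Hypothesis bA : forall i j t, -1 <= t <= 1 -> `|A i j t| <= K.

Definition volt y i x := prim (fun t => \sum_(j < n) A i j t * y j t) x.

(* In the norm weighted by exp (- lamV (x + 1)) the Volterra operator contracts
   by a factor 1 / 2. *)
Definition lamV : R := 2 * (n%:R * K) + 1.

Definition weight x := expR (lamV * (x + 1)).

Lemma lamV_gt0 : 0 < lamV.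
Proof. by rewrite /lamV ltr_wpDl // !mulr_ge0. Qed.

Lemma weight_ge1 x : -1 <= x -> 1 <= weight x.
Proof.
move=> x1; rewrite /weight -[leLHS]expR0 ler_expR mulr_ge0 //; last by lra.
exact: ltW lamV_gt0.
Qed.

Lemma weight_le x : x <= 1 -> weight x <= expR (2 * lamV).
Proof.
move=> x1; rewrite /weight ler_expR mulrC ler_wpM2r //; last by lra.
exact: ltW lamV_gt0.
Qed.

Lemma bm_row y i : (forall j, bm (y j)) -> bm (fun t => \sum_(j < n) A i j t * y j t).
Proof. by move=> hy; apply: bm_sum => j; exact: bmM. Qed.

Lemma volt_contract y (C : R) : (forall j, bm (y j)) -> 0 <= C ->
  (forall j t, -1 <= t <= 1 -> `|y j t| <= C * weight t) ->
  forall i x, -1 <= x <= 1 -> `|volt y i x| <= C / 2 * weight x.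
Proof.
move=> hy C0 hC i x x1; apply: prim_weight => //.
- exact: lamV_gt0.
- by rewrite divr_ge0.
- exact/bm_integ/bm_row.
move=> t t1; apply: le_trans (ler_norm_sum _ _ _) _.
apply: le_trans (_ : \sum_(j < n) K * (C * weight t) <= _).
  apply: ler_sum => j _; rewrite normrM; apply: ler_pM => //.
  - exact: bA.
  - exact: hC.
rewrite sumr_const card_ord -[_ *+ n]mulr_natl -/(weight t).
have w0 : 0 <= C * weight t by rewrite mulr_ge0 // expR_ge0.
rewrite (_ : C / 2 * (lamV * weight t) = lamV / 2 * (C * weight t)); last by ring.
by rewrite mulrA ler_wpM2r // /lamV; lra.
Qed.

Lemma voltB y y' i x : (forall j, bm (y j)) -> (forall j, bm (y' j)) -> x <= 1 ->
  volt y i x - volt y' i x = volt (fun j t => y j t - y' j t) i x.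
Proof.
move=> hy hy' x1; rewrite /volt -primB //; [|exact/bm_integ/bm_row..].
apply: eq_prim => // t _; rewrite -sumrB; apply: eq_bigr => j _.
by rewrite mulrBr.
Qed.

Lemma bmB (f g : R -> R) : bm f -> bm g -> bm (fun x => f x - g x).
Proof. by move=> hf hg; apply: bmD => //; exact: bmN. Qed.

(** A bound (2 E + B) times the weight reproduces itself under the equation with B halved; B comes
    from boundedness and disappears in the limit. *)
Lemma volterra_bound y (F : 'I_n -> R -> R) (E : R) :
  (forall j, bm (y j)) ->
  (forall i x, -1 <= x <= 1 -> y i x = F i x + volt y i x) ->
  (forall i x, -1 <= x <= 1 -> `|F i x| <= E) -> 0 <= E ->
  forall i x, -1 <= x <= 1 -> `|y i x| <= 2 * E * expR (2 * lamV).
Proof.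
move=> hy hyF hF E0 i x x1.
have [B B0 hB] : exists2 B : R, 0 <= B &
    forall i t, -1 <= t <= 1 -> `|y i t| <= B.
  have hM j : exists M, forall x, -1 <= x <= 1 -> `|y j x| <= M by case: (hy j).
  have [M hM'] := choice hM.
  exists (\sum_(j < n) `|M j|) => [|j t t1]; first exact: sumr_ge0.
  apply: le_trans (hM' j t t1) _; apply: le_trans (ler_norm _) _.
  by rewrite (bigD1 j) //= lerDl sumr_ge0.
have iter k : forall i t, -1 <= t <= 1 -> `|y i t| <= (2 * E + B / 2 ^+ k) * weight t.
  elim: k => [|k IH] j t t1; have w1 : 1 <= weight t by apply: weight_ge1; case/andP: t1.
    rewrite expr0 divr1; apply: le_trans (hB j t t1) _.
    rewrite -[leLHS]mulr1; apply: ler_pM => //; lra.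
  rewrite hyF //; apply: le_trans (ler_normD _ _) _.
  have p2 : 0 < 2 ^+ k :> R by rewrite exprn_gt0.
  have C0 : 0 <= 2 * E + B / 2 ^+ k by rewrite addr_ge0 ?mulr_ge0 // divr_ge0 // ltW.
  have := volt_contract hy C0 IH j t1.
  have := hF j t t1.
  have -> : (2 * E + B / 2 ^+ k.+1) * weight t =
      E * weight t + (2 * E + B / 2 ^+ k) / 2 * weight t.
    by rewrite exprS; field; rewrite gt_eqF.
  have : E <= E * weight t by rewrite ler_peMr.
  lra.
have w : weight x <= expR (2 * lamV) by apply: weight_le; case/andP: x1.
have w1 : 1 <= weight x by apply: weight_ge1; case/andP: x1.
apply: le_trans (_ : 2 * E * weight x <= _); last by rewrite ler_wpM2l // mulr_ge0.
apply/ler_addgt0Pr => e e0.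
pose k := (Num.truncn (B * weight x / e)).+1.
have hk : B * weight x <= e * 2 ^+ k.
  rewrite [leRHS]mulrC -ler_pdivrMr //; apply: ltW; apply: lt_le_trans (truncnS_gt _) _.
  by rewrite -/k -natrX ler_nat; apply: ltnW; exact: ltn_expl.
apply: le_trans (iter k i x x1) _; rewrite mulrDl lerD2l mulrAC.
by rewrite ler_pdivrMr ?exprn_gt0.
Qed.

Lemma volterra_exists (F : 'I_n -> R -> R) : (forall i, bm (F i)) ->
  exists y, (forall i, bm (y i)) /\
    forall i x, -1 <= x <= 1 -> y i x = F i x + volt y i x.
Proof.
move=> hF.
have [E E0 hE] : exists2 B : R, 0 <= B &
    forall i t, -1 <= t <= 1 -> `|F i t| <= B.
  have hM j : exists M, forall x, -1 <= x <= 1 -> `|F j x| <= M by case: (hF j).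
  have [M hM'] := choice hM.
  exists (\sum_(j < n) `|M j|) => [|j t t1]; first exact: sumr_ge0.
  apply: le_trans (hM' j t t1) _; apply: le_trans (ler_norm _) _.
  by rewrite (bigD1 j) //= lerDl sumr_ge0.
pose Y := fix Y (k : nat) : 'I_n -> R -> R :=
  if k is m.+1 then fun i x => F i x + volt (Y m) i x else fun _ _ => 0.
have bY k : forall i, bm (Y k i).
  elim: k => [|k IH] i /=; first exact: bm_cst.
  by apply: bmD => //; apply: prim_bm; exact/bm_integ/bm_row.
have step k : forall i x, -1 <= x <= 1 -> `|Y k.+1 i x - Y k i x| <= E / 2 ^+ k * weight x.
  elim: k => [|k IH] i x x1.
    have w1 : 1 <= weight x by apply: weight_ge1; case/andP: x1.
    rewrite /= subr0 expr0 divr1 (_ : volt _ _ _ = 0).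
      by rewrite addr0; apply: le_trans (hE i x x1) _; rewrite ler_peMr.
    rewrite /volt (@eq_prim _ _ (fun=> 0 * 1)) //; first last.
    - by move=> t _; rewrite big1 ?mul0r // => j _; rewrite mulr0.
    - by case/andP: x1.
    rewrite (@primZ _ (fun=> 1)) ?mul0r //; first exact/bm_integ/bm_cst.
    by case/andP: x1.
  have -> : Y k.+2 i x - Y k.+1 i x = volt (Y k.+1) i x - volt (Y k) i x.
    by rewrite /=; ring.
  rewrite voltB //; last by case/andP: x1.
  have -> : E / 2 ^+ k.+1 = E / 2 ^+ k / 2.
    by rewrite exprS; field; rewrite expf_neq0 // pnatr_eq0.
  apply: volt_contract => //; first by move=> j; exact: bmB.
  by rewrite divr_ge0 // exprn_ge0.
have [y hy] : exists y, forall i x, -1 <= x <= 1 -> forall k,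
    `|y i x - Y k i x| <= 2 * (E * weight x) / 2 ^+ k.
  have h (p : 'I_n * R) : exists l, -1 <= p.2 <= 1 -> forall k,
      `|l - Y k p.1 p.2| <= 2 * (E * weight p.2) / 2 ^+ k.
    have [p1|np] := boolP (-1 <= p.2 <= 1); last by exists 0.
    have [|l hl] := @geometric_limit (fun k => Y k p.1 p.2) (E * weight p.2).
      by move=> k; rewrite mulrAC; exact: step.
    by exists l.
  have [l hl] := choice h.
  by exists (fun i x => l (i, x)) => i x x1; exact: (hl (i, x)).
have WE (t : R) : t <= 1 -> E * weight t <= E * expR (2 * lamV).
  by move=> t1; rewrite ler_wpM2l // weight_le.
have small (B e : R) : 0 <= B -> 0 < e -> exists N : nat, forall k, (N <= k)%N -> B / 2 ^+ k < e.
  move=> B0 e0; exists (Num.truncn (B / e)).+1 => k hk.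
  rewrite ltr_pdivrMr ?exprn_gt0 // mulrC -ltr_pdivrMr //.
  apply: lt_le_trans (truncnS_gt _) _; rewrite -natrX ler_nat.
  by apply: leq_trans hk _; apply: ltnW; exact: ltn_expl.
have bmy i : bm (y i).
  split.
    apply: (@measurable_realfun.measurable_fun_cvg _ _ _ _ (fun k => Y k i)).
      by move=> k; case: (bY k i).
    move=> x; rewrite /= in_itv /= => x1; apply/cvgrPdist_lt => e e0.
    have [|N hN] := small (2 * (E * weight x)) e _ e0.
      by rewrite !mulr_ge0 // expR_ge0.
    by exists N => // k Nk; apply: le_lt_trans (hy i x x1 k) (hN k Nk).
  exists (2 * (E * expR (2 * lamV))) => x x1.
  have := hy i x x1 0%N; rewrite /= subr0 expr0 divr1 => h; apply: le_trans h _.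
  by rewrite ler_wpM2l // WE //; case/andP: x1.
exists y; split => // i x x1.
apply/eqP; rewrite -subr_eq0 -normr_le0; apply/ler_addgt0Pr => e e0; rewrite add0r.
set W := E * weight x.
have W0 : 0 <= W by rewrite mulr_ge0 // expR_ge0.
have [|N hN] := small (4 * W) e _ e0; first by rewrite mulr_ge0.
have hW := hN N.+1 (leqnSn _); apply: le_trans (ltW hW).
have x1' : x <= 1 by case/andP: x1.
have -> : y i x - (F i x + volt y i x) = (y i x - Y N.+2 i x) -
    volt (fun j t => y j t - Y N.+1 j t) i x 
    by rewrite -(voltB i bmy (bY N.+1) x1') /=; ring.
apply: le_trans (ler_normB _ _) _.
have p2 : 2 ^+ N.+1 != 0 :> R by rewrite expf_neq0 // pnatr_eq0.
have h2 := hy i x x1 N.+2.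
have h1 : `|volt (fun j t => y j t - Y N.+1 j t) i x| <= 2 * E / 2 ^+ N.+1 / 2 * weight x.
  apply: volt_contract => //.
  - by move=> j; exact: bmB.
  - by rewrite divr_ge0 ?exprn_ge0 // mulr_ge0.
  by move=> j t t1; rewrite mulrAC -[2 * E * _]mulrA; exact: hy.
apply: le_trans (lerD h2 h1) _; rewrite -subr_ge0.
rewrite [leRHS](_ : _ = 2 * W / 2 ^+ N.+1).
  by rewrite divr_ge0 ?exprn_ge0 // mulr_ge0.
by rewrite /W !exprS; field; rewrite expf_neq0 // pnatr_eq0.
Qed.

End VolterraSystem.

(** * The equation f'' = q f + F' as a real Volterra system *)

Section ComplexVolterra.
Variable R : realType.
Implicit Types (f g q F : R -> R[i]) (z w : R[i]) (x t : R).

Definition cbm f := bm (fun x => Re (f x)) /\ bm (fun x => Im (f x)).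

Definition cint f x : R[i] :=
  prim (fun t => Re (f t)) x +i* prim (fun t => Im (f t)) x.

Definition n1 z : R := `|Re z| + `|Im z|.

Lemma n1_ge0 z : 0 <= n1 z.
Proof. by rewrite addr_ge0. Qed.

Lemma n1D z w : n1 (z + w) <= n1 z + n1 w.
Proof.
rewrite /n1 ReD ImD addrACA.
by apply: lerD; exact: ler_normD.
Qed.

Lemma n1N z : n1 (- z) = n1 z.
Proof. by rewrite /n1 ReN ImN !normrN. Qed.

Lemma n1M z w : n1 (z * w) <= n1 z * n1 w.
Proof.
rewrite /n1 ReM ImM.
have h1 := ler_normB (Re z * Re w) (Im z * Im w).
have h2 := ler_normD (Re z * Im w) (Im z * Re w).
apply: le_trans (lerD h1 h2) _; rewrite !normrM; lra.
Qed.

Lemma n1_eq0 z : n1 z <= 0 -> z = 0.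
Proof.
rewrite /n1 => h; have := normr_ge0 (Re z); have := normr_ge0 (Im z) => i0 r0.
by apply: eqC => /=; apply/normr0_eq0; lra.
Qed.

Lemma nsq_n1 z : nsq z <= n1 z ^+ 2.
Proof.
rewrite /nsq /n1 -(real_normK (num_real (Re z))) -(real_normK (num_real (Im z))).
by have := mulr_ge0 (normr_ge0 (Re z)) (normr_ge0 (Im z)); nra.
Qed.

Lemma cbmD f g : cbm f -> cbm g -> cbm (fun x => f x + g x).
Proof.
move=> [f1 f2] [g1 g2]; split.
  by under eq_fun do rewrite ReD; exact: bmD.
by under eq_fun do rewrite ImD; exact: bmD.
Qed.

Lemma cbmN f : cbm f -> cbm (fun x => - f x).
Proof.
move=> [f1 f2]; split.
  by under eq_fun do rewrite ReN; exact: bmN.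
by under eq_fun do rewrite ImN; exact: bmN.
Qed.

Lemma cbmM f g : cbm f -> cbm g -> cbm (fun x => f x * g x).
Proof.
move=> [f1 f2] [g1 g2]; split.
  by under eq_fun do rewrite ReM; apply: bmD; [|apply: bmN]; exact: bmM.
by under eq_fun do rewrite ImM; apply: bmD; exact: bmM.
Qed.

Lemma cbm_cst z : cbm (fun=> z).
Proof. by split; exact: bm_cst. Qed.

Lemma cintB f g x : cbm f -> cbm g -> x <= 1 ->
  cint (fun t => f t - g t) x = cint f x - cint g x.
Proof.
move=> [f1 f2] [g1 g2] x1; apply: eqC; rewrite /cint /= -primB //; do ?exact: bm_integ.
  by apply: eq_prim => // t _; rewrite ReD ReN.
by apply: eq_prim => // t _; rewrite ImD ImN.
Qed.

Lemma eq_cint f g x : x <= 1 -> (forall t, -1 <= t <= 1 -> f t = g t) ->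
  cint f x = cint g x.
Proof. by move=> x1 h; apply: eqC; apply: eq_prim => // t /h ->. Qed.

Lemma cintZ z f x : cbm f -> x <= 1 -> cint (fun t => z * f t) x = z * cint f x.
Proof.
move=> [f1 f2] x1; have [i1 i2] := (bm_integ f1, bm_integ f2).
apply: eqC; rewrite /cint /=.
  rewrite ReM /= -!primZ // -primB //; [|exact: integZ..].
  by apply: eq_prim => // t _; rewrite ReM.
rewrite ImM /= -!primZ // -primD //; [|exact: integZ..].
by apply: eq_prim => // t _; rewrite ImM.
Qed.

(** The integrated form of f'' = q f + F' with f(-1) = 0. The function F carries the initial slope
    F(-1) and the primitive of the right-hand side, so discontinuous q and square-integrable data
    are covered. *)
Definition vsol q F f (f' : R -> R[i]) := [/\ cbm f, cbm f',
  forall x, -1 <= x <= 1 -> f x = cint f' x &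
  forall x, -1 <= x <= 1 -> f' x = F x + cint (fun t => q t * f t) x].

Lemma vsol_sub q F G f f' g g' z : cbm q -> vsol q F f f' -> vsol q G g g' ->
  vsol q (fun x => F x - z * G x) (fun x => f x - z * g x) (fun x => f' x - z * g' x).
Proof.
move=> bq [bf bf' hf hf'] [bg bg' hg hg'].
have bz h : cbm h -> cbm (fun x => z * h x) by move=> bh; apply: cbmM => //; exact: cbm_cst.
split.
- by apply: cbmD => //; apply: cbmN; exact: bz.
- by apply: cbmD => //; apply: cbmN; exact: bz.
- move=> x x1; have x1' : x <= 1 by case/andP: x1.
  by rewrite cintB //; [rewrite cintZ // -hf // -hg|exact: bz].
move=> x x1; have x1' : x <= 1 by case/andP: x1.
rewrite (@eq_cint _ (fun t => q t * f t - z * (q t * g t))) //.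
  rewrite cintB //; [|exact: cbmM|by apply: bz; exact: cbmM].
  by rewrite cintZ //; [rewrite hf' // hg' //; ring|exact: cbmM].
by move=> t _; ring.
Qed.

(* The system for (Re f, Im f, Re f', Im f'). *)
Definition system_mx q (i j : nat) t : R :=
  match i, j with
  | 0%N, 2%N => 1 | 1%N, 3%N => 1
  | 2%N, 0%N => Re (q t) | 2%N, 1%N => - Im (q t)
  | 3%N, 0%N => Im (q t) | 3%N, 1%N => Re (q t)
  | _, _ => 0
  end.

Definition system_vec f (f' : R -> R[i]) (i : nat) t : R :=
  match i with
  | 0%N => Re (f t) | 1%N => Im (f t) | 2%N => Re (f' t) | _ => Im (f' t)
  end.

Lemma bm_system_mx q : cbm q -> forall i j : 'I_4, bm (system_mx q i j).
Proof.
move=> [b1 b2] [[|[|[|[|i]]]] hi] // [[|[|[|[|j]]]] hj] //=;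
  do ?[exact: bm_cst|exact: b1|exact: b2|exact: bmN].
Qed.

Lemma cbm_bounded q : cbm q -> exists2 K : R, 1 <= K &
  forall t, -1 <= t <= 1 -> n1 (q t) <= K.
Proof.
move=> [[_ [M hM]] [_ [M' hM']]]; exists (`|M| + `|M'| + 1).
  by have := normr_ge0 M; have := normr_ge0 M'; lra.
move=> t t1; rewrite /n1; have := hM t t1; have := hM' t t1.
have := ler_norm M; have := ler_norm M'; lra.
Qed.

Lemma system_mx_bounded q (K : R) : 1 <= K ->
  (forall t, -1 <= t <= 1 -> n1 (q t) <= K) ->
  forall (i j : 'I_4) t, -1 <= t <= 1 -> `|system_mx q i j t| <= K.
Proof.
move=> K1 hK i j t t1; have := hK t t1; rewrite /n1.
have r0 := normr_ge0 (Re (q t)); have i0 := normr_ge0 (Im (q t)).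
case: i => [[|[|[|[|i]]]] hi] //; case: j => [[|[|[|[|j]]]] hj] //= h;
  rewrite ?normr0 ?normr1 ?normrN; lra.
Qed.

Lemma system_volt q f f' (i : 'I_4) x : cbm q -> cbm f -> cbm f' -> x <= 1 ->
  volt (fun i j : 'I_4 => system_mx q i j) (fun j => system_vec f f' j) i x =
  system_vec (cint f') (cint (fun t => q t * f t)) i x.
Proof.
move=> bq bf bf' x1; case: i => [[|[|[|[|i]]]] hi] //=; rewrite /volt;
  apply: eq_prim => // t _; rewrite !big_ord_recl big_ord0 /= /bump /=;
  rewrite ?ReM ?ImM; ring.
Qed.

Lemma vsol_system q F f f' : cbm q -> vsol q F f f' ->
  forall (i : 'I_4) x, -1 <= x <= 1 -> system_vec f f' i x =
  system_vec (fun=> 0) F i x +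
  volt (fun i j : 'I_4 => system_mx q i j) (fun j => system_vec f f' j) i x.
Proof.
move=> bq [bf bf' hf hf'] i x x1; rewrite system_volt //; last by case/andP: x1.
by case: i => [[|[|[|[|i]]]] hi] //=;
  rewrite ?hf ?hf' ?add0r ?ReD ?ImD // system_volt.
Qed.

Lemma bm_system_vec f f' : cbm f -> cbm f' ->
  forall i : 'I_4, bm (system_vec f f' i).
Proof. by move=> [a b] [c d] [[|[|[|[|i]]]] hi]. Qed.

(** The constant depends on q alone; the bounded inverse of the operator comes from this. *)
Lemma vsol_bound q : cbm q -> exists2 C : R, 0 <= C & forall F f f' (E : R),
  vsol q F f f' -> 0 <= E -> (forall x, -1 <= x <= 1 -> n1 (F x) <= E) ->
  forall x, -1 <= x <= 1 -> n1 (f x) <= C * E.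
Proof.
move=> bq; have [K K1 hK] := cbm_bounded bq.
have K0 : 0 <= K by lra.
exists (4 * expR (2 * lamV 4 K)); first by rewrite mulr_ge0 // expR_ge0.
move=> F f f' E hv E0 hF x x1.
have [bf bf' _ _] := hv.
have h := volterra_bound (bm_system_mx bq) K0 (system_mx_bounded K1 hK)
  (bm_system_vec bf bf') (vsol_system bq hv) _ E0.
have hE : forall (i : 'I_4) x, -1 <= x <= 1 -> `|system_vec (fun=> 0) F i x| <= E.
  move=> i y y1; have := hF y y1; rewrite /n1.
  have := normr_ge0 (Re (F y)); have := normr_ge0 (Im (F y)).
  by case: i => [[|[|[|[|i]]]] hi] //= ? ? ?; rewrite ?normr0; lra.
have h0 := h hE (@Ordinal 4 0 isT) x x1.
have h1 := h hE (@Ordinal 4 1 isT) x x1.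
by move: h0 h1; rewrite /= /n1; lra.
Qed.

Lemma vsol_exists q F : cbm q -> cbm F -> exists f f', vsol q F f f'.
Proof.
move=> bq bF; have [K K1 hK] := cbm_bounded bq.
have K0 : 0 <= K by lra.
have [y [by0 hy]] := volterra_exists (bm_system_mx bq) K0 (system_mx_bounded K1 hK)
  (bm_system_vec (cbm_cst 0) bF).
pose f t : R[i] := y (@Ordinal 4 0 isT) t +i* y (@Ordinal 4 1 isT) t.
pose f' t : R[i] := y (@Ordinal 4 2 isT) t +i* y (@Ordinal 4 3 isT) t.
have bf : cbm f by split; apply: by0.
have bf' : cbm f' by split; apply: by0.
have yE : y = fun j => system_vec f f' j.
  apply/funext => -[[|[|[|[|i]]]] hi] //=; apply/funext => t;
    by congr (y _ t); apply: val_inj.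
exists f, f'; split => // x x1; have x1' : x <= 1 by case/andP: x1.
  apply: eqC.
    have := hy (@Ordinal 4 0 isT) x x1; rewrite {2}yE system_volt //= add0r.
    by move=> ->.
  have := hy (@Ordinal 4 1 isT) x x1; rewrite {2}yE system_volt //= add0r.
  by move=> ->.
apply: eqC.
  have := hy (@Ordinal 4 2 isT) x x1; rewrite {2}yE system_volt //= ReD => ->.
  by [].
have := hy (@Ordinal 4 3 isT) x x1; rewrite {2}yE system_volt //= ImD => ->.
by [].
Qed.

End ComplexVolterra.

(** * Spectrum and the shooting problem *)

Section SquareIntegrable.
Variable R : realType.
Local Notation mu := (@lebesgue_measure R).
Implicit Types (f g k : R -> R[i]) (x t : R).

Lemma measurable_oI_cI (f : R -> R) : measurable_fun (@oI R) f ->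
  measurable_fun `[(-1 : R), 1] f.
Proof. exact: measurable_realfun.measurable_fun_itv_cc. Qed.

Lemma measurable_cI_oI (f : R -> R) : measurable_fun `[(-1 : R), 1] f ->
  measurable_fun (@oI R) f.
Proof.
apply: measurable_funS => //.
by move=> x /=; rewrite !in_itv /= => /andP[? ?]; apply/andP; split; exact: ltW.
Qed.

Lemma measurable_nsq (D : set R) f : measurable_fun D (fun x => Re (f x)) ->
  measurable_fun D (fun x => Im (f x)) -> measurable_fun D (fun x => nsq (f x)).
Proof.
move=> h1 h2; rewrite (_ : (fun x => _) = (fun x =>
   Re (f x) * Re (f x) + Im (f x) * Im (f x))).
  by apply: measurable_realfun.measurable_funD; exact: measurable_realfun.measurable_funM.
by apply/funext => x; rewrite /nsq !expr2.
Qed.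

Lemma L2normsq_cI f : measurable_fun (@oI R) (fun x => Re (f x)) ->
  measurable_fun (@oI R) (fun x => Im (f x)) ->
  L2normsq f = (\int[mu]_(x in `[(-1)%R, 1%R]) (nsq (f x))%:E)%E.
Proof.
move=> h1 h2; rewrite /L2normsq /oI -(integral_itv_bndoo true false) //.
by apply/measurable_realfun.measurable_EFinP; exact: (measurable_nsq h1 h2).
Qed.

Lemma int_abs_nsq g :
  (\int[mu]_(x in `[(-1)%R, 1%R]) `|(EFin \o (fun t => nsq (g t))) x| =
   \int[mu]_(x in `[(-1)%R, 1%R]) (nsq (g x))%:E)%E.
Proof. by apply: eq_integral => x _ /=; rewrite ger0_norm // nsq_ge0. Qed.

Lemma L2_nsq g : L2 g -> integ (fun x => nsq (g x)) /\
  prim (fun x => nsq (g x)) 1 = L2norm g ^+ 2.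
Proof.
move=> [h1 h2 h3].
have e := L2normsq_cI h1 h2.
split.
  apply/integrableP; split.
    apply/measurable_realfun.measurable_EFinP; apply: measurable_oI_cI.
    exact: measurable_nsq.
  by rewrite int_abs_nsq -e.
rewrite /L2norm sqr_sqrtr; first by rewrite e.
by apply: fine_ge0; apply: integral_ge0 => x _; rewrite lee_fin; exact: nsq_ge0.
Qed.

(** Square-integrable functions are integrable on a bounded interval, by |p| <= 1 + |p|^2. *)
Lemma integ_nsq_dom g (p : R -> R) : L2 g -> measurable_fun (@oI R) p ->
  (forall x, p x ^+ 2 <= nsq (g x)) -> integ p.
Proof.
move=> hg mp hp; have [i _] := L2_nsq hg.
have i1 : integ (fun x => 1 + nsq (g x)).
  by apply: integD => //; apply/bm_integ/bm_cst.
apply: le_integrable i1 => //.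
  by apply/measurable_realfun.measurable_EFinP; exact: measurable_oI_cI.
move=> x _ /=; rewrite lee_fin [leRHS]ger0_norm; last by rewrite addr_ge0 // nsq_ge0.
have := hp x; rewrite -(real_normK (num_real (p x))); have := sqr_ge0 (`|p x| - 1); nra.
Qed.

Lemma Re_sqr_le (z : R[i]) : Re z ^+ 2 <= nsq z.
Proof. by rewrite /nsq lerDl sqr_ge0. Qed.

Lemma L2_integ g : L2 g ->
  integ (fun x => Re (g x)) /\ integ (fun x => Im (g x)).
Proof.
move=> hg; have [h1 h2 _] := hg; split; apply: (integ_nsq_dom hg) => // x.
  exact: Re_sqr_le.
exact: Im_sqr_le.
Qed.

Lemma prim_mono (f : R -> R) x : integ f -> (forall t, 0 <= f t) ->
  -1 <= x <= 1 -> prim f x <= prim f 1.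
Proof.
move=> hf f0 /andP[x0 x1]; rewrite -subr_ge0 /prim Rintegral_itvB //.
by apply: Rintegral_ge0.
Qed.

(* Cauchy-Schwarz on an interval of length 2, by the arithmetic-geometric mean
   inequality [|p| <= (l + p^2 / l) / 2] with [l] the norm of [g]. *)
Lemma prim_L2_le g (p : R -> R) x : L2 g -> integ p ->
  (forall x, p x ^+ 2 <= nsq (g x)) -> -1 <= x <= 1 ->
  `|prim p x| <= 2 * L2norm g.
Proof.
move=> hg ip hp x01; have [i e] := L2_nsq hg; have /andP[x0 x1] := x01.
have N0 : 0 <= L2norm g by exact: sqrtr_ge0.
have key l : 0 < l -> `|prim p x| <= l + L2norm g ^+ 2 / (2 * l).
  move=> l0; set c := (2 * l)^-1.
  have c0 : 0 < c by rewrite invr_gt0 mulr_gt0.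
  have i1 : integ (fun=> l / 2 : R) by apply/bm_integ/bm_cst.
  have i2 : integ (fun t => c * nsq (g t)) by exact: integZ.
  apply: le_trans (prim_le ip (integD i1 i2) x1 _) _.
    move=> t _; have := hp t; rewrite -(real_normK (num_real (p t))).
    move: `|p t| (nsq _) => a b ab.
    apply: le_trans (_ : l / 2 + c * a ^+ 2 <= _); last by rewrite lerD2l ler_wpM2l // ltW.
    rewrite -subr_ge0 (_ : _ - _ = c * (l - a) ^+ 2); last by rewrite /c; field; rewrite gt_eqF.
    by rewrite mulr_ge0 ?sqr_ge0 // ltW.
  rewrite (primD i1 i2) // (primZ c i) //; apply: lerD; last first.
    by rewrite -e mulrC ler_wpM2r ?(ltW c0) // prim_mono // => t; exact: nsq_ge0.
  rewrite (@eq_prim _ _ (fun=> l / 2 * 1)) //; last by move=> t _; rewrite mulr1.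
  rewrite (@primZ _ (fun=> 1)) //; last exact/bm_integ/bm_cst.
  by rewrite prim_1 //; nra.
have [n0|n0] := eqVneq (L2norm g) 0.
  rewrite n0 mulr0; apply/ler_addgt0Pr => l l0; rewrite add0r.
  by have := key l l0; rewrite n0 expr0n /= mul0r addr0.
have {}n0 : 0 < L2norm g by rewrite lt_def n0.
apply: le_trans (key _ n0) _.
rewrite (_ : _ / _ = L2norm g / 2); last by field; rewrite gt_eqF.
by lra.
Qed.

Lemma n1_cint_L2 g x : L2 g -> -1 <= x <= 1 -> n1 (cint g x) <= 4 * L2norm g.
Proof.
move=> hg x1; have [i1 i2] := L2_integ hg.
have := prim_L2_le hg i1 (fun t => Re_sqr_le (g t)) x1.
have := prim_L2_le hg i2 (fun t => Im_sqr_le (g t)) x1.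
by rewrite /n1 /cint /=; lra.
Qed.

Lemma L2_of_le f (p : R -> R) : measurable_fun (@oI R) (fun x => Re (f x)) ->
  measurable_fun (@oI R) (fun x => Im (f x)) -> integ p ->
  (forall x, -1 <= x <= 1 -> nsq (f x) <= p x) -> L2 f /\ L2norm f ^+ 2 <= prim p 1.
Proof.
move=> h1 h2 ip hp.
have hp0 x : -1 <= x <= 1 -> `|nsq (f x)| <= p x by move=> x1; rewrite ger0_norm ?nsq_ge0 // hp.
have i : integ (fun x => nsq (f x)).
  apply: le_integrable ip => //.
    apply/measurable_realfun.measurable_EFinP; apply: measurable_oI_cI.
    exact: measurable_nsq.
  move=> x /=; rewrite in_itv /= => x1; rewrite lee_fin.
  by apply: le_trans (hp0 x x1) _; exact: ler_norm.
have hf : L2 f.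
  split => //; rewrite L2normsq_cI //.
  by have /integrableP[_] := i; rewrite int_abs_nsq.
split => //; have [_ <-] := L2_nsq hf.
by apply: le_trans (ler_norm _) _; apply: prim_le.
Qed.

Lemma L2D f g : L2 f -> L2 g -> L2 (fun x => f x + g x).
Proof.
move=> hf hg; have [f1 f2 _] := hf; have [g1 g2 _] := hg.
have [i1 _] := L2_nsq hf; have [i2 _] := L2_nsq hg.
suff [] : L2 (fun x => f x + g x) /\ L2norm (fun x => f x + g x) ^+ 2 <=
  prim (fun x => 2 * nsq (f x) + 2 * nsq (g x)) 1 by [].
apply: L2_of_le.
- by under eq_fun do rewrite ReD; exact: measurable_realfun.measurable_funD.
- by under eq_fun do rewrite ImD; exact: measurable_realfun.measurable_funD.
- by apply: integD; exact: integZ.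
by move=> x _; exact: nsqD_le.
Qed.

Lemma L2Z (z : R[i]) f : L2 f -> L2 (fun x => z * f x).
Proof.
move=> hf; have [f1 f2 _] := hf; have [i1 _] := L2_nsq hf.
suff [] : L2 (fun x => z * f x) /\ L2norm (fun x => z * f x) ^+ 2 <=
  prim (fun x => nsq z * nsq (f x)) 1 by [].
have mc (c : R) (p : R -> R) : measurable_fun (@oI R) p -> measurable_fun (@oI R) (fun x => c * p x).
  by move=> mp; apply: measurable_realfun.measurable_funM => //; exact: measurable_cst.
apply: L2_of_le.
- under eq_fun do rewrite ReM; apply: measurable_realfun.measurable_funB; exact: mc.
- under eq_fun do rewrite ImM; apply: measurable_realfun.measurable_funD; exact: mc.
- exact: integZ.
by move=> x _; rewrite nsqM.
Qed.

Lemma L2_bounded f (B : R) : cbm f -> (forall x, -1 <= x <= 1 -> n1 (f x) <= B) ->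
  L2 f /\ L2norm f <= 2 * B.
Proof.
move=> [[m1 _] [m2 _]] hB.
have B0 : 0 <= B by apply: le_trans (n1_ge0 _) (hB 0 _); apply/andP; split; lra.
have [||||h hn] := @L2_of_le f (fun=> B ^+ 2 * 1).
- exact: measurable_cI_oI.
- exact: measurable_cI_oI.
- exact/bm_integ/bm_cst.
- move=> x x1; rewrite mulr1; apply: le_trans (nsq_n1 _) _.
  by rewrite ler_pXn2r ?nnegrE ?n1_ge0 // hB.
split => //; move: hn; rewrite (@primZ _ (fun=> 1)) //; last exact/bm_integ/bm_cst.
rewrite prim_1; last by lra.
move=> hn; rewrite -(@ler_pXn2r _ 2) ?nnegrE ?mulr_ge0 //; last exact: sqrtr_ge0.
by have := sqr_ge0 B; lra.
Qed.

Lemma cbm_L2 f : cbm f -> L2 f.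
Proof. by move=> bf; have [K _ hK] := cbm_bounded bf; case: (L2_bounded bf hK). Qed.

End SquareIntegrable.

(** * The Dirichlet problem and the resolvent *)

Section Resolvent.
Variable R : realType.
Local Notation mu := (@lebesgue_measure R).
Implicit Types (f g k q F u : R -> R[i]) (x t : R) (z : R[i]).

Lemma continuous_cI_cbm f : continuous_cI f -> cbm f.
Proof. by move=> [h1 h2]; split; exact: within_bm. Qed.

Lemma eq_within_continuous (p r : R -> R) : (forall x, -1 <= x <= 1 -> p x = r x) ->
  {within `[-1, 1], continuous p} -> {within `[-1, 1], continuous r}.
Proof.
move=> pr; apply: subspace_eq_continuous => x; rewrite inE /= in_itv /=.
exact: pr.
Qed.

Lemma near_itv (x : R) : -1 < x < 1 -> \forall t \near x, -1 < t < 1.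
Proof.
move=> x1; have : x \in `]-1, 1[ by rewrite in_itv.
move=> /near_in_itvoo; apply: filterS => t; by rewrite in_itv.
Qed.

Lemma prim_derive (p : R -> R) x : integ p -> -1 < x < 1 -> {for x, continuous p} ->
  is_derive x (1 : R) (prim p) (p x).
Proof.
move=> ip /andP[x0 x1] cp.
have [d e] := continuous_FTC1_closed x1 ip x0 cp.
have e' : 'D_1 (prim p) x = p x by rewrite -derive1E; exact: e.
exact: (DeriveDef d e').
Qed.

Definition integ2 g := integ (fun x => Re (g x)) /\ integ (fun x => Im (g x)).

Lemma cbm_integ2 g : cbm g -> integ2 g.
Proof. by move=> [h1 h2]; split; exact: bm_integ. Qed.

Lemma cint_continuous g : integ2 g -> continuous_cI (cint g).
Proof. by move=> [h1 h2]; split; exact: prim_continuous. Qed.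

Lemma continuous_cI_D f g : continuous_cI f -> continuous_cI g ->
  continuous_cI (fun x => f x + g x).
Proof.
move=> [f1 f2] [g1 g2]; split.
  by under eq_fun do rewrite ReD; exact: within_continuous_add.
by under eq_fun do rewrite ImD; exact: within_continuous_add.
Qed.

Lemma eq_continuous_cI f g : (forall x, -1 <= x <= 1 -> f x = g x) ->
  continuous_cI f -> continuous_cI g.
Proof.
move=> fg [h1 h2]; split; [apply: eq_within_continuous h1|apply: eq_within_continuous h2];
  by move=> x /fg ->.
Qed.

Lemma vsol_continuous q F f f' : cbm q -> vsol q F f f' -> continuous_cI F ->
  continuous_cI f /\ continuous_cI f'.
Proof.
move=> bq [bf bf' hf hf'] cF; split.
  apply: (@eq_continuous_cI (cint f')) => [x /hf //|].
  by apply: cint_continuous; exact: cbm_integ2.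
apply: (@eq_continuous_cI (fun x => F x + cint (fun t => q t * f t) x)) => [x /hf' //|].
by apply: continuous_cI_D => //; apply/cint_continuous/cbm_integ2/cbmM.
Qed.

Lemma within_for (p : R -> R) x : {within `[-1, 1], continuous p} -> -1 < x < 1 ->
  {for x, continuous p}.
Proof.
move=> cp x1; have ab : -1 < 1 :> R by lra.
have [c _ _] := (continuous_within_itvP p ab).1 cp.
by apply: c; rewrite in_itv.
Qed.

Lemma cint_derive g x : integ2 g -> -1 < x < 1 ->
  {for x, continuous (fun t => Re (g t))} -> {for x, continuous (fun t => Im (g t))} ->
  cderiv (cint g) x (g x).
Proof. by move=> [i1 i2] x1 c1 c2; split; exact: prim_derive. Qed.

Lemma near_eq_cderiv f g x d : (forall t, -1 < t < 1 -> f t = g t) -> -1 < x < 1 ->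
  cderiv f x d -> cderiv g x d.
Proof.
move=> fg x1 [h1 h2]; split.
  by apply: near_eq_is_derive h1; near=> t; rewrite fg //; near: t; exact: near_itv.
by apply: near_eq_is_derive h2; near=> t; rewrite fg //; near: t; exact: near_itv.
Unshelve. all: by end_near. Qed.

Lemma vsol_derive q F f f' x : cbm q -> vsol q F f f' -> continuous_cI F ->
  -1 < x < 1 -> cderiv f x (f' x).
Proof.
move=> bq hv cF x1; have [_ [c1 c2]] := vsol_continuous bq hv cF.
have [bf bf' hf hf'] := hv.
apply: (@near_eq_cderiv (cint f')) => //.
  by move=> t /andP[t0 t1]; rewrite hf // !ltW.
apply: cint_derive => //; [exact: cbm_integ2|exact: within_for|exact: within_for].
Qed.

Section Dirichlet.
Variables (q u u' : R -> R[i]).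
Hypotheses (bq : cbm q) (hu : vsol q (fun=> 1) u u') (u1 : u 1 != 0).

(** The constant c stands for the unknown initial slope, on which no bound is given. The function f
    - c u has the forcing F - c, hence is controlled, and its value at 1 is - c u(1), which bounds c
    because u(1) is nonzero. *)
Lemma dirichlet_bound : exists2 C : R, 0 <= C & forall F f f' c (E : R),
  vsol q F f f' -> f 1 = 0 -> 0 <= E ->
  (forall x, -1 <= x <= 1 -> n1 (F x - c) <= E) ->
  forall x, -1 <= x <= 1 -> n1 (f x) <= C * E.
Proof.
have [C C0 hC] := vsol_bound bq.
set m := n1 (u 1)^-1; have m0 : 0 <= m by exact: n1_ge0.
exists (C + C * m * C); first by rewrite addr_ge0 // !mulr_ge0.
move=> F f f' c E hf f1 E0 hE x x1.
have hw := vsol_sub c bq hf hu.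
have hF y : -1 <= y <= 1 -> n1 (F y - c * 1) <= E by rewrite mulr1; exact: hE.
have b := hC _ _ _ E hw E0 hF.
have hu1 y : -1 <= y <= 1 -> n1 (u y) <= C * 1.
  apply: (hC _ _ _ 1 hu) => // t _.
  by rewrite /n1 /= normr1 normr0 addr0.
have i1 : -1 <= (1 : R) <= 1 by apply/andP; split; lra.
have hc : n1 c <= C * E * m.
  have -> : c = - (f 1 - c * u 1) * (u 1)^-1 by rewrite f1 sub0r opprK mulfK.
  apply: le_trans (n1M _ _) _; rewrite n1N ler_wpM2r //; exact: b.
have -> : f x = (f x - c * u x) + c * u x by rewrite subrK.
apply: le_trans (n1D _ _) _.
have h1 := b x x1.
have h2 : n1 (c * u x) <= C * E * m * (C * 1).
  by apply: le_trans (n1M _ _) _; apply: ler_pM; rewrite ?n1_ge0 // hu1.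
by apply: le_trans (lerD h1 h2) _; rewrite le_eqVlt; apply/orP; left; apply/eqP; ring.
Qed.

Lemma dirichlet_exists F : cbm F -> exists f f' c,
  vsol q (fun x => F x - c * 1) f f' /\ f 1 = 0.
Proof.
move=> bF; have [w [w' hw]] := vsol_exists bq bF.
pose c := w 1 / u 1.
exists (fun x => w x - c * u x), (fun x => w' x - c * u' x), c; split.
  exact: vsol_sub.
by rewrite /c divfK // subrr.
Qed.

End Dirichlet.

Section Hop.
Variables (delta h : R) (z : R[i]).
Hypothesis h0 : 0 < h.

Definition hq t : R[i] := (h ^- 2)%:C * (Vdelta delta t - z).

Lemma cbm_V : cbm (Vdelta delta).
Proof.
have e : (fun t => Im (Vdelta delta t)) =
    (fun t => if t < 0 then t - delta else if 0 < t then t + delta else 0).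
  by apply/funext => t; rewrite /Vdelta; case: ifP => // _; case: ifP.
split.
  rewrite (_ : (fun t => _) = (fun=> 0)); first exact: bm_cst.
  by apply/funext => t; rewrite /Vdelta; case: ifP => // _; case: ifP.
rewrite e; split.
  apply: (@measurable_funS _ _ _ _ setT) => //.
  have m1 : measurable_fun setT (fun t : R => t - delta).
    by apply: measurable_realfun.measurable_funB; [exact: measurable_id|exact: measurable_cst].
  have m2 : measurable_fun setT (fun t : R => t + delta).
    by apply: measurable_realfun.measurable_funD; [exact: measurable_id|exact: measurable_cst].
  apply: measurable_fun_ifT => //.
    by apply: measurable_realfun.measurable_fun_ltr; [exact: measurable_id|exact: measurable_cst].
  apply: measurable_fun_ifT => //.
  by apply: measurable_realfun.measurable_fun_ltr; [exact: measurable_cst|exact: measurable_id].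
exists (1 + `|delta|) => x /andP[x0 x1].
have d0 := normr_ge0 delta.
have nx : `|x| <= 1 by rewrite ler_norml x0.
case: ifP => _; first by apply: le_trans (ler_normB _ _) _; rewrite lerD2r.
case: ifP => _; first by apply: le_trans (ler_normD _ _) _; rewrite lerD2r.
by rewrite normr0 addr_ge0.
Qed.

Lemma cbm_hq : cbm hq.
Proof.
apply: cbmM; first exact: cbm_cst.
by apply: cbmD; [exact: cbm_V|exact: cbm_cst].
Qed.

Lemma ae_sub (P Q : R -> Prop) : {ae mu, forall x, P x} ->
  (forall x, P x -> Q x) -> {ae mu, forall x, Q x}.
Proof.
move=> [N [mN N0 PN]] PQ; exists N; split => // x /= nQ.
by apply: PN => /= /PQ.
Qed.

Lemma ae_neq (a : R) : {ae mu, forall x : R, x != a}.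
Proof.
exists [set a]; split => //; first exact: lebesgue_measure_set1.
by move=> x /= /negP; rewrite negbK => /eqP.
Qed.

Lemma prim_ae (p r : R -> R) x : measurable_fun (@oI R) p -> measurable_fun (@oI R) r ->
  {ae mu, forall t, oI t -> p t = r t} -> x <= 1 -> prim p x = prim r x.
Proof.
move=> mp mr pr x1; rewrite /prim /Rintegral; congr fine.
have sub : `[(-1 : R), x] `<=` `[(-1 : R), 1].
  by apply: subset_itvl; rewrite bnd_simp.
apply: ae_eq_integral => //.
- apply/measurable_realfun.measurable_EFinP.
  by apply: measurable_funS sub (measurable_oI_cI mp).
- apply/measurable_realfun.measurable_EFinP.
  by apply: measurable_funS sub (measurable_oI_cI mr).
have FF : Filter (almost_everywhere mu) by exact: ae_filter_ringOfSetsType.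
have hI : {ae mu, forall x : R, ((oI x -> p x = r x) /\ x != -1) /\ x != 1}.
  exact: filterI (filterI pr (ae_neq (-1))) (ae_neq 1).
apply: (ae_sub hI) => t [[ht t1] t2].
rewrite /= in_itv /= => /andP[ta tb]; rewrite ht // /oI /= in_itv /=.
by rewrite lt_neqAle eq_sym t1 ta lt_neqAle t2 (le_trans tb).
Qed.

Lemma cint_ae f g x : L2 f -> L2 g -> ae_eqI f g -> x <= 1 -> cint f x = cint g x.
Proof.
move=> [f1 f2 _] [g1 g2 _] fg x1; rewrite /cint; congr (_ +i* _).
  by apply: prim_ae => //; apply: (ae_sub fg) => t ht /ht ->.
by apply: prim_ae => //; apply: (ae_sub fg) => t ht /ht ->.
Qed.

Lemma cintB2 f g x : integ2 f -> integ2 g -> x <= 1 ->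
  cint (fun t => f t - g t) x = cint f x - cint g x.
Proof.
move=> [f1 f2] [g1 g2] x1; apply: eqC; rewrite /cint /= -primB //.
  by apply: eq_prim => // t _; rewrite ReD ReN.
by apply: eq_prim => // t _; rewrite ImD ImN.
Qed.

Lemma cintZr (c : R) f x : integ2 f -> x <= 1 ->
  cint (fun t => c%:C * f t) x = c%:C * cint f x.
Proof.
move=> [f1 f2] x1; apply: eqC; rewrite ?ReM ?ImM /cint /= mul0r ?subr0 ?addr0 -primZ //.
  by apply: eq_prim => // t _; rewrite ReM /= mul0r subr0.
by apply: eq_prim => // t _; rewrite ImM /= mul0r addr0.
Qed.

Lemma L2_integ2 g : L2 g -> integ2 g.
Proof. exact: L2_integ. Qed.

Lemma integ2Z (c : R) g : integ2 g -> integ2 (fun t => c%:C * g t).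
Proof.
move=> [g1 g2]; split.
  by under eq_fun do rewrite ReM /= mul0r subr0; exact: integZ.
by under eq_fun do rewrite ImM /= mul0r addr0; exact: integZ.
Qed.

Lemma hop_L2 f k : Hop delta h f k -> L2 (fun x => k x - z * f x).
Proof.
move=> [Lk [f2 [cf _ _ _ _] _]].
rewrite (_ : (fun x => _) = (fun x => k x + (- z) * f x)).
  by apply: L2D => //; apply: L2Z; apply: cbm_L2; exact: continuous_cI_cbm.
by apply/funext => x; rewrite mulNr.
Qed.

(** Integrate f'' = h^-2 ((V - z) f - g), with g = k - z f, from -1. This equation holds only almost
    everywhere, so it is used under the integral sign. *)
Lemma hop_vsol f k : Hop delta h f k -> exists f' c,
  vsol hq (fun x => c - (h ^- 2)%:C * cint (fun t => k t - z * f t) x) f f' /\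
  f 1 = 0.
Proof.
move=> T; have Lg := hop_L2 T; set g := (fun x => k x - z * f x) in Lg *.
have [Lk [f2 [cf fm fp Lf2 [f' [df cf' acf']]] kE]] := T.
have bf := continuous_cI_cbm cf; have bf' := continuous_cI_cbm cf'.
exists f', (f' (-1)); split => //; split => // x /andP[x0 x1].
  move: x0; rewrite le_eqVlt => /predU1P[<-|x0].
    by rewrite fm; apply: eqC; rewrite /cint /prim /= set_itv1 Rintegral_set1.
  have sub (p : R -> R) : {within `[-1, 1], continuous p} -> {within `[-1, x], continuous p}.
    by apply: continuous_subspaceW; apply: subset_itvl; rewrite bnd_simp.
  have ftc (p dp : R -> R) : {within `[-1, 1], continuous p} ->
      {within `[-1, 1], continuous dp} ->
      (forall t, -1 < t < 1 -> is_derive t (1 : R) p (dp t)) ->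
      prim dp x = p x - p (-1).
    move=> /sub cp /sub cdp hd.
    have := @continuous_FTC2 R dp p (-1) x x0 cdp.
    rewrite /prim /Rintegral => ->.
    - by rewrite -EFinB.
    - have [_ ? ?] := (continuous_within_itvP p x0).1 cp.
      split => // t; rewrite in_itv /= => /andP[t0 t1].
      have h1 : -1 < t < 1 by rewrite t0 (lt_le_trans t1).
      by case: (hd t h1).
    move=> t; rewrite in_itv /= => /andP[t0 t1]; rewrite derive1E.
    have h1 : -1 < t < 1 by rewrite t0 (lt_le_trans t1).
    by case: (hd t h1).
  have [c1 c2] := cf; have [c1' c2'] := cf'.
  have dr t : -1 < t < 1 -> is_derive t (1 : R) (fun s => Re (f s)) (Re (f' t)).
    by move=> t1; case: (df t) => //; rewrite /oI /= in_itv.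
  have di t : -1 < t < 1 -> is_derive t (1 : R) (fun s => Im (f s)) (Im (f' t)).
    by move=> t1; case: (df t) => //; rewrite /oI /= in_itv.
  have er := ftc _ _ c1 c1' dr; have ei := ftc _ _ c2 c2' di.
  by apply: eqC; rewrite /cint /= ?er ?ei fm subr0.
have := acf' (-1) x (lexx _) x0 x1; rewrite -[X in _ = X]/(cint f2 x) => e.
have -> : f' x = f' (-1) + cint f2 x by rewrite -e addrC subrK.
have Lq : L2 (fun t => hq t * f t - (h ^- 2)%:C * g t).
  rewrite (_ : (fun t => _) = (fun t => hq t * f t + (- (h ^- 2)%:C) * g t)).
    by apply: L2D; [apply/cbm_L2/cbmM => //; exact: cbm_hq|exact: L2Z].
  by apply/funext => t; rewrite mulNr.
have ae2 : ae_eqI f2 (fun t => hq t * f t - (h ^- 2)%:C * g t).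
  apply: (ae_sub kE) => t ht /ht kt.
  rewrite /hq /g kt.
  have hh : (h ^- 2)%:C * (h ^+ 2)%:C = 1 :> R[i].
    by rewrite -rmorphM mulVf // expf_neq0 // gt_eqF.
  by ring: hh.
rewrite (cint_ae Lf2 Lq ae2 x1) cintB2 //; last 2 first.
- by apply/cbm_integ2/cbmM => //; exact: cbm_hq.
- exact/integ2Z/L2_integ2.
by rewrite cintZr //; [ring|exact: L2_integ2].
Qed.

Lemma vsol_hop f f' c g : L2 g ->
  vsol hq (fun x => - (h ^- 2)%:C * cint g x - c * 1) f f' -> f 1 = 0 ->
  Hop delta h f (fun x => z * f x + g x).
Proof.
move=> Lg hv f1; have [bf bf' hf hf'] := hv.
have ig := L2_integ2 Lg.
have bq := cbm_hq.
pose F x := - (h ^- 2)%:C * cint g x - c * 1.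
have cF : continuous_cI F.
  apply: (@eq_continuous_cI (fun x => cint (fun t => (- h ^- 2)%:C * g t) x + - c)).
    by move=> x /andP[_ x1]; rewrite cintZr // /F mulr1 rmorphN.
  apply: continuous_cI_D; first exact/cint_continuous/integ2Z.
  by split => x; exact: cvg_cst.
have [cf cf'] := vsol_continuous bq hv cF.
pose f2 t := hq t * f t - (h ^- 2)%:C * g t.
have Lf2 : L2 f2.
  rewrite (_ : f2 = (fun t => hq t * f t + (- (h ^- 2)%:C) * g t)).
    by apply: L2D; [apply/cbm_L2/cbmM|exact: L2Z].
  by apply/funext => t; rewrite mulNr.
have f'E x : -1 <= x <= 1 -> f' x = - c + cint f2 x.
  move=> x01; have /andP[_ x1] := x01; rewrite hf' // /f2 cintB2 //; last 2 first.
  - exact/cbm_integ2/cbmM.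
  - exact: integ2Z.
  by rewrite cintZr //; ring.
split; first by apply: L2D => //; apply/L2Z/cbm_L2.
exists f2.
  split => //.
    rewrite hf; last by apply/andP; split; lra.
    by apply: eqC; rewrite /cint /prim /= set_itv1 Rintegral_set1.
  exists f'; split => //.
    by move=> x; rewrite /oI /= in_itv /= => x1; have [] := vsol_derive bq hv cF x1.
  move=> a b a0 ab b1.
  have a1 : a <= 1 by exact: le_trans b1. have b0 : -1 <= b by exact: le_trans ab.
  rewrite !f'E ?a0 ?b0 // [LHS](_ : _ = cint f2 b - cint f2 a); last by ring.
  have [i1 i2] := L2_integ2 Lf2.
  have key (p : R -> R) : integ p -> prim p b - prim p a = \int[mu]_(t in `[a, b]) p t.
    move=> ip; rewrite /prim Rintegral_itvB //; last exact: integ_sub.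
    rewrite Rintegral_itv_obnd_cbnd //; apply: integrableS ip => //.
    by apply: subset_itv; rewrite bnd_simp.
  by apply: eqC; rewrite /cint /= key.
apply: aeW => x _.
have hh : (h ^- 2)%:C * (h ^+ 2)%:C = 1 :> R[i].
  by rewrite -rmorphM mulVf // expf_neq0 // gt_eqF.
by rewrite /f2 /hq; ring: hh.
Qed.

Lemma resolvent_of_shooting u u' : vsol hq (fun=> 1) u u' -> u 1 != 0 ->
  resolvent_set (Hop delta h) z.
Proof.
move=> hu u1; have bq := cbm_hq.
have [C C0 hC] := dirichlet_bound bq hu u1.
split.
- move=> f1 k1 f2 k2 T1 T2 ae.
  have [f1' [c1 [v1 e1]]] := hop_vsol T1; have [f2' [c2 [v2 e2]]] := hop_vsol T2.
  have v := vsol_sub 1 bq v1 v2.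
  apply: aeW => x; rewrite /oI /= in_itv /= => /andP[x0 x1].
  have x01 : -1 <= x <= 1 by rewrite !ltW.
  (* The forcing of f1 - f2 is the constant c1 - c2, so the bound applies with E = 0. *)
  have := hC _ _ _ (c1 - c2) 0 v _ (lexx 0) _ x x01; rewrite mulr0 e1 e2 mulr0 subrr.
  move=> /(_ erefl) h1.
  have {}h1 : n1 (f1 x - 1 * f2 x) <= 0.
    apply: h1 => y /andP[_ y1].
    rewrite (cint_ae (hop_L2 T1) (hop_L2 T2) ae y1).
    rewrite (_ : _ - _ - _ = 0); first by rewrite /n1 /= !normr0 addr0.
    by ring.
  by have /n1_eq0 := h1; rewrite mul1r => /subr0_eq.
- move=> g Lg.
  have bF : cbm (fun x => - (h ^- 2)%:C * cint g x).
    apply: cbmM; first exact: cbm_cst.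
    by apply: continuous_cI_cbm; exact/cint_continuous/L2_integ2.
  have [f [f' [c [v f1]]]] := dirichlet_exists bq hu u1 bF.
  exists f, (fun x => z * f x + g x); split; first exact: vsol_hop v f1.
  by apply: aeW => x _; rewrite addrC addKr.
(* The 4 is the cost of bounding the primitive by the L^2 norm, the 2 that of returning from a
   pointwise bound to the L^2 norm. *)
exists (2 * (C * (n1 (h ^- 2)%:C * 4))) => f k T.
have [f' [c [v e]]] := hop_vsol T; have Lg := hop_L2 T.
set g := (fun x => k x - z * f x) in v Lg *.
have N0 : 0 <= L2norm g by exact: sqrtr_ge0.
have bf : cbm f by case: v.
have b x : -1 <= x <= 1 -> n1 (f x) <= C * (n1 (h ^- 2)%:C * (4 * L2norm g)).
  apply: (hC _ _ _ c _ v e); first by rewrite !mulr_ge0 ?n1_ge0.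
  move=> y y1; rewrite addrC addKr n1N.
  apply: le_trans (n1M _ _) _; rewrite ler_wpM2l ?n1_ge0 //.
  exact: n1_cint_L2.
have [_ ] := L2_bounded bf b; rewrite !mulrA; exact.
Qed.

End Hop.

End Resolvent.

(** * The shooting solution on the two halves of the interval *)

Section EdgesOfShooting.
Variables (R : realType) (delta h : R) (z : R[i]) (u u' : R -> R[i]).
Hypothesis hu : vsol (hq delta h z) (fun=> 1) u u'.

Lemma continuous_cI_1 : continuous_cI (fun=> 1 : R[i]).
Proof. by split=> x; exact: cvg_cst. Qed.

Lemma shooting_continuous : continuous_cI u /\ continuous_cI u'.
Proof. exact: vsol_continuous (cbm_hq _ _ _) hu continuous_cI_1. Qed.

Lemma shooting_left : u (-1) = 0 /\ u' (-1) = 1.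
Proof.
have [_ _ e e'] := hu.
have c0 g : cint g (-1) = 0 :> R[i].
  by apply: eqC; rewrite /cint /prim /= set_itv1 Rintegral_set1.
have i1 : -1 <= (-1 : R) <= 1 by apply/andP; split; lra.
by rewrite e // e' // !c0 addr0.
Qed.

Lemma continuous_eq_pt (p r : R -> R) (x : R) (P : R -> Prop) :
  (\forall t \near x, P t) -> (forall t, P t -> p t = r t) ->
  {for x, continuous p} -> {for x, continuous r}.
Proof.
move=> hP pr cp; have Px := nbhs_singleton hP.
rewrite /prop_for /continuous_at -(pr _ Px).
apply: cvg_trans cp; apply: near_eq_cvg.
by apply: filterS hP => t /pr.
Qed.

(** Where V agrees near x with an affine function, the integrand q u is continuous at x, so u' is
    differentiable in the classical sense. The offset d is delta on the right and - delta on the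
    left. *)
Lemma shooting_derive (x d : R) (P : R -> Prop) : -1 < x < 1 ->
  (\forall t \near x, P t) -> (forall t, P t -> Vdelta delta t = (t + d)*i) ->
  cderiv u x (u' x) /\ cderiv u' x ((h ^- 2)%:C * ((x + d)*i - z) * u x).
Proof.
move=> x1 hP hV; have bq := cbm_hq delta h z.
have du y : -1 < y < 1 -> cderiv u y (u' y) by exact: (vsol_derive bq hu continuous_cI_1).
split; first exact: du.
have [bu bu' e e'] := hu.
pose g t : R[i] := (h ^- 2)%:C * ((t + d)*i - z) * u t.
have [dg hdg] : exists dg, cderiv g x dg.
  have dl : cderiv (fun t : R => (t + d)*i) x ('i%C).
    by split => /=; [exact: is_derive_cst|
      apply: is_derive_eq (is_derive_add (is_derive_id x (1 : R)) (is_derive_cst d _ _)) _;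
      rewrite addr0].
  eexists; apply: cderivM (du x x1).
  exact: cderivMl (cderivB dl (cderiv_cst z x)).
have qg t : P t -> g t = hq delta h z t * u t by move=> Pt; rewrite /hq hV.
have Px := nbhs_singleton hP.
have : cderiv (fun y => 1 + cint (fun t => hq delta h z t * u t) y) x (0 + g x).
  apply: cderivD; first exact: cderiv_cst.
  rewrite qg //; apply: cint_derive => //.
  - exact/cbm_integ2/cbmM.
  - apply: (continuous_eq_pt hP) (cderiv_continuous_Re hdg) => t /qg -> //.
  apply: (continuous_eq_pt hP) (cderiv_continuous_Im hdg) => t /qg -> //.
rewrite add0r; apply: near_eq_cderiv => // t /andP[t0 t1].
by rewrite e' // !ltW.
Qed.

Lemma near_gt0 (x : R) : 0 < x -> \forall t \near x, 0 < t.
Proof. by move=> x0; apply: lt_nbhsr. Qed.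

Lemma near_lt0 (x : R) : x < 0 -> \forall t \near x, t < 0.
Proof. by move=> x0; apply: lt_nbhsl. Qed.

Lemma shooting_right_edge : u 1 = 0 -> edge_solution h (edge_pot delta z) u u'.
Proof.
move=> u1; have [[c1 c2] [c1' c2']] := shooting_continuous.
have sub (p : R -> R) : {within `[-1, 1], continuous p} -> {within `[0, 1], continuous p}.
  by apply: continuous_subspaceW; apply: subset_itvr; rewrite bnd_simp; lra.
split => //; [by split; exact: sub|by split; exact: sub|].
move=> x /andP[x0 x1]; have x11 : -1 < x < 1 by apply/andP; split; lra.
have [|d1 d2] := shooting_derive x11 (near_gt0 x0) (d := delta).
  by move=> t t0; rewrite /Vdelta ltNge ltW //= t0.
split => //; apply: cderiv_eq d2 _; congr (_ * _ * _).
by rewrite /edge_pot; case: (z) => a b; apply: eqC => /=; ring.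
Qed.

(** Since conj V(- x) = V(x) away from 0, reflection and conjugation turn the left half into the
    right half with conj z in place of z. The zero at 1 is u(-1) = 0. *)
Lemma shooting_left_edge : edge_solution h (edge_pot delta (conjc z))
  (fun x => conjc (u (- x))) (fun x => - conjc (u' (- x))).
Proof.
have [[c1 c2] [c1' c2']] := shooting_continuous.
have [um _] := shooting_left.
have opp (p : R -> R) : {within `[-1, 1], continuous p} ->
    {within `[0, 1], continuous (fun x => p (- x))}.
  move=> cp; apply/(continuous_within_itvP _ ltr01).
  have ab : -1 < 1 :> R by lra.
  have [_ cl _] := (continuous_within_itvP p ab).1 cp.
  have int (x : R) : -1 < x < 1 -> {for x, continuous (fun t => p (- t))}.
    move=> /andP[x0 x1]; apply: (@continuous_comp _ _ _ -%R p).
      exact: opp_continuous.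
    by apply: within_for => //; apply/andP; split; lra.
  split.
  - by move=> x; rewrite in_itv /= => /andP[x0 x1]; apply: int; apply/andP; split; lra.
  - by apply: cvg_at_right_filter; apply: int; apply/andP; split; lra.
  by apply/cvg_at_leftNP; rewrite /comp; under eq_fun do rewrite opprK.
split.
- split.
    rewrite (_ : (fun x => _) = (fun x => Re (u (- x)))).
      exact: (opp (fun x => Re (u x))).
    by apply/funext => x; rewrite Re_conj.
  rewrite (_ : (fun x => _) = (fun x => - Im (u (- x)))).
    apply: within_continuous_opp; exact: (opp (fun x => Im (u x))).
  by apply/funext => x; rewrite Im_conj.
- split.
    rewrite (_ : (fun x => _) = (fun x => - Re (u' (- x)))).
      apply: within_continuous_opp; exact: (opp (fun x => Re (u' x))).
    by apply/funext => x; rewrite ReN Re_conj.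
  rewrite (_ : (fun x => _) = (fun x => Im (u' (- x)))).
    exact: (opp (fun x => Im (u' x))).
  by apply/funext => x; rewrite ImN Im_conj opprK.
- by rewrite um; apply: eqC => //=; rewrite oppr0.
move=> x /andP[x0 x1]; have x11 : -1 < - x < 1 by apply/andP; split; lra.
have x0' : - x < 0 by lra.
have [|d1 d2] := shooting_derive x11 (near_lt0 x0') (d := - delta).
  by move=> t t0; rewrite /Vdelta t0.
have cN f d : cderiv f (- x) d -> cderiv (fun t => f (- t)) x (- d).
  have dN : is_derive x (1 : R) (fun t => - t) (-1) by exact: is_derive_opp (is_derive_id x (1 : R)).
  move=> [h1 h2]; split.
    by apply: is_derive_eq (is_derive1_comp (g := fun t => - t) h1 dN) _; rewrite ReN mulrN1.
  by apply: is_derive_eq (is_derive1_comp (g := fun t => - t) h2 dN) _; rewrite ImN mulrN1.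
split.
  by apply: cderiv_eq (cderiv_conj (cN _ _ d1)) _; rewrite rmorphN.
apply: cderiv_eq (cderivN (cderiv_conj (cN _ _ d2))) _.
rewrite rmorphN opprK !rmorphM; congr (_ * _ * _).
  by apply: eqC => //=; rewrite oppr0.
by rewrite /edge_pot; case: (z) => a b; apply: eqC => /=; ring.
Qed.

End EdgesOfShooting.

(** * Conjugation symmetry of S and the matching at 0 *)

Lemma Nhd_subset (R : realType) (A B : set R[i]) (eps : R) : A `<=` B ->
  Nhd A eps `<=` Nhd B eps.
Proof. by move=> AB w [s [z [As zs ->]]]; exists s, z; split => //; exact: AB. Qed.

Lemma Splus_sub (R : realType) (delta : R) : Splus delta `<=` Sset delta.
Proof.
move=> w [[h|h]|h].
- by do 5!left.
- by do 4!left; right.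
by left; right.
Qed.

Lemma conj_Splus_sub (R : realType) (delta : R) w : Splus delta w ->
  Sset delta (conjc w).
Proof.
have cseg (a b v : R[i]) : segment a b v -> segment (conjc a) (conjc b) (conjc v).
  move=> [t t01 ->]; exists t => //; rewrite rmorphD !rmorphM.
  by congr (_ * _ + _ * _); apply: eqC => //=; rewrite oppr0.
have cG : conjc (Gammap delta) = Gammam delta by [].
move=> [[h|h]|[r r0 ->]].
- do 3!left; right; have := cseg _ _ _ h; rewrite cG.
  by rewrite (_ : conjc _ = (- delta)*i) //; apply: eqC => //=; rewrite oppr0.
- do 2!left; right; have := cseg _ _ _ h; rewrite cG.
  by rewrite (_ : conjc _ = (- (1 + delta))*i) //; apply: eqC => //=; rewrite oppr0.
right; exists r => //; rewrite -cG [LHS]rmorphD; congr (_ + _).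
by apply: eqC => //=; rewrite oppr0.
Qed.

Lemma Nhd_conj (R : realType) (delta eps : R) (z : R[i]) :
  Nhd (Splus delta) eps (conjc z) -> Nhd (Sset delta) eps z.
Proof.
move=> [s [w [hs hw e]]]; exists (conjc s), (conjc w); split.
- exact: conj_Splus_sub.
- by move: hw; rewrite !normc_def Re_conj Im_conj sqrrN.
by rewrite -[RHS]rmorphD -e [RHS]conjcK.
Qed.

Theorem corollary4 (R : realType) (delta : R) (hdelta : 0 < delta)
    (eps : R) (heps : 0 < eps) (N : nat) (hN : (0 < N)%N) :
  exists h0 : R, 0 < h0 /\
    forall h : R, 0 < h -> h < h0 ->
      Spec (Hop delta h) `&` [set z : R[i] | `|z| <= N%:R]
        `<=` Nhd (Sset delta) eps.
Proof.
(* 2 D bounds |V - z|^2 on both sides of 0 when |z| <= N, and [eta] makes each of the two errors at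
   most (delta^2 / 2) |u(0)|^4. *)
pose D : R := delta ^+ 2 + N%:R ^+ 2.
have d2 : 0 < delta ^+ 2 by rewrite exprn_gt0.
have D0 : 0 < D by rewrite ltr_wpDr // sqr_ge0.
pose eta := delta ^+ 2 / (4 * D).
have eta0 : 0 < eta by rewrite divr_gt0 // mulr_gt0.
have etaD : eta * (4 * D) = delta ^+ 2 by rewrite divfK // gt_eqF // mulr_gt0.
have [h0 h00 H] := edge_uniform delta N heps eta0.
exists h0; split => // h hpos hlt z [/= zspec zN].
apply: contrapT => nz.
have nsqzN : nsq z <= N%:R ^+ 2.
  move: zN; rewrite normc_def -(rmorph_nat (real_complex R)) lecR => zN.
  rewrite /nsq -[leLHS]sqr_sqrtr; last by rewrite addr_ge0 // sqr_ge0.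
  by rewrite ler_pXn2r ?nnegrE ?sqrtr_ge0.
have hRe : `|Re z| <= N%:R.
  rewrite -(@ler_pXn2r _ 2) ?nnegrE // real_normK ?num_real //.
  exact: le_trans (Re_sqr_le z) nsqzN.
have hIm : `|Im z| <= N%:R.
  rewrite -(@ler_pXn2r _ 2) ?nnegrE // real_normK ?num_real //.
  exact: le_trans (Im_sqr_le z) nsqzN.
have nz1 : ~ Nhd (Splus delta) eps z by move=> /(Nhd_subset (@Splus_sub R delta)).
have nz2 : ~ Nhd (Splus delta) eps (conjc z) by move=> /Nhd_conj.
have [u [u' hu]] := vsol_exists (cbm_hq delta h z) (cbm_cst (1 : R[i])).
have [u1|u1] := eqVneq (u 1) 0; last exact: zspec (resolvent_of_shooting hpos hu u1).
have er := shooting_right_edge hu u1; have el := shooting_left_edge hu.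
have [Hr Hr0] := H h z hpos hlt hRe hIm nz1 _ _ er.
have hRe' : `|Re (conjc z)| <= N%:R by rewrite Re_conj.
have hIm' : `|Im (conjc z)| <= N%:R by rewrite Im_conj normrN.
have [Hl _] := H h (conjc z) hpos hlt hRe' hIm' nz2 _ _ el.
have nsqc (w : R[i]) : nsq (conjc w) = nsq w by rewrite /nsq Re_conj Im_conj sqrrN.
set Pr := edge_pot delta z - 'i%C in Hr.
set Pl := edge_pot delta (conjc z) - 'i%C in Hl.
have ndi : nsq (delta*i) = delta ^+ 2 by rewrite /nsq /= expr0n add0r.
have nPr : nsq Pr <= 2 * D.
  have -> : Pr = delta*i + - z.
    by rewrite /Pr /edge_pot; case: (z) => a b; apply: eqC => /=; ring.
  apply: le_trans (nsqD_le _ _) _; rewrite nsqN ndi /D; lra.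
have nPl : nsq Pl <= 2 * D.
  have -> : Pl = delta*i + - conjc z.
    by rewrite /Pl /edge_pot; case: (z) => a b; apply: eqC => /=; ring.
  apply: le_trans (nsqD_le _ _) _; rewrite nsqN nsqc ndi /D; lra.
have u00 : u 0 = 0.
  move: Hr Hl; rewrite oppr0 sqrrN nsqc.
  set U := nsq (u 0) ^+ 2; set X := _ - Pr * _; set Y := _ - Pl * _ => HX HY.
  have U0 : 0 <= U by rewrite sqr_ge0.
  (* The terms with u'(0)^2 cancel and - 2 i delta u(0)^2 remains. Its squared modulus 4 delta^2 U
     is at most 2 |X|^2 + 2 |Y|^2 <= 2 delta^2 U, which forces U = 0. *)
  have e : nsq (X - conjc Y) = 4 * delta ^+ 2 * U.
    have -> : X - conjc Y = (2 * delta)%:C * - 'i%C * u 0 ^+ 2.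
      rewrite /X /Y /Pr /Pl /edge_pot !expr2.
      move: (u 0) (u' 0) => [a1 a2] [b1 b2].
      by case: (z) => x y; apply: eqC => /=; ring.
    rewrite expr2 !nsqM nsqN nsq_i nsq_real /U; ring.
  have := nsqD_le X (- conjc Y); rewrite e nsqN nsqc => hXY.
  have b1 : eta * nsq Pr * U <= delta ^+ 2 / 2 * U.
    rewrite ler_wpM2r //; have := ler_wpM2l (ltW eta0) nPr; lra.
  have b2 : eta * nsq Pl * U <= delta ^+ 2 / 2 * U.
    rewrite ler_wpM2r //; have := ler_wpM2l (ltW eta0) nPl; lra.
  have : delta ^+ 2 * U <= 0 by lra.
  rewrite pmulr_rle0 // => Ule; apply: nsq_eq0.
  by apply/eqP; rewrite -sqrf_eq0 eq_le Ule.
have v0 : u' 0 = 0 by exact: Hr0.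
(* Zero Cauchy data at 0 propagate through the reflected solution to u'(-1) = 0, against the
   normalisation u'(-1) = 1. *)
have := edge_solution_eq0 el; rewrite oppr0 u00 v0 conjc0 oppr0 => /(_ erefl erefl).
have [_ ->] := shooting_left hu.
by rewrite conjc1 => /eqP; rewrite oppr_eq0 oner_eq0.
Qed.
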